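(* Let $n\ge 5$, let $2^\sharp=\frac{2n}{n-4}$, let $(M,g)$ be any smooth compact Riemannian manifold of dimension $n-1$, and let $M_1=S^1\times M$, where $S^1$ is the circle of radius $1$ in $\mathbb R^2$, equipped with the product metric $g_1$ of the standard metric of $S^1$ and $g$. For $\alpha>0$ consider on $M_1$ the equation $$\left(\Delta_{g_1}+\frac{\alpha}{2}\right)^2u=u^{2^\sharp-1},\qquad u>0,\qquad (E_\alpha)$$ and let $E_m(\alpha)$ be the infimum of $E(u)=\int_{M_1}|u|^{2^\sharp}dv_{g_1}$ over all positive solutions $u\in H_2^2(M_1)$ of $(E_\alpha)$. Then there exists a sequence $(\alpha_k)$ of positive real numbers with $\alpha_k\to+\infty$ as $k\to+\infty$ such that, for every $k$, equation $(E_{\alpha_k})$ possesses a smooth positive nonconstant solution on $M_1$, and $E_m(\alpha_k)$ is not realized by the constant solution $\overline u_{\alpha_k}=(\alpha_k^2/4)^{(n-4)/8}$, i.e. $E_m(\alpha_k)<E(\overline u_{\alpha_k})$.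
   Context: Convention: $\Delta_{g_1}=-\mathrm{div}_{g_1}\nabla$ is the Laplace-Beltrami operator with nonnegative spectrum; $dv_{g_1}$ is the Riemannian volume element. Compact means compact without boundary. $H_2^2(M_1)$ is the Sobolev space of functions $u\in L^2$ such that $|\nabla u|$ and $|\nabla^2u|$ are also in $L^2$. Solutions of the equation are always required to be positive. *)

(* Defs.v *)
From HB Require Import structures.
From mathcomp Require Import all_boot all_order all_algebra.
From mathcomp Require Import all_classical all_reals all_analysis.
Set Implicit Arguments.
Unset Strict Implicit.
Unset Printing Implicit Defensive.
Import Order.TTheory GRing.Theory Num.Theory.
Import numFieldNormedType.Exports.
Local Open Scope classical_set_scope.
Local Open Scope ring_scope.

(* Lebesgue measure on R^d, as an iterated product. It lives on [d.-tuple R]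
   with the product sigma-algebra, whereas the differential calculus takes
   place on ['rV[R]_d]; [rowt] below identifies the two. *)

Section cons_measure.
Context (R : realType) (d : nat).
Variable mu : {sigma_finite_measure set (d.-tuple R) -> \bar R}.

Definition consT (p : measurableTypeR R * d.-tuple R) : d.+1.-tuple R :=
  [the d.+1.-tuple R of p.1 :: p.2].

Lemma measurable_consT : measurable_fun setT consT.
Proof. exact: measurable_cons measurable_fst measurable_snd. Qed.

Definition cons_measure : set (d.+1.-tuple R) -> \bar R :=
  pushforward ((@lebesgue_measure R) \x mu)%E consT.

Let cons_measure0 : cons_measure set0 = 0%E.
Proof. by rewrite /cons_measure /pushforward preimage_set0 measure0. Qed.

Let cons_measure_ge0 A : (0 <= cons_measure A)%E.
Proof. exact: (@measure_ge0 _ _ _ ((@lebesgue_measure R) \x mu)%E). Qed.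

Let cons_measure_sigma_additive : semi_sigma_additive cons_measure.
Proof.
move=> F mF tF mUF.
have m (A : set (d.+1.-tuple R)) : measurable A -> measurable (consT @^-1` A).
  by move=> mA; rewrite -[X in measurable X]setTI; exact: measurable_consT.
rewrite /cons_measure /pushforward preimage_bigcup.
apply: measure_semi_sigma_additive => [n||]; first exact: m.
  apply/trivIsetP => /= i j _ _ ij; rewrite -preimage_setI.
  by move/trivIsetP : tF => /(_ _ _ _ _ ij) ->//; rewrite preimage_set0.
by rewrite -preimage_bigcup; exact: m.
Qed.

HB.instance Definition _ := isMeasure.Build _ _ _ cons_measure
  cons_measure0 cons_measure_ge0 cons_measure_sigma_additive.

Let cons_measure_sigma_finite : sigma_finite setT cons_measure.
Proof.
have /sigma_finiteP[F [TF ndF Foo]] := sigma_finiteT (@lebesgue_measure R).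
have /sigma_finiteP[G [TG ndG Goo]] := sigma_finiteT mu.
pose unc (t : d.+1.-tuple R) : measurableTypeR R * d.-tuple R :=
  (thead t, [tuple of behead t]).
have consTK : cancel consT unc.
  by move=> [x t]; rewrite /consT /unc /=; congr pair; exact/val_inj.
have munc : measurable_fun setT unc.
  apply/measurable_fun_pairP; split; first exact: measurable_tnth.
  exact: measurable_behead.
exists (fun n => unc @^-1` (F n `*` G n)).
  apply/seteqP; split=> // t _.
  have [n _ Fn] : (\bigcup_n F n) (unc t).1 by rewrite -TF.
  have [m _ Gm] : (\bigcup_n G n) (unc t).2 by rewrite -TG.
  exists (maxn n m) => //; split.
    by move: Fn; exact/subsetPset/ndF/leq_maxl.
  by move: Gm; exact/subsetPset/ndG/leq_maxr.
move=> n; have [mF Fn] := Foo n; have [mG Gn] := Goo n; split.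
  by rewrite -[X in measurable X]setTI; apply: munc => //; exact: measurableX.
rewrite /cons_measure /pushforward -comp_preimage.
rewrite (_ : unc \o consT = id); last by apply/funext => x /=; exact: consTK.
by rewrite preimage_id product_measure1E// lte_mul_pinfty// ge0_fin_numE.
Qed.

HB.instance Definition _ := Measure_isSigmaFinite.Build _ _ _ cons_measure
  cons_measure_sigma_finite.

End cons_measure.

Fixpoint leb (R : realType) (d : nat) :
    {sigma_finite_measure set (d.-tuple R) -> \bar R} :=
  match d with
  | 0 => \d_([tuple])
  | d'.+1 => cons_measure (leb R d')
  end.

Definition rowt (R : realType) (d : nat) (t : d.-tuple R) : 'rV[R]_d :=
  \row_a tnth t a.

Section euclidean.
Context {R : realType} {d : nat}.
Implicit Types (O A : set 'rV[R]_d) (f w phi : 'rV[R]_d -> R) (a b : 'I_d).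

Definition leint A f : \bar R :=
  (\int[leb R d]_(t in @rowt R d @^-1` A) (f (rowt t))%:E)%E.

Definition partial a f : 'rV[R]_d -> R := 'D_(delta_mx 0 a) f.

(* For open [O], differentiability of all the iterated partial derivatives
   at every point of [O] is C^oo regularity on [O]. *)
Definition smooth_on O f : Prop :=
  forall (s : seq 'I_d) x, O x -> differentiable (foldr partial f s) x.

Definition test_function O phi : Prop :=
  smooth_on setT phi /\
  exists K, [/\ compact K, K `<=` O & forall x, ~ K x -> phi x = 0].

(* The integrability requirement of [locally_integrable], for functions of
   d variables. *)
Definition loc_integrable O f : Prop :=
  measurable_fun (@rowt R d @^-1` O) (f \o @rowt R d) /\
  forall K, compact K -> K `<=` O -> (leint K (fun x => `|f x|%R) < +oo)%E.

Definition weak_partial O a f w : Prop :=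
  [/\ loc_integrable O f, loc_integrable O w &
      forall phi, test_function O phi ->
        leint O (fun x => f x * partial a phi x) =
        (- leint O (fun x => (w x * phi x)%R))%E].

(* From here on, [g] is the matrix of a metric in some local coordinates. *)

Variable g : 'rV[R]_d -> 'M[R]_d.

Definition vol_density (x : 'rV[R]_d) : R := Num.sqrt (\det (g x)).

(* [- div (grad f)] *)
Definition laplacian f (x : 'rV[R]_d) : R :=
  - (vol_density x)^-1 *
  \sum_a partial a
    (fun y => vol_density y * \sum_b invmx (g y) a b * partial b f y) x.

Definition shifted_laplacian (alpha : R) f (x : 'rV[R]_d) : R :=
  laplacian f x + alpha / 2 * f x.

Definition paneitz (alpha : R) f : 'rV[R]_d -> R :=
  shifted_laplacian alpha (shifted_laplacian alpha f).

Definition christoffel (c a b : 'I_d) (x : 'rV[R]_d) : R :=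
  2^-1 * \sum_e invmx (g x) c e *
    (partial a (fun y => g y e b) x + partial b (fun y => g y a e) x -
     partial e (fun y => g y a b) x).

(* [|grad f|^2] and [|Hess f|^2], when [w1] and [w2] are the first and second
   partial derivatives of [f]. *)
Definition grad_sqnorm (w1 : 'I_d -> 'rV[R]_d -> R) (x : 'rV[R]_d) : R :=
  \sum_a \sum_b invmx (g x) a b * w1 a x * w1 b x.

Definition hessian (w1 : 'I_d -> 'rV[R]_d -> R)
    (w2 : 'I_d -> 'I_d -> 'rV[R]_d -> R) (a b : 'I_d) (x : 'rV[R]_d) : R :=
  w2 a b x - \sum_c christoffel c a b x * w1 c x.

Definition hess_sqnorm (w1 : 'I_d -> 'rV[R]_d -> R)
    (w2 : 'I_d -> 'I_d -> 'rV[R]_d -> R) (x : 'rV[R]_d) : R :=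
  \sum_a \sum_b \sum_a' \sum_b' invmx (g x) a a' * invmx (g x) b b' *
    hessian w1 w2 a b x * hessian w1 w2 a' b' x.

End euclidean.

(* A chart of the space [T], with the matrix of a metric in this chart.
   [param] is meant to be the inverse of [coord]; only the restriction of
   [coord] to [dom] and those of [param] and [metric] to [chart_im] matter. *)
Record chart (R : realType) (T : Type) (d : nat) := Chart {
  dom : set T;
  coord : T -> 'rV[R]_d;
  param : 'rV[R]_d -> T;
  metric : 'rV[R]_d -> 'M[R]_d }.

Definition chart_im (R : realType) (T : Type) (d : nat) (c : chart R T d) :
  set 'rV[R]_d := coord c @` dom c.

(* The data of a Riemannian manifold with a finite atlas; the axioms are in
   [compact_riemannian] below. On a compact manifold every atlas contains a
   finite one, defining the same smooth structure. *)
Record rmanifold (R : realType) (d : nat) := RManifold {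
  space :> topologicalType;
  chart_index : finType;
  atlas : chart_index -> chart R space d }.

Arguments atlas {R d}.

Record compact_riemannian (R : realType) (d : nat) (X : rmanifold R d) :
    Prop := {
  space_nonempty : [set: X] !=set0;
  space_hausdorff : hausdorff_space X;
  space_compact : compact [set: X];
  atlas_cover : forall p : X, exists i, dom (atlas X i) p;
  dom_open : forall i, open (dom (atlas X i));
  chart_im_open : forall i, open (chart_im (atlas X i));
  coordK : forall i p, dom (atlas X i) p ->
    param (atlas X i) (coord (atlas X i) p) = p;
  coord_continuous : forall i p, dom (atlas X i) p ->
    {for p, continuous (coord (atlas X i))};
  param_continuous : forall i x, chart_im (atlas X i) x ->
    {for x, continuous (param (atlas X i))};
  transition_smooth : forall i j a,
    smooth_on (coord (atlas X i) @` (dom (atlas X i) `&` dom (atlas X j)))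
      (fun x => coord (atlas X j) (param (atlas X i) x) 0 a);
  metric_smooth : forall i a b,
    smooth_on (chart_im (atlas X i)) (fun x => metric (atlas X i) x a b);
  metric_sym : forall i x, chart_im (atlas X i) x ->
    (metric (atlas X i) x)^T = metric (atlas X i) x;
  metric_posdef : forall i x (v : 'rV[R]_d), chart_im (atlas X i) x ->
    v != 0 -> 0 < (v *m metric (atlas X i) x *m v^T) 0 0;
  (* ['J f x] acts on row vectors, on the right *)
  metric_transition : forall i j p,
    dom (atlas X i) p -> dom (atlas X j) p ->
    let x := coord (atlas X i) p in
    let J := 'J (coord (atlas X j) \o param (atlas X i)) x in
    metric (atlas X i) x =
      J *m metric (atlas X j) (coord (atlas X j) p) *m J^T }.

Section circle.
Context (R : realType).

Definition circle : set (R * R) := [set p | p.1 ^+ 2 + p.2 ^+ 2 = 1].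

Lemma circle_cos_sin (t : R) : (cos t, sin t) \in circle.
Proof. by apply/mem_set; rewrite /circle /= cos2Dsin2. Qed.

Definition circle_pt (t : R) : circle :=
  exist _ (cos t, sin t) (circle_cos_sin t).

(* The angle in [(-pi, pi)] of the point [(x, y)] of the circle other than
   [(-1, 0)]: half of it has tangent [y / (1 + x)]. *)
Definition angle (p : R * R) : R := 2 * atan (p.2 / (1 + p.1)).

(* Two angular coordinates, in [(-pi, pi)] and in [(0, 2 pi)]. The metric
   induced by R^2 is [dt^2], since [t |-> (cos t, sin t)] has unit speed. *)
Definition circle_chart (b : bool) : chart R circle 1 :=
  if b then
    {| dom := [set p | set_val p <> (1, 0)];
       coord := fun p => const_mx (pi + angle (- set_val p));
       param := fun x => circle_pt (x 0 0);
       metric := fun=> 1%:M |}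
  else
    {| dom := [set p | set_val p <> (-1, 0)];
       coord := fun p => const_mx (angle (set_val p));
       param := fun x => circle_pt (x 0 0);
       metric := fun=> 1%:M |}.

Definition S1 : rmanifold R 1 :=
  {| space := circle : topologicalType; atlas := circle_chart |}.

End circle.

Definition prod_chart (R : realType) (T1 T2 : Type) (d1 d2 : nat)
    (c1 : chart R T1 d1) (c2 : chart R T2 d2) : chart R (T1 * T2) (d1 + d2) :=
  {| dom := dom c1 `*` dom c2;
     coord := fun p => row_mx (coord c1 p.1) (coord c2 p.2);
     param := fun x => (param c1 (lsubmx x), param c2 (rsubmx x));
     metric := fun x =>
       block_mx (metric c1 (lsubmx x)) 0 0 (metric c2 (rsubmx x)) |}.

Definition rprod (R : realType) (d1 d2 : nat)
    (X1 : rmanifold R d1) (X2 : rmanifold R d2) : rmanifold R (d1 + d2) :=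
  {| space := (X1 * X2)%type : topologicalType;
     chart_index := (chart_index X1 * chart_index X2)%type : finType;
     atlas := fun i => prod_chart (atlas X1 i.1) (atlas X2 i.2) |}.

Section analysis.
Context {R : realType} {d : nat} (X : rmanifold R d).
Implicit Types (i : chart_index X) (u f : X -> R).

Definition local_rep i f : 'rV[R]_d -> R := f \o param (atlas X i).

(* Integral over the domain of a chart for the Riemannian volume, of a
   function expressed in this chart. *)
Definition chart_int i (h : 'rV[R]_d -> R) : \bar R :=
  leint (chart_im (atlas X i))
    (fun x => h x * vol_density (metric (atlas X i)) x).

Definition chart_multiplicity (p : X) : nat :=
  #|[pred i | p \in dom (atlas X i)]|.

(* Integral of [f] for the Riemannian volume: each point is shared equally
   between the charts containing it, i.e. the partition of unity made of the
   indicators of the chart domains divided by their sum. *)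
Definition vol_int f : \bar R :=
  (\sum_i chart_int i
     (local_rep i (fun p => f p / (chart_multiplicity p)%:R)%R))%E.

Definition smooth_fun f : Prop :=
  forall i, smooth_on (chart_im (atlas X i)) (local_rep i f).

(* The Sobolev space H_2^2: u, |grad u| and |Hess u| are in L^2, with weak
   derivatives. As the atlas is finite, a function is in L^2 for the
   Riemannian volume iff it is so on the domain of each chart. *)
Definition sobolev22 u : Prop :=
  forall i, let g := metric (atlas X i) in let O := chart_im (atlas X i) in
  exists (w1 : 'I_d -> 'rV[R]_d -> R) (w2 : 'I_d -> 'I_d -> 'rV[R]_d -> R),
    [/\ forall a, weak_partial O a (local_rep i u) (w1 a),
        forall a b, weak_partial O a (w1 b) (w2 a b),
        (chart_int i (fun x => local_rep i u x ^+ 2)%R < +oo)%E,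
        (chart_int i (grad_sqnorm g w1) < +oo)%E &
        (chart_int i (hess_sqnorm g w1 w2) < +oo)%E].

Definition ae_positive u : Prop :=
  forall i, {ae leb R d, forall t,
    chart_im (atlas X i) (rowt t) -> 0 < local_rep i u (rowt t)}.

(* The equation [(Delta + alpha / 2)^2 u = u ^ q], for smooth [u]... *)
Definition classical_solution (alpha q : R) u : Prop :=
  forall i x, chart_im (atlas X i) x ->
    paneitz (metric (atlas X i)) alpha (local_rep i u) x =
    local_rep i u x `^ q.

(* ...and in the sense of distributions, i.e. tested in each chart against
   compactly supported smooth functions. The operator is formally
   self-adjoint for the Riemannian volume. *)
Definition weak_solution (alpha q : R) u : Prop :=
  forall i phi, test_function (chart_im (atlas X i)) phi ->
    chart_int i (fun x =>
      local_rep i u x * paneitz (metric (atlas X i)) alpha phi x) =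
    chart_int i (fun x => local_rep i u x `^ q * phi x).

End analysis.

Section critical_equation.
Context {R : realType} (n : nat).

Definition two_sharp : R := (2 * n)%:R / (n%:R - 4).

Definition energy {d : nat} (X : rmanifold R d) (u : X -> R) : \bar R :=
  vol_int (fun p => `|u p| `^ two_sharp).

Definition least_energy {d : nat} (X : rmanifold R d) (alpha : R) : \bar R :=
  ereal_inf [set energy u | u in [set u : X -> R |
    [/\ sobolev22 u, ae_positive u &
        weak_solution alpha (two_sharp - 1) u]]].

Definition constant_solution (alpha : R) : R :=
  (alpha ^+ 2 / 4) `^ ((n%:R - 4) / 8).

End critical_equation.

(* Main.v *)
(* A function of the angle of the circle solves the equation iff, as a
   2 pi-periodic function V > 0, it satisfies D^4 V - a D^2 V + a^2/4 V = V^q,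
   where q + 1 is the critical exponent. With b^2 = a/2, let K be the inverse of
   (b^2 - D^2)^2 on periodic functions; such solutions are, up to a factor, the
   critical points of J(w) = int w^q K(w^q) under the constraint
   int w^(q+1) = 1. The operators (b^2 - D^2)^-1 produce functions whose
   logarithm is b-Lipschitz, so J may be maximized over e^l with l periodic and
   b-Lipschitz, which is a compact problem, and convexity shows that the
   maximizer is a fixed point of the normalized map w |-> K(w^q). A test function
   independent of a, proportional to 2 + cos, has for all large a a larger J than
   the constant; the scaled maximizer V then has less energy than the constant
   solution, and in particular is not constant.

   On the product, the metric splits and V only depends on the first coordinate,
   so the differential operators reduce to derivatives of V, and by Tonelli the
   energy is a one-dimensional integral times the volume of M. One still has to
   know that this volume is finite, although the charts of M may be unbounded.
   This is obtained without a change of variables formula, by bisecting a cube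
   of a chart j: to first order, the transition map to a chart i sends a small
   cube into an ellipsoid of the metric, whose Riemannian volume is bounded by a
   constant times the volume of the cube. *)

Require Import Defs.
From mathcomp Require Import all_boot all_order all_algebra.
From mathcomp Require Import all_classical all_reals all_analysis.
From mathcomp Require Import ring lra measurable_realfun.
Set Implicit Arguments.
Unset Strict Implicit.
Unset Printing Implicit Defensive.
Import Order.TTheory GRing.Theory Num.Theory.
Import numFieldNormedType.Exports.
Local Open Scope classical_set_scope.
Local Open Scope ring_scope.

(** * Periodic solutions of the ordinary differential equation *)

(** Minimizing a fourth-order quotient directly would leave the sign of the minimizer open. Passing
    to the inverse keeps everything positive: b^2 - D^2 is the product of b + D and b - D, each of
    which has a positive inverse on periodic functions. The Lipschitz constraint is harmless as
    well, since the normalized map w |-> K(w^q) sends the class into itself, so no multiplier of the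
    constraint enters the Euler equation.

    A maximizer w satisfies K(w^q) = lambda w with lambda = J(w). The multiple V of w that solves
    the equation has energy lambda^(-(q+1)/(q-1)), so a larger J means less energy. For the
    constant, lambda = b^(-4) T^(2/(q+1)-1) with T = 2 pi.

    The constant loses for large b because b^4 K tends to the identity, so that b^4 J(w) tends to
    int w^(2q). As 2q > q+1, Hoelder's inequality makes the constant the minimum of this limit under
    the constraint, not the maximum. *)

Section line_calculus.
Context {R : realType}.
Implicit Types (f g h : R -> R) (x y T : R).

(** Derivability and the value of the derivative are kept in one predicate, so that the rules below
    compute derivatives of explicit expressions without side conditions. *)
Definition antideriv h f := forall x, is_derive x 1 h (f x).

Definition has_period T f := forall x, f (x + T) = f x.

Lemma antideriv_continuous h f : antideriv h f -> continuous h.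
Proof.
move=> hf x; apply/differentiable_continuous/derivable1_diffP.
exact: (@ex_derive _ _ _ _ _ _ _ (hf x)).
Qed.

Lemma antideriv_eq h f f' : antideriv h f -> (forall x, f x = f' x) ->
  antideriv h f'.
Proof. by move=> hf ff' x; rewrite -ff'. Qed.

Lemma antideriv0_cst h : antideriv h (fun=> 0) -> forall x y, h x = h y.
Proof. by move=> h0 x y; exact: is_derive_0_is_cst. Qed.

Lemma antideriv_ge0_homo h f : antideriv h f -> (forall x, 0 <= f x) ->
  {homo h : x y / x <= y}.
Proof.
move=> hf f0 x y xy.
have dh z : derivable h z 1 by exact: (@ex_derive _ _ _ _ _ _ _ (hf z)).
apply: (@ger0_derive1_le_cc _ h x y) => //.
- by move=> z _; rewrite derive1E (@derive_val _ _ _ _ _ _ _ (hf z)).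
- by apply: continuous_subspaceT; exact: antideriv_continuous hf.
- by rewrite in_itv /= lexx.
- by rewrite in_itv /= lexx andbT.
Qed.

Lemma continuous_integrable_itv f x y : continuous f ->
  (@lebesgue_measure R).-integrable `[x, y] (EFin \o f).
Proof.
move=> cf; apply: continuous_compact_integrable; first exact: segment_compact.
exact: continuous_subspaceT.
Qed.

Lemma continuous_antideriv f : continuous f -> exists h, antideriv h f.
Proof.
move=> cf.
(* The integral is not oriented: on either side of 0, at most one of the two intervals is more than
   a point. *)
pose h (x : R) : R := \int[lebesgue_measure]_(t in `[0, x]) f t
  - \int[lebesgue_measure]_(t in `[x, 0]) f t.
exists h => x.
(* A base point to the left of both 0 and [x]: near [x], [h] is [F] minus a constant, and the
   fundamental theorem of calculus applies to [F]. *)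
pose a := Num.min 0 x - 1; pose u := x + 1.
pose F (z : R) : R := \int[lebesgue_measure]_(t in `[a, z]) f t.
have a0 : a < 0 by rewrite /a ltrBlDr gt_min ltrDl ltr01.
have ax : a < x by rewrite /a ltrBlDr gt_min ltrDl ltr01 orbT.
have split (c d : R) : a < c -> c <= d ->
    F d - F c = \int[lebesgue_measure]_(t in `[c, d]) f t.
  move=> ac cd; rewrite /F Rintegral_itvB.
  - rewrite Rintegral_itv_obnd_cbnd //.
    apply: integrableS (continuous_integrable_itv c d cf) => //.
    by apply: subset_itv; rewrite bnd_simp.
  - exact: continuous_integrable_itv.
  - by rewrite bnd_simp ltW.
  - by rewrite bnd_simp.
have hE z : a < z -> h z = F z - F 0.
  move=> az; rewrite /h; have [z0|z0] := leP 0 z.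
    rewrite -split //; have [->|zn0] := eqVneq z 0.
      by rewrite set_itv1 Rintegral_set1 subr0.
    by rewrite [X in _ - X]Rintegral_mkcond set_itv_ge ?bnd_simp -?ltNge ?lt_neqAle
      1?eq_sym ?zn0 // -Rintegral_mkcond Rintegral_set0 subr0.
  rewrite -(split z 0) //; last exact: ltW.
  rewrite set_itv_ge ?bnd_simp -?ltNge // Rintegral_set0; ring.
have xu : x < u by rewrite ltrDl.
have [dF F'] := @continuous_FTC1 R f (BLeft a) x u xu
  (continuous_integrable_itv a u cf) ax (cf x).
have isF : is_derive x 1 F (f x).
  by apply: DeriveDef; [exact: dF|rewrite -derive1E; exact: F'].
clear F' dF; clearbody F h.
have isG : is_derive x 1 (fun z => F z - F 0) (f x).
  by apply: is_derive_eq; rewrite subr0.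
have E : {near x, (fun z => F z - F 0) =1 h}.
  by near=> z; rewrite hE //; near: z; exact: lt_nbhsr.
exact: near_eq_is_derive E isG.
Unshelve. all: by end_near. Qed.

End line_calculus.

Lemma integral_antideriv (R : realType) (a c : R) (f h : R -> R) :
  a < c -> continuous f -> antideriv h f ->
  (\int[lebesgue_measure]_(s in `]a, c[) (f s)%:E = (h c - h a)%:E)%E.
Proof.
move=> ac cf hf; have ch : continuous h by exact: antideriv_continuous hf.
have mf (A : set R) : measurable_fun A (EFin \o f).
  by apply/measurable_EFinP/measurable_funTS; exact: continuous_measurable_fun.
rewrite -(@integral_itv_bndoo R a c (EFin \o f) true false); last exact: mf.
rewrite (@continuous_FTC2 _ _ h) ?EFinB //.
- exact: continuous_subspaceT.
- split; first by move=> x _; exact: (@ex_derive _ _ _ _ _ _ _ (hf x)).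
    exact/cvg_at_right_filter/ch.
  exact/cvg_at_left_filter/ch.
- by move=> x _; rewrite derive1E (@derive_val _ _ _ _ _ _ _ (hf x)).
Qed.

(** * Integration over a period *)

Section periodic_integral.
Context {R : realType} (T : R) (T0 : 0 < T).
Implicit Types (f g h : R -> R) (x y z : R).

Definition int_per f : R := \int[lebesgue_measure]_(t in `[0, T]) f t.

Lemma int_perE h f : continuous f -> antideriv h f -> int_per f = h T - h 0.
Proof.
move=> cf hf; rewrite -[RHS]/(fine (h T - h 0)%:E) -(integral_antideriv T0 cf hf).
rewrite /int_per /Rintegral; congr fine; apply: integral_itv_bndoo.
by apply/measurable_EFinP/measurable_funTS; exact: continuous_measurable_fun.
Qed.

Lemma int_perD f g : continuous f -> continuous g ->
  int_per (fun x => f x + g x) = int_per f + int_per g.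
Proof. by move=> cf cg; rewrite /int_per RintegralD //; exact: continuous_integrable_itv. Qed.

Lemma int_perB f g : continuous f -> continuous g ->
  int_per (fun x => f x - g x) = int_per f - int_per g.
Proof. by move=> cf cg; rewrite /int_per RintegralB //; exact: continuous_integrable_itv. Qed.

Lemma int_perZ (a : R) f : continuous f ->
  int_per (fun x => a * f x) = a * int_per f.
Proof. by move=> cf; rewrite /int_per RintegralZl //; exact: continuous_integrable_itv. Qed.

Lemma int_per_cst (a : R) : int_per (fun=> a) = a * T.
Proof.
rewrite /int_per Rintegral_cst //; congr (_ * _).
have := @lebesgue_measure_itv R `[0, T]; rewrite /= lte_fin T0 => ->.
by rewrite /= subr0.
Qed.

Lemma int_per_le f g : continuous f -> continuous g ->
  (forall x, f x <= g x) -> int_per f <= int_per g.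
Proof. by move=> cf cg fg; apply: le_Rintegral => //; exact: continuous_integrable_itv. Qed.

Lemma int_per_ge0 f : (forall x, 0 <= f x) -> 0 <= int_per f.
Proof. by move=> f0; exact: Rintegral_ge0. Qed.

(** The left-hand side has derivative f (x + T) - f x = 0, so it equals its value at 0. *)
Lemma periodic_antideriv_shift h f x : antideriv h f -> has_period T f ->
  h (x + T) - h x = h T - h 0.
Proof.
move=> hf pf.
rewrite -{2}[T]add0r; apply: (@antideriv0_cst R (fun x => h (x + T) - h x)) => z.
have H : is_derive (z + T) 1 h (f (z + T)) by exact: hf.
have H1 : @is_derive R R R z 1 (fun y => h (y + T)) (f (z + T)).
  have HT : @is_derive R R R z 1 (fun y => y + T) 1.
    by apply: is_derive_eq; rewrite addr0.
  by have := @is_derive1_comp R h (fun y => y + T) z _ _ H HT; rewrite mulr1.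
have H2 := hf z.
by apply: is_derive_eq; rewrite pf subrr.
Qed.

Lemma periodic_natmul f n x : has_period T f -> f (x + T *+ n) = f x.
Proof.
move=> pf; elim: n => [|n IH]; first by rewrite mulr0n addr0.
by rewrite mulrSr addrA pf.
Qed.

Lemma periodic_into f x : has_period T f ->
  exists2 z, f x = f z & 0 <= z < T.
Proof.
move=> pf; pose k := Num.floor (x / T).
exists (x - k%:~R * T).
  have [n [->|->]] : exists n : nat, k = n%:Z \/ k = - n%:Z.
  - by case: k => n; [exists n; left|exists n.+1; right].
  - by rewrite -[in LHS](subrK (n%:Z%:~R * T) x) mulrzl -pmulrn periodic_natmul.
  - by rewrite -(periodic_natmul n x pf) intrN mulNr opprK mulrzl -pmulrn.
have := floor_itv (x / T); rewrite -/k => /andP[k1 k2].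
rewrite subr_ge0 -ler_pdivlMr // k1 /= ltrBlDl -[X in _ + X]mul1r -mulrDl.
by rewrite -ltr_pdivrMr // intrD in k2 *.
Qed.

(** A primitive of [f] is nondecreasing and, its increment over a period being 0, also periodic.
    Hence it is constant and its derivative [f] vanishes everywhere, not just almost everywhere. *)
Lemma int_per_eq0 f : continuous f -> has_period T f -> (forall x, 0 <= f x) ->
  int_per f = 0 -> forall x, f x = 0.
Proof.
move=> cf pf f0.
have [h hf] := continuous_antideriv cf.
rewrite (int_perE cf hf) => h0.
have hT x : h (x + T) = h x.
  by apply/eqP; rewrite -subr_eq0 (periodic_antideriv_shift _ hf pf) h0.
have hh := antideriv_ge0_homo hf f0.
have hc x y : h x = h y.
  have [u -> /andP[u0 uT]] := periodic_into x hT.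
  have [v -> /andP[v0 vT]] := periodic_into y hT.
  have E : h T = h 0 by apply/eqP; rewrite -subr_eq0 h0.
  have hE z : 0 <= z < T -> h z = h 0.
    move=> /andP[z0 zT]; apply/eqP; rewrite eq_le -{1}E.
    by apply/andP; split; apply: hh => //; exact: ltW.
  by rewrite (hE u) ?(hE v) // ?u0 ?v0.
move=> x; have hfx := hf x.
rewrite -(@derive_val _ _ _ _ _ _ _ hfx).
have -> : h = cst (h 0) by apply/funext => y; exact: hc.
exact: derive_cst.
Qed.

Lemma int_per_lt f g : continuous f -> continuous g ->
  has_period T f -> has_period T g ->
  (forall x, f x <= g x) -> (exists x, f x != g x) -> int_per f < int_per g.
Proof.
move=> cf cg pf pg fg [x fgx]; rewrite lt_neqAle int_per_le // andbT.
apply: contra fgx => /eqP E; rewrite eq_sym -subr_eq0; apply/eqP.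
apply: (int_per_eq0 (f := fun x => g x - f x)).
- by move=> z; apply: cvgB; [exact: cg|exact: cf].
- by move=> z; rewrite pf pg.
- by move=> z; rewrite subr_ge0.
- by rewrite int_perB // E subrr.
Qed.

End periodic_integral.

(** * The positive inverse of b^2 - D^2 on periodic functions *)

Section periodic_ode.
Context {R : realType}.
Implicit Types (f g h u v w : R -> R) (b x y z : R).

Lemma antiderivD h f h' f' : antideriv h f -> antideriv h' f' ->
  antideriv (fun x => h x + h' x) (fun x => f x + f' x).
Proof. by move=> H H' x; have := H x; have := H' x => ? ?; exact: is_derive_eq. Qed.

Lemma antiderivN h f : antideriv h f -> antideriv (fun x => - h x) (fun x => - f x).
Proof. by move=> H x; have := H x => ?; exact: is_derive_eq. Qed.

Lemma antiderivB h f h' f' : antideriv h f -> antideriv h' f' ->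
  antideriv (fun x => h x - h' x) (fun x => f x - f' x).
Proof. by move=> H H'; apply: antiderivD => //; exact: antiderivN. Qed.

Lemma antiderivM h f h' f' : antideriv h f -> antideriv h' f' ->
  antideriv (fun x => h x * h' x) (fun x => f x * h' x + h x * f' x).
Proof.
move=> H H' x; have := H x; have := H' x => ? ?; apply: is_derive_eq.
by rewrite addrC /GRing.scale /= [h' x * _]mulrC.
Qed.

Lemma antideriv_cst (a : R) : antideriv (fun=> a) (fun=> 0).
Proof. by move=> x; exact: is_derive_cst. Qed.

Lemma antiderivZ (a : R) h f : antideriv h f ->
  antideriv (fun x => a * h x) (fun x => a * f x).
Proof.
move=> H; apply: antideriv_eq (antiderivM (antideriv_cst a) H) _ => x.
by rewrite mul0r add0r.
Qed.

Lemma antideriv_expR b :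
  antideriv (fun x => expR (b * x)) (fun x => b * expR (b * x)).
Proof.
move=> x; have H : is_derive (b * x) 1 expR (expR (b * x)) by exact: is_derive_expR.
have H' : @is_derive R R R x 1 (fun y => b * y) b.
  by apply: is_derive_eq; rewrite /GRing.scale /= mulr1.
by have := @is_derive1_comp R expR (fun y => b * y) x _ _ H H'; rewrite mulrC.
Qed.

Lemma antideriv_twist b h f : antideriv h f ->
  antideriv (fun x => expR (b * x) * h x)
    (fun x => expR (b * x) * (b * h x + f x)).
Proof.
move=> H; apply: antideriv_eq (antiderivM (antideriv_expR b) H) _ => x; ring.
Qed.

Variable T : R.
Hypothesis T0 : 0 < T.

(** Variation of constants for h' + b h = f. The sign of [b] is free, since the two factors of b^2 -
    D^2 need both signs. *)
Lemma first_order_periodic b f : b != 0 -> continuous f -> has_period T f ->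
  exists h, has_period T h /\ antideriv h (fun x => f x - b * h x).
Proof.
move=> b0 cf pf.
have cef : continuous (fun x => expR (b * x) * f x).
  move=> x; apply: cvgM; last exact: cf.
  exact: (antideriv_continuous (antideriv_expR b)).
have [F FE] := continuous_antideriv cef.
(* The only constant for which h T = h 0, that is, F T + c = exp(b T) (F 0 + c). *)
pose c := (F T - F 0) / (expR (b * T) - 1) - F 0.
pose h x := expR (- b * x) * (F x + c).
have ebT : expR (b * T) - 1 != 0.
  by rewrite subr_eq0 -expR0 (inj_eq (@expR_inj R)) mulf_neq0 // gt_eqF.
have hE : antideriv h (fun x => f x - b * h x).
  have := antideriv_twist (- b) (antiderivD FE (antideriv_cst c)).
  move=> /antideriv_eq; apply => x; rewrite /h mulNr expRN.
  by field; rewrite expR_eq0.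
exists h; split=> //.
(* The defect of periodicity solves k' = - b k with k 0 = 0, so exp(b x) k x is constant and equal
   to 0. *)
pose k x := h (x + T) - h x.
have kE : antideriv k (fun x => - b * k x).
  have HT : antideriv (fun x => h (x + T)) (fun x => f x - b * h (x + T)).
    move=> x; have H := hE (x + T).
    have HT : @is_derive R R R x 1 (fun y => y + T) 1.
      by apply: is_derive_eq; rewrite addr0.
    have := @is_derive1_comp R h (fun y => y + T) x _ _ H HT.
    by rewrite mulr1 pf.
  by apply: antideriv_eq (antiderivB HT hE) _ => x; rewrite /k; ring.
have k0 : k 0 = 0.
  rewrite /k /h add0r mulr0 expR0 mul1r mulNr expRN /c.
  by field; rewrite ebT expR_eq0.
move=> x; apply/eqP; rewrite -subr_eq0 -/(k x); apply/eqP.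
have := antideriv0_cst (h := fun x => expR (b * x) * k x) _ x 0.
rewrite k0 mulr0 => H; have {}H : expR (b * x) * k x = 0.
  apply: H; apply: antideriv_eq (antideriv_twist b kE) _ => y; ring.
by move/eqP : H; rewrite mulf_eq0 expR_eq0 /= => /eqP.
Qed.

(** Since h' + b h = f >= 0, the function exp(b x) h x is nondecreasing. Comparing [x] with [x + T]
    gives (exp(b T) - 1) h x >= 0. *)
Lemma first_order_ge0 b f h : 0 < b -> (forall x, 0 <= f x) ->
  has_period T h -> antideriv h (fun x => f x - b * h x) -> forall x, 0 <= h x.
Proof.
move=> b0 f0 ph hE x.
have : expR (b * x) * h x <= expR (b * (x + T)) * h (x + T).
  apply: (antideriv_ge0_homo (antideriv_twist b hE)); last by rewrite lerDl ltW.
  by move=> y; rewrite mulr_ge0 ?expR_ge0 // addrC subrK.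
rewrite ph mulrDr expRD -mulrA ler_pM2l ?expR_gt0 //.
rewrite -subr_ge0 -[X in _ - X]mul1r -mulrBl pmulr_rge0 //.
by rewrite subr_gt0 -expR0 ltr_expR mulr_gt0.
Qed.

(** The same argument with exp(- b x) h x, which is nonincreasing. *)
Lemma first_order_rev_ge0 b f h : 0 < b -> (forall x, 0 <= f x) ->
  has_period T h -> antideriv h (fun x => b * h x - f x) -> forall x, 0 <= h x.
Proof.
move=> b0 f0 ph hE x.
have : - (expR (- b * x) * h x) <= - (expR (- b * (x + T)) * h (x + T)).
  apply: (antideriv_ge0_homo (antiderivN (antideriv_twist (- b) hE))); last by rewrite lerDl ltW.
  by move=> y; rewrite -mulrN mulr_ge0 ?expR_ge0 // mulNr addrA addNr sub0r opprK.
rewrite lerN2 ph mulrDr expRD -mulrA ler_pM2l ?expR_gt0 //.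
rewrite -subr_ge0 -[X in X - _]mul1r -mulrBl pmulr_rge0 //.
by rewrite subr_gt0 -expR0 ltr_expR mulNr oppr_lt0 mulr_gt0.
Qed.

(* [w = (b^2 - D^2)^-1 f] *)
Definition resolvent b f w : Prop := has_period T w /\
  exists2 w1, has_period T w1 &
    antideriv w w1 /\ antideriv w1 (fun x => b ^+ 2 * w x - f x).

Variable b : R.
Hypothesis b0 : 0 < b.

(** Factorization: first (b - D) y = f, then (b + D) w = y. *)
Lemma resolvent_ex f : continuous f -> has_period T f -> exists w, resolvent b f w.
Proof.
move=> cf pf.
have [] := @first_order_periodic (- b) (fun x => - f x).
- by rewrite oppr_eq0 gt_eqF.
- by move=> x; apply: cvgN; exact: cf.
- by move=> x; rewrite pf.
move=> y [py yE].
have [] := @first_order_periodic b y _ _ py; first by rewrite gt_eqF.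
  exact: antideriv_continuous yE.
move=> w [pw wE]; exists w; split=> //.
exists (fun x => y x - b * w x); first by move=> x; rewrite py pw.
split=> //; apply: antideriv_eq (antiderivB yE (antiderivZ b wE)) _ => x; ring.
Qed.

(** Both b w + w' and b w - w' solve first-order equations with source [f], hence are nonnegative.
    Their sum gives the sign of [w], and together they give the bound |w'| <= b w behind the
    Lipschitz logarithms. *)
Lemma resolvent_ge0 f w w1 : (forall x, 0 <= f x) ->
  has_period T w -> has_period T w1 -> antideriv w w1 ->
  antideriv w1 (fun x => b ^+ 2 * w x - f x) ->
  forall x, 0 <= w x /\ `|w1 x| <= b * w x.
Proof.
move=> f0 pw pw1 wE w1E.
have H1 x : 0 <= w1 x + b * w x.
  apply: (@first_order_rev_ge0 b f (fun x => w1 x + b * w x)) => //.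
    by move=> y; rewrite pw pw1.
  apply: antideriv_eq (antiderivD w1E (antiderivZ b wE)) _ => y; ring.
have H2 x : 0 <= b * w x - w1 x.
  apply: (@first_order_ge0 b f (fun x => b * w x - w1 x)) => //.
    by move=> y; rewrite pw pw1.
  apply: antideriv_eq (antiderivB (antiderivZ b wE) w1E) _ => y; ring.
move=> x; have {}H1 := H1 x; have {}H2 := H2 x; split; last first.
  by rewrite ler_norml; apply/andP; split; lra.
by rewrite -(pmulr_rge0 _ b0); lra.
Qed.

Lemma resolventB f w f' w' (c : R) : resolvent b f w -> resolvent b f' w' ->
  resolvent b (fun x => f x - c * f' x) (fun x => w x - c * w' x).
Proof.
move=> [pw [w1 pw1 [E1 E2]]] [pw' [w1' pw1' [E1' E2']]]; split.
  by move=> x; rewrite pw pw'.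
exists (fun x => w1 x - c * w1' x); first by move=> x; rewrite pw1 pw1'.
split; first exact: antiderivB E1 (antiderivZ c E1').
apply: antideriv_eq (antiderivB E2 (antiderivZ c E2')) _ => x; ring.
Qed.

Lemma resolvent_le f w f' w' : resolvent b f w -> resolvent b f' w' ->
  (forall x, f x <= f' x) -> forall x, w x <= w' x.
Proof.
move=> H H' ff' x.
have [p [w1 p1 [E1 E2]]] := resolventB 1 H' H.
have := resolvent_ge0 _ p p1 E1 E2 x; rewrite mul1r subr_ge0.
by case=> // y; rewrite mul1r subr_ge0.
Qed.

Lemma resolvent_uniq f w w' : resolvent b f w -> resolvent b f w' -> w = w'.
Proof.
move=> H H'; apply/funext => x; apply/eqP; rewrite eq_le.
by rewrite (resolvent_le H H') // (resolvent_le H' H).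
Qed.

(** Uniqueness makes the choice irrelevant; the default 0 is reached only when there is no periodic
    solution. *)
Definition green f : R -> R := xget (fun=> 0) [set w | resolvent b f w].

Lemma greenP f : continuous f -> has_period T f -> resolvent b f (green f).
Proof.
by move=> cf pf; have [w wP] := resolvent_ex cf pf; rewrite /green; case: xgetP => // /(_ w).
Qed.

Lemma green_eq f w : resolvent b f w -> green f = w.
Proof.
rewrite /green => H; case: xgetP => [v _ Hv|/(_ w)] //; exact: resolvent_uniq H.
Qed.

Lemma resolvent_continuous f w : resolvent b f w -> continuous w.
Proof. by move=> [_ [w1 _ [E _]]]; exact: antideriv_continuous E. Qed.

(** The Wronskian of the two solutions is a periodic primitive of the difference of the two
    integrands. *)
Lemma resolvent_sym f w f' w' : continuous f -> continuous f' ->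
  resolvent b f w -> resolvent b f' w' ->
  int_per T (fun x => w x * f' x) = int_per T (fun x => f x * w' x).
Proof.
move=> cf cf' H H'; have cw := resolvent_continuous H; have cw' := resolvent_continuous H'.
move: H H' => [pw [w1 pw1 [E1 E2]]] [pw' [w1' pw1' [E1' E2']]].
have c1 : continuous (fun x => w x * f' x) by move=> x; apply: cvgM; [exact: cw|exact: cf'].
have c2 : continuous (fun x => f x * w' x) by move=> x; apply: cvgM; [exact: cf|exact: cw'].
apply/eqP; rewrite -subr_eq0 -int_perB //.
rewrite (@int_perE _ _ T0 (fun x => w1 x * w' x - w x * w1' x)).
- have /eqP := pw1 0; rewrite add0r => /eqP ->.
  have /eqP := pw 0; rewrite add0r => /eqP ->.
  have /eqP := pw' 0; rewrite add0r => /eqP ->.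
  have /eqP := pw1' 0; rewrite add0r => /eqP ->.
  by rewrite subrr.
- by move=> x; apply: cvgB; [exact: c1|exact: c2].
- apply: antideriv_eq (antiderivB (antiderivM E2 E1') (antiderivM E1 E2')) _ => x; ring.
Qed.

End periodic_ode.

(** * Young's inequality for exponentials, with its equality case *)

Section exponential_young.
Context {R : realType}.

Lemma expR_tangent (u m : R) : expR m * (1 + (u - m)) <= expR u.
Proof.
rewrite -[X in _ <= expR X](subrK m) expRD mulrC ler_pM2r ?expR_gt0 //.
exact: expR_ge1Dx.
Qed.

Lemma expR_tangent_eq (u m : R) : expR u = expR m * (1 + (u - m)) -> u = m.
Proof.
rewrite -[X in expR X = _](subrK m) expRD mulrC.
move=> /(mulfI (lt0r_neq0 (expR_gt0 m))) E; apply/eqP; rewrite -subr_eq0.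
by apply: contraT => /expR_gt1Dx; rewrite E ltxx.
Qed.

(** [m] is the mean of r s and r t with weights (r - 1) / r and 1 / r. The same weighted sum of the
    tangent inequalities at [m] gives the result. *)
Lemma expR_young (r s t : R) : 0 < r - 1 ->
  expR ((r - 1) * s + t) <= (r - 1) / r * expR (r * s) + r^-1 * expR (r * t).
Proof.
move=> r1; have r0 : 0 < r by lra.
set m := _ + t; have H1 := expR_tangent (r * s) m; have H2 := expR_tangent (r * t) m.
have -> : expR m = (r - 1) / r * (expR m * (1 + (r * s - m))) +
    r^-1 * (expR m * (1 + (r * t - m))) by rewrite /m; field; lra.
by rewrite lerD // ler_pM2l // ?divr_gt0 ?invr_gt0.
Qed.

(** Equality in the weighted sum forces equality in the tangent inequality for r t, whence r t = m
    and (r - 1) (t - s) = 0. *)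
Lemma expR_young_eq (r s t : R) : 0 < r - 1 ->
  expR ((r - 1) * s + t) = (r - 1) / r * expR (r * s) + r^-1 * expR (r * t) ->
  s = t.
Proof.
move=> r1; have r0 : 0 < r by lra.
set m := _ + t; have H1 := expR_tangent (r * s) m; have H2 := expR_tangent (r * t) m.
have E : expR m = (r - 1) / r * (expR m * (1 + (r * s - m))) +
    r^-1 * (expR m * (1 + (r * t - m))) by rewrite /m; field; lra.
rewrite {1}E => E2.
have : r^-1 * (expR (r * t) - expR m * (1 + (r * t - m))) <= 0.
  rewrite mulrBr subr_le0 -(lerD2l ((r - 1) / r * expR (r * s))) -E2.
  by rewrite lerD2r ler_pM2l // divr_gt0.
rewrite pmulr_rle0 ?invr_gt0 // subr_le0 => H3.
have /expR_tangent_eq : expR (r * t) = expR m * (1 + (r * t - m)).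
  by apply/eqP; rewrite eq_le H3 H2.
rewrite /m => rt; have : (r - 1) * (t - s) = 0 by lra.
by move/eqP; rewrite mulf_eq0 gt_eqF //= subr_eq0 => /eqP.
Qed.

End exponential_young.

(** By Tychonoff's theorem the sequence has a cluster point in a product of segments. In the product
    topology this means approximation on finite sets, at arbitrarily large indices; no subsequence
    is extracted. *)
Lemma function_cluster {R : realType} (M : R) (l_ : nat -> R -> R) :
  (forall k x, `|l_ k x| <= M) ->
  exists l : R -> R, forall (s : seq R) (e : R) (m : nat), 0 < e ->
    exists2 k, (m <= k)%N & {in s, forall x, `|l_ k x - l x| < e}.
Proof.
move=> lM.
have K := @tychonoff R (fun=> R : topologicalType) (fun=> [set` `[- M, M]])
  (fun=> @segment_compact R _ _).
have [|l [_ lcl]] := K (l_ @ \oo) _.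
  by exists 0%N => // k _ i; rewrite /= in_itv /= -ler_norml lM.
exists l => s e m e0.
have FA : (l_ @ \oo) [set f | exists2 k, (m <= k)%N & f = l_ k].
  by exists m => // k mk; exists k.
pose X : topologicalType := prod_topology (fun _ : R => (R : topologicalType)).
have NB : @nbhs X X l
    [set f : R -> R | {in s, forall x, `|f x - l x| < e}].
  elim: s => [|a s IH].
    rewrite (_ : [set _ | _] = setT); first exact: filterT.
    by apply/seteqP; split => f.
  have Na : @nbhs X X l [set f : R -> R | `|f a - l a| < e].
    apply: (@proj_continuous R (fun _ => R : topologicalType) a l
      [set y : R | `|y - l a| < e]).
    by apply/(nbhs_ballP (l a)); exists e => //= y /=; rewrite distrC.
  apply: filterS (filterI Na IH) => f [/= fa fs] x.
  by rewrite inE => /predU1P[->|/fs].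
have [f [[k mk ->] fs]] := lcl _ _ FA NB.
by exists k.
Qed.

(** * Maximization of the dual energy over exponentials of Lipschitz functions *)

Section variational.
Context {R : realType}.
Variables (T b q : R).
Hypotheses (T0 : 0 < T) (b0 : 0 < b) (q1 : 1 < q).
Implicit Types (f g h l v w : R -> R) (x y z r d : R).

Let q0 : 0 < q. Proof. by rewrite (lt_trans _ q1). Qed.
Let p : R := q + 1.
Let p0 : 0 < p. Proof. by rewrite /p addr_gt0. Qed.

Definition log_lip l := has_period T l /\ forall x y, `|l x - l y| <= b * `|x - y|.

Lemma log_lip_continuous l : log_lip l -> continuous l.
Proof.
move=> [_ ll] x; apply/cvgrPdist_le => e e0; near=> y.
apply: (le_trans (ll x y)); rewrite mulrC -ler_pdivlMr //.
near: y; apply/(nbhs_ballP x); exists (e / b); first by rewrite /= divr_gt0.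
by move=> y /= /ltW.
Unshelve. all: by end_near. Qed.

Lemma continuous_expRM r l : continuous l -> continuous (fun x => expR (r * l x)).
Proof.
move=> cl x; apply: continuous_comp; last exact: continuous_expR.
by apply: cvgM; [exact: cvg_cst|exact: cl].
Qed.

Lemma periodic_expRM r l : has_period T l -> has_period T (fun x => expR (r * l x)).
Proof. by move=> pl x; rewrite pl. Qed.

Lemma continuous_mul f g : continuous f -> continuous g ->
  continuous (fun x => f x * g x).
Proof. by move=> cf cg x; apply: cvgM; [exact: cf|exact: cg]. Qed.

Lemma continuousZl (a : R) f : continuous f -> continuous (fun x => a * f x).
Proof. by move=> cf; apply: continuous_mul => //; exact: cst_continuous. Qed.

(** The bound |w'| <= b w says that exp(b x) w x is nondecreasing and exp(- b x) w x nonincreasing;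
    taking logarithms gives the two halves of the Lipschitz estimate. *)
Lemma green_log_lip f : continuous f -> has_period T f -> (forall x, 0 < f x) ->
  exists2 l, log_lip l & green T b f = expR \o l.
Proof.
move=> cf pf f0; have H := greenP T0 b0 cf pf.
have [c _ cm] := EVT_min (ltW T0) (continuous_subspaceT cf).
have fm x : f c <= f x.
  have [z -> /andP[z0 zT]] := periodic_into T0 x pf.
  by apply: cm; rewrite in_itv /= z0 ltW.
(* The constant min f / b^2 solves the equation with source min f. By comparison it bounds
   [green T b f] away from 0, so that the logarithm makes sense. *)
have Hm : resolvent T b (fun=> f c) (fun=> f c / b ^+ 2).
  split=> //; exists (fun=> 0) => //; split; first exact: antideriv_cst.
  apply: antideriv_eq (antideriv_cst 0) _ => x.
  by rewrite mulrC divfK ?subrr // expf_neq0 // gt_eqF.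
set w := green T b f in H *.
have w0 x : 0 < w x.
  apply: lt_le_trans (resolvent_le T0 b0 Hm H fm x).
  by rewrite divr_gt0 ?exprn_gt0.
have [pw [w1 pw1 [wE w1E]]] := H.
have Lw x := resolvent_ge0 T0 b0 (fun z => ltW (f0 z)) pw pw1 wE w1E x.
exists (fun x => ln (w x)); last by apply/funext => x /=; rewrite lnK // posrE.
split=> [x|]; first by rewrite pw.
have mono x y : x <= y -> b * x + ln (w x) <= b * y + ln (w y) /\
    - b * y + ln (w y) <= - b * x + ln (w x).
  move=> xy; split.
    rewrite -ler_expR !expRD !lnK ?posrE //.
    apply: (antideriv_ge0_homo (antideriv_twist b wE) _ xy) => z.
    rewrite mulr_ge0 ?expR_ge0 //.
    by have [_] := Lw z; rewrite ler_norml => /andP[? _]; lra.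
  rewrite -ler_expR !expRD !lnK ?posrE // -lerN2.
  apply: (antideriv_ge0_homo (antiderivN (antideriv_twist (- b) wE)) _ xy) => z.
  rewrite -mulrN mulr_ge0 ?expR_ge0 //.
  by have [_] := Lw z; rewrite ler_norml => /andP[_ ?]; lra.
have aux x y : x <= y -> `|ln (w x) - ln (w y)| <= b * (y - x).
  by move=> /mono [H1 H2]; rewrite ler_norml; apply/andP; split; lra.
move=> x y; have [xy|/ltW xy] := leP x y.
  by rewrite [X in b * X]distrC [X in b * X]ger0_norm ?subr_ge0 // aux.
by rewrite distrC [X in b * X]ger0_norm ?subr_ge0 // aux.
Qed.

Definition mass l : R := int_per T (fun x => expR (p * l x)).
Definition source l : R -> R := fun x => expR (q * l x).
(** With w = exp l, this is the functional J(w) = int w^q K(w^q): K is [green] applied twice, and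
    [green] is self-adjoint. *)
Definition dual_energy l : R := int_per T (fun x => green T b (source l) x ^+ 2).

Lemma source_resolvent l : log_lip l -> resolvent T b (source l) (green T b (source l)).
Proof.
move=> ll; apply: greenP => //; first exact/continuous_expRM/log_lip_continuous.
by apply: periodic_expRM; case: ll.
Qed.

Lemma continuous_source l : log_lip l -> continuous (source l).
Proof. by move=> ll; exact/continuous_expRM/log_lip_continuous. Qed.

Lemma resolventZ (a : R) f w : resolvent T b f w ->
  resolvent T b (fun x => a * f x) (fun x => a * w x).
Proof.
move=> H; have := resolventB (1 - a) H H.
have E g : (fun x => g x - (1 - a) * g x) = (fun x => a * g x).
  by apply/funext => x; ring.
by rewrite !E.
Qed.

Lemma source_ge0 l x : 0 <= source l x. Proof. exact: expR_ge0. Qed.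

Lemma resolvent_ge0' f w : (forall x, 0 <= f x) -> resolvent T b f w ->
  forall x, 0 <= w x.
Proof.
move=> f0 [pw [w1 pw1 [E1 E2]]] x.
by case: (resolvent_ge0 T0 b0 f0 pw pw1 E1 E2 x).
Qed.

Lemma continuous_sqr f : continuous f -> continuous (fun x => f x ^+ 2).
Proof. by move=> cf; under eq_fun do rewrite expr2; exact: continuous_mul. Qed.

(** Here and in [dual_energy_near], continuity for the uniform distance takes a multiplicative form:
    the functional is homogeneous and nondecreasing in exp l. *)
Lemma mass_near l l' d : log_lip l -> log_lip l' ->
  (forall x, `|l x - l' x| <= d) -> mass l <= expR (p * d) * mass l'.
Proof.
move=> ll ll' H; have cl := log_lip_continuous ll; have cl' := log_lip_continuous ll'.
rewrite /mass -int_perZ; last exact: continuous_expRM.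
apply: int_per_le.
- exact: continuous_expRM.
- by apply: continuous_mul; [exact: cst_continuous|exact: continuous_expRM].
- move=> x; rewrite -expRD ler_expR -mulrDr ler_pM2l //.
  by have := H x; rewrite ler_norml; lra.
Qed.

Lemma dual_energy_near l l' d : log_lip l -> log_lip l' ->
  (forall x, `|l x - l' x| <= d) ->
  dual_energy l <= expR (2 * q * d) * dual_energy l'.
Proof.
move=> ll ll' H; have R1 := source_resolvent ll; have R2 := source_resolvent ll'.
have R3 := resolventZ (expR (q * d)) R2.
have L : forall x, green T b (source l) x <= expR (q * d) * green T b (source l') x.
  apply: (resolvent_le T0 b0 R1 R3) => x.
  rewrite -expRD ler_expR -mulrDr ler_pM2l //.
  by have := H x; rewrite ler_norml; lra.
have L0 := resolvent_ge0' (source_ge0 l) R1.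
have c1 := resolvent_continuous R1; have c2 := resolvent_continuous R2.
rewrite /dual_energy -int_perZ; last exact: continuous_sqr.
apply: int_per_le.
- exact: continuous_sqr.
- by apply: continuous_mul; [exact: cst_continuous|exact: continuous_sqr].
- move=> x; have -> : 2 * q * d = q * d + q * d by ring.
  rewrite expRD -expr2 -exprMn lerXn2r ?nnegrE ?L0 //.
  by rewrite mulr_ge0 ?expR_ge0 // (resolvent_ge0' (source_ge0 l') R2).
Qed.

(* Translating [l] scales both functionals. *)
Lemma log_lipD l (c : R) : log_lip l -> log_lip (fun x => l x - c).
Proof.
move=> [pl ll]; split=> [x|x y]; first by rewrite pl.
by rewrite opprB addrA subrK.
Qed.

Lemma massD l (c : R) : log_lip l -> mass (fun x => l x - c) = expR (- p * c) * mass l.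
Proof.
move=> ll; rewrite /mass -int_perZ; last exact/continuous_expRM/log_lip_continuous.
by congr int_per; apply/funext => x; rewrite -expRD mulrBr mulNr addrC.
Qed.

Lemma dual_energyD l (c : R) : log_lip l ->
  dual_energy (fun x => l x - c) = expR (- 2 * q * c) * dual_energy l.
Proof.
move=> ll; have H := source_resolvent ll.
have -> : dual_energy (fun x => l x - c) =
    int_per T (fun x => (expR (- q * c) * green T b (source l) x) ^+ 2).
  rewrite /dual_energy; congr int_per; apply/funext => x; congr (_ ^+ 2).
  have /(congr1 (fun f => f x)) /= <- := green_eq T0 b0 (resolventZ (expR (- q * c)) H).
  congr (green _ _ _ _); apply/funext => y.
  by rewrite /source -expRD mulrBr mulNr addrC.
rewrite /dual_energy -int_perZ; last exact/continuous_sqr/(resolvent_continuous H).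
congr int_per; apply/funext => x.
by rewrite exprMn expr2 -expRD; congr (expR _ * _); ring.
Qed.

Lemma log_lip_osc l x y : log_lip l -> `|l x - l y| <= b * T.
Proof.
move=> [pl ll].
have [x' -> /andP[x0 xT]] := periodic_into T0 x pl.
have [y' -> /andP[y0 yT]] := periodic_into T0 y pl.
apply: (le_trans (ll _ _)); rewrite ler_pM2l // ler_norml; apply/andP; split; lra.
Qed.

(** The mean of exp(p l) is 1 / T, and the oscillation of [l] is at most b T. *)
Lemma mass1_bound l x : log_lip l -> mass l = 1 -> `|l x| <= `|ln T| / p + b * T.
Proof.
move=> ll m1; have cl := log_lip_continuous ll.
have lo : expR (p * (l x - b * T)) * T <= 1.
  rewrite -m1 /mass -int_per_cst //; apply: int_per_le.
  - exact: cst_continuous.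
  - exact: continuous_expRM.
  - move=> y; rewrite ler_expR ler_pM2l //.
    by have := log_lip_osc x y ll; rewrite ler_norml; lra.
have hi : 1 <= expR (p * (l x + b * T)) * T.
  rewrite -m1 /mass -int_per_cst //; apply: int_per_le.
  - exact: continuous_expRM.
  - exact: cst_continuous.
  - move=> y; rewrite ler_expR ler_pM2l //.
    by have := log_lip_osc x y ll; rewrite ler_norml; lra.
have T_exp : T = expR (ln T) by rewrite lnK // posrE.
rewrite [in X in X <= _]T_exp -expRD -expR0 ler_expR in lo.
rewrite [in X in _ <= X]T_exp -expRD -expR0 ler_expR in hi.
have n1 := ler_norm (ln T); have n2 := ler_norm (- ln T); rewrite normrN in n2.
rewrite -(ler_pM2l p0) -[X in X * `|_|]gtr0_norm // -normrM mulrDr.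
rewrite [p * (_ / _)]mulrC divfK ?gt_eqF // ler_norml; apply/andP; split; nra.
Qed.


(** The argument of Arzela and Ascoli: pointwise approximation on a fine finite grid of [0, T]
    becomes uniform, because all the functions share a Lipschitz constant and a period. The limit
    inherits both, each being a condition on two points at a time. *)
Lemma log_lip_cluster (l_ : nat -> R -> R) :
  (forall k, log_lip (l_ k)) -> (forall k, mass (l_ k) = 1) ->
  exists2 l, log_lip l & forall d (m : nat), 0 < d ->
    exists2 k, (m <= k)%N & forall x, `|l_ k x - l x| <= d.
Proof.
move=> lll lm.
have [l lcl] := function_cluster (fun k x => mass1_bound x (lll k) (lm k)).
have ll : log_lip l.
  split=> [x|x y].
    apply/eqP; rewrite -subr_eq0 -normr_le0; apply/ler_addgt0Pr => e e0; rewrite add0r.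
    have [|k _ H] := lcl [:: x; x + T] (e / 2) 0%N; first by rewrite divr_gt0.
    have h1 := H x; have h2 := H (x + T).
    rewrite !inE !eqxx ?orbT in h1 h2; have {}h1 := h1 isT; have {}h2 := h2 isT.
    rewrite (lll k).1 in h2; move: h1 h2; rewrite !ltr_norml !ler_norml => /andP[? ?] /andP[? ?].
    by apply/andP; split; lra.
  apply/ler_addgt0Pr => e e0.
  have [|k _ H] := lcl [:: x; y] (e / 2) 0%N; first by rewrite divr_gt0.
  have h1 := H x; have h2 := H y.
  rewrite !inE !eqxx ?orbT in h1 h2; have {}h1 := h1 isT; have {}h2 := h2 isT.
  have h3 := (lll k).2 x y.
  move: h1 h2 h3; rewrite !ltr_norml !ler_norml => /andP[? ?] /andP[? ?] /andP[? ?].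
  by apply/andP; split; lra.
exists l => // d m d0.
(* For a grid of step T / (n + 1), moving to a neighbouring grid point changes a b-Lipschitz
   function by less than d / 4. *)
have [n nP] : exists n : nat, 4 * b * T / d < n.+1%:R.
  by exists (Num.truncn (4 * b * T / d)); exact: truncnS_gt.
have n0 : 0 < n.+1%:R :> R by rewrite ltr0n.
pose s := [seq T / n.+1%:R * i%:R | i <- iota 0 n.+2].
(* An error d / 2 at the grid point and d / 4 for moving each of the two functions to it add up to
   d. *)
have [|k mk H] := lcl s (d / 2) m; first by rewrite divr_gt0.
exists k => // x.
have [z E /andP[z0 zT]] : exists2 z, l_ k x - l x = l_ k z - l z & 0 <= z < T.
  by apply: (@periodic_into _ T T0 (fun x => l_ k x - l x)) => // y; rewrite (lll k).1 ll.1.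
rewrite {}E; pose i := Num.truncn (z * n.+1%:R / T).
have zn : 0 <= z * n.+1%:R / T by rewrite divr_ge0 ?mulr_ge0 // ltW.
have /andP[i1 i2] := truncn_itv zn; rewrite -/i in i1 i2.
pose t := T / n.+1%:R * i%:R.
have tz : `|z - t| <= T / n.+1%:R.
  have E : z = T / n.+1%:R * (z * n.+1%:R / T) by field; rewrite !gt_eqF.
  rewrite /t {1}E -mulrBr normrM gtr0_norm ?divr_gt0 // -[X in _ <= X]mulr1.
  rewrite ler_pM2l ?divr_gt0 // ger0_norm; last by rewrite subr_ge0.
  by rewrite lerBlDl natr1 ltW.
have ts : t \in s.
  apply/mapP; exists i => //; rewrite mem_iota /= add0n ltnS.
  rewrite -(ler_nat R); apply: (le_trans i1).
  by rewrite ler_pdivrMr // mulrC ler_pM2l // ltW.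
have h1 := H t ts; have h2 := (lll k).2 z t; have h3 := ll.2 z t.
have h4 : b * `|z - t| <= d / 4.
  apply: (@le_trans _ _ (b * (T / n.+1%:R))); first by rewrite ler_pM2l.
  rewrite mulrA ler_pdivrMr //; move: nP; rewrite ltr_pdivrMr // => nP; lra.
move: h1 h2 h3; rewrite !ltr_norml !ler_norml => /andP[? ?] /andP[? ?] /andP[? ?].
by apply/andP; split; lra.
Qed.

(** Passage to the limit d -> 0+, in the form produced by [mass_near] and [dual_energy_near]. *)
Lemma le_expR_limit (a c B : R) :
  (forall d, 0 < d -> a <= expR (c * d) * B + d) -> a <= B.
Proof.
move=> H.
have cg : (fun d : R => expR (c * d) * B + d) @ (0 : R)^'+ --> B.
  have gE : expR (c * 0) * B + 0 = B by rewrite mulr0 expR0 mul1r addr0.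
  rewrite -[X in _ --> X]gE {gE}.
  apply: cvg_at_right_filter; apply: cvgD; last exact: cvg_id.
  apply: cvgM; last exact: cvg_cst.
  apply: (@continuous_comp _ _ _ (fun d => c * d) expR); last exact: continuous_expR.
  by apply: cvgM; [exact: cvg_cst|exact: cvg_id].
rewrite -(cvg_lim _ cg) //; apply: limr_ge; first by apply/cvg_ex; exists B.
by near=> d; apply: H; near: d; exact: nbhs_right_gt.
Unshelve. all: by end_near. Qed.

Lemma log_lip_cst (c : R) : log_lip (fun=> c).
Proof. by split=> // x y; rewrite subrr normr0 mulr_ge0 ?normr_ge0 // ltW. Qed.

Lemma mass_gt0 l : log_lip l -> 0 < mass l.
Proof.
move=> ll; have cl := log_lip_continuous ll.
apply: (@lt_le_trans _ _ (expR (p * (l 0 - b * T)) * T)).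
  by rewrite mulr_gt0 ?expR_gt0.
rewrite -int_per_cst //; apply: int_per_le.
- exact: cst_continuous.
- exact: continuous_expRM.
- move=> y; rewrite ler_expR ler_pM2l //.
  by have := log_lip_osc 0 y ll; rewrite ler_norml; lra.
Qed.

Lemma mass_normalize l : log_lip l -> mass (fun x => l x - ln (mass l) / p) = 1.
Proof.
move=> ll; have E : - p * (ln (mass l) / p) = - ln (mass l) by field; exact: lt0r_neq0.
by rewrite massD // E expRN lnK ?posrE ?mass_gt0 // mulVf // gt_eqF // mass_gt0.
Qed.

(** The supremum is finite because normalized functions are uniformly bounded, hence comparable with
    0 by [dual_energy_near]. A uniform cluster point of a maximizing sequence keeps mass 1 and
    attains the supremum. *)
Lemma dual_energy_maximizer : exists l, [/\ log_lip l, mass l = 1 &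
  forall l', log_lip l' -> mass l' = 1 -> dual_energy l' <= dual_energy l].
Proof.
pose E := [set dual_energy l | l in [set l | log_lip l /\ mass l = 1]].
have supE : has_sup E.
  split.
    have l0 := log_lip_cst 0.
    exists (dual_energy (fun=> 0 - ln (mass (fun=> 0)) / p)).
    by exists (fun=> 0 - ln (mass (fun=> 0)) / p) => //; split;
      [exact: log_lip_cst|exact: (mass_normalize l0)].
  exists (expR (2 * q * (`|ln T| / p + b * T)) * dual_energy (fun=> 0)).
  move=> _ [l [ll lm] <-]; apply: dual_energy_near => // [|x].
    exact: log_lip_cst.
  by rewrite subr0; exact: mass1_bound.
have mx k : exists l, [/\ log_lip l, mass l = 1 & sup E - k.+1%:R^-1 < dual_energy l].
  have k0 : 0 < k.+1%:R^-1 :> R by rewrite invr_gt0 ltr0n.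
  by have [_ [l [ll lm] <-] H] := sup_adherent k0 supE; exists l; split.
have [l_ lP] := choice mx.
have [||l ll lcl] := @log_lip_cluster l_; try by move=> k; have [] := lP k.
exists l; have m1 : mass l = 1.
  apply/eqP; rewrite eq_le; apply/andP; split.
    apply: (@le_expR_limit _ p) => d d0; have [k _ H] := lcl d 0%N d0.
    have [kl <- _] := lP k; apply: (le_trans (mass_near ll kl _)) => [x|].
      by rewrite distrC.
    by rewrite lerDl ltW.
  apply: (@le_expR_limit _ p) => d d0; have [k _ H] := lcl d 0%N d0.
  have [kl <- _] := lP k; apply: (le_trans (mass_near kl ll H)).
  by rewrite lerDl ltW.
split; [exact: ll|exact: m1|move=> l' ll' m1'].
apply: (@le_trans _ _ (sup E)); first by apply: ub_le_sup; [case: supE|exists l'].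
apply: (@le_expR_limit _ (2 * q)) => d d0.
(* An index beyond 1 / d makes the defect 1 / (k + 1) of the maximizing sequence smaller than
   [d]. *)
have [k mk H] := lcl d (Num.truncn d^-1) d0.
have [kl _ kE] := lP k; have h := dual_energy_near kl ll H.
have : k.+1%:R^-1 < d.
  rewrite -[d]invrK ltf_pV2 ?posrE ?invr_gt0 ?ltr0n //.
  by apply: (lt_le_trans (truncnS_gt _)); rewrite ler_nat ltnS.
move=> kd; rewrite -lerBlDr; apply: le_trans h; apply/ltW/(le_lt_trans _ kE).
by rewrite lerD2l lerN2 ltW.
Qed.

(** Expand the integral of (g - s w)^2 >= 0 with g = [green T b (source l)]; by symmetry the cross
    term is the integral of [source l] times [y]. This serves both as a tangent inequality at a
    maximizer and as a lower bound by a test function. *)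
Lemma dual_energy_lb l h w (y : R -> R) (s : R) : log_lip l -> continuous h -> has_period T h ->
  resolvent T b h w -> resolvent T b w y ->
  2 * s * int_per T (fun x => source l x * y x) - s ^+ 2 * int_per T (fun x => w x ^+ 2)
    <= dual_energy l.
Proof.
move=> ll ch ph Hw Hy; have cw := resolvent_continuous Hw; have cy := resolvent_continuous Hy.
have G := source_resolvent ll; have cG := resolvent_continuous G; have cs := continuous_source ll.
rewrite -(resolvent_sym T0 cs cw G Hy).
set g := green T b (source l) in G cG *.
have cgw : continuous (fun x => g x * w x) by exact: continuous_mul.
have := @int_per_ge0 R T (fun x => (g x - s * w x) ^+ 2) (fun x => sqr_ge0 _).
have -> : (fun x => (g x - s * w x) ^+ 2) =
    (fun x => (g x ^+ 2 - 2 * s * (g x * w x)) + s ^+ 2 * w x ^+ 2).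
  by apply/funext => x; ring.
rewrite int_perD; first last.
- exact/continuousZl/continuous_sqr.
- move=> x; apply: cvgB; first exact: (continuous_sqr cG).
  exact: (continuousZl (a := 2 * s) cgw).
rewrite int_perB; first last.
- exact: continuousZl.
- exact: continuous_sqr.
rewrite !int_perZ //; last exact: continuous_sqr.
rewrite /dual_energy -/g; lra.
Qed.

(* Convexity of [dual_energy] and Young's inequality show that one step of the
   power iteration starting at a maximizer cannot move it. *)
Lemma maximizer_euler l : log_lip l -> mass l = 1 ->
  (forall l', log_lip l' -> mass l' = 1 -> dual_energy l' <= dual_energy l) ->
  resolvent T b (green T b (source l)) (fun x => dual_energy l * expR (l x)).
Proof.
move=> ll m1 lmax.
have G := source_resolvent ll; have cG := resolvent_continuous G; have cs := continuous_source ll.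
set g := green T b (source l) in G cG *.
have pG : has_period T g by case: G.
have [l1 ll1 gE] : exists2 l1, log_lip l1 & green T b g = expR \o l1.
  apply: green_log_lip => //.
  have [l2 _ E] := green_log_lip cs (periodic_expRM q ll.1) (fun x => expR_gt0 _).
  by move=> x; rewrite /g E /= expR_gt0.
have H := greenP T0 b0 cG pG; rewrite gE in H.
(* exp l1 = K(exp(q l)) is one step of the power iteration, and subtracting [c] normalizes it. *)
pose c := ln (mass l1) / p.
pose l' x := l1 x - c.
have ll' : log_lip l' by exact: log_lipD.
have m1' : mass l' = 1 by exact: mass_normalize.
have cl := log_lip_continuous ll; have cl' := log_lip_continuous ll'.
have kE x : expR (l1 x) = expR c * expR (l' x).
  by rewrite -expRD /l' addrC subrK.
have pl' := ll'.1; have pl := ll.1.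
pose f x := expR (q * l x + l' x).
have cf : continuous f.
  have := continuous_mul cs (continuous_expRM (r := 1) cl').
  by rewrite /source; under eq_fun do rewrite -expRD mul1r.
have EJ : dual_energy l = expR c * int_per T f.
  rewrite /dual_energy -/g -int_perZ //.
  have -> : (fun x => g x ^+ 2) = (fun x => g x * g x) by apply/funext => x; rewrite expr2.
  rewrite (resolvent_sym T0 cs cG G H); congr int_per; apply/funext => x.
  by rewrite /= kE mulrCA -expRD.
(* J is a convex quadratic form in exp(q l); this is its tangent inequality at [l], evaluated at
   [l']. By normalization of [l'] the linear term is 2 exp c. *)
have lb := dual_energy_lb 1 ll' cs (periodic_expRM q pl) G H.
have E1 : int_per T (fun x => source l' x * (expR \o l1) x) = expR c.
  rewrite -[RHS]mulr1 -m1' /mass -int_perZ; last exact: continuous_expRM.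
  congr int_per; apply/funext => x; rewrite /= kE mulrCA; congr (_ * _).
  by rewrite /source -expRD /p mulrDl mul1r.
rewrite E1 mulr1 expr1n mul1r in lb.
have /(le_trans lb) := lmax l' ll' m1'.
rewrite -/(dual_energy l) lerBlDr => {}lb.
(* Maximality turns the tangent inequality into exp c <= J, and J is exp c times the integral of
   [f]. *)
have I1 : 1 <= int_per T f.
  by rewrite -(ler_pM2l (expR_gt0 c)) mulr1 -EJ; lra.
pose gap x := (p - 1) / p * expR (p * l x) + p^-1 * expR (p * l' x).
have cgap : continuous gap.
  move=> x; apply: cvgD.
    exact: (continuousZl (a := (p - 1) / p) (continuous_expRM (r := p) cl)).
  exact: (continuousZl (a := p^-1) (continuous_expRM (r := p) cl')).
have p1 : 0 < p - 1 by rewrite /p addrK.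
have Igap : int_per T gap = 1.
  rewrite /gap int_perD; last 2 first.
  - exact/continuousZl/continuous_expRM.
  - exact/continuousZl/continuous_expRM.
  rewrite !int_perZ; try exact: continuous_expRM.
  rewrite -/(mass l) -/(mass l') m1 m1'; field; exact: lt0r_neq0.
have fgap x : f x <= gap x.
  by have := expR_young (l x) (l' x) p1; rewrite /f /gap /p addrK.
(* The integral of [gap] is 1 and that of [f] at least 1, so Young's inequality is an equality at
   every point; its equality case gives [l = l']. *)
have eq_l x : l x = l' x.
  apply: (expR_young_eq p1); rewrite -/(gap x) {1}/p addrK -/(f x).
  apply/eqP/negPn/negP => ne.
  have : int_per T f < int_per T gap.
    apply: int_per_lt => //; last by exists x.
    - by move=> z; rewrite /f pl pl'.
    - by move=> z; rewrite /gap pl pl'.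
  by rewrite Igap ltNge I1.
(* Once [l = l'], [f] is the integrand of the mass, so its integral is 1 and
   [dual_energy l = expR c]. *)
suff -> : (fun x => dual_energy l * expR (l x)) = expR \o l1 by [].
apply/funext => x; rewrite /= kE eq_l; congr (_ * _).
rewrite EJ -[RHS]mulr1 -m1'; congr (_ * _); congr int_per; apply/funext => y.
by rewrite /f eq_l /p mulrDl mul1r.
Qed.

End variational.

(** * The test function 2 + cos against the constant *)

Section test_function_energy.
Context {R : realType}.
Let T : R := pi *+ 2.
Let T0 : 0 < T. Proof. by rewrite /T mulrn_wgt0 // pi_gt0. Qed.
Let phi : R -> R := fun x => 2 + cos x.
Implicit Types (p q b x : R).

Let phi1 x : 1 <= phi x.
Proof. by have := cos_geN1 x; rewrite /phi; lra. Qed.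

Let phi0 x : 0 < phi x. Proof. exact: lt_le_trans ltr01 (phi1 x). Qed.

Let l x : R := ln (phi x).

Lemma antideriv_sin : antideriv (@sin R) cos.
Proof. by move=> x; exact: is_derive_sin. Qed.

Lemma antideriv_cos : antideriv (@cos R) (fun x => - sin x).
Proof. by move=> x; exact: is_derive_cos. Qed.

Lemma antideriv_id : antideriv (@id R) (fun=> 1).
Proof. by move=> x; exact: is_derive_id. Qed.

Let phiE : antideriv phi (fun x => - sin x).
Proof.
apply: antideriv_eq (antiderivD (antideriv_cst 2) antideriv_cos) _ => x.
by rewrite add0r.
Qed.

Let lE : antideriv l (fun x => - sin x / phi x).
Proof.
move=> x; have H := is_derive1_ln (phi0 x); have H' := phiE x.
by have := @is_derive1_comp R (@ln R) phi x _ _ H H'; rewrite mulrC.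
Qed.

Let perphi : has_period T phi.
Proof. by move=> x; rewrite /phi /T mulr2n addrA !cosDpi opprK. Qed.

Let log_lip_l b : 1 <= b -> log_lip T b l.
Proof.
move=> b1; split=> [x|x y]; first by rewrite /l perphi.
have bd x' : `|- sin x' / phi x'| <= b.
  rewrite normrM normrN [X in _ * X]gtr0_norm ?invr_gt0 // ler_pdivrMr //.
  apply: (@le_trans _ _ 1); first by rewrite ler_norml sin_geN1 sin_le1.
  by rewrite -[1]mul1r ler_pM.
have bE : antideriv (fun x => b * x) (fun=> b).
  by apply: antideriv_eq (antiderivZ b antideriv_id) _ => z; rewrite mulr1.
have mono x' y' : x' <= y' -> `|l x' - l y'| <= b * (y' - x').
  move=> xy.
  have h1 := antideriv_ge0_homo (antiderivD bE lE) _ xy.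
  have h2 := antideriv_ge0_homo (antiderivB bE lE) _ xy.
  have {}h1 : b * x' + l x' <= b * y' + l y'.
    by apply: h1 => z; have := bd z; rewrite ler_norml => /andP[? _]; lra.
  have {}h2 : b * x' - l x' <= b * y' - l y'.
    by apply: h2 => z; have := bd z; rewrite ler_norml => /andP[_ ?]; lra.
  by rewrite ler_norml; apply/andP; split; lra.
have [xy|/ltW xy] := leP x y.
  by rewrite [X in b * X]distrC [X in b * X]ger0_norm ?subr_ge0 // mono.
by rewrite distrC [X in b * X]ger0_norm ?subr_ge0 // mono.
Qed.

Lemma int_per_cos_sqr (a c : R) :
  int_per T (fun x => (a + c * cos x) ^+ 2) = pi * (2 * a ^+ 2 + c ^+ 2).
Proof.
have ccos : continuous (@cos R) by exact: continuous_cos.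
rewrite (@int_perE _ _ T0 (fun x => a ^+ 2 * x + (2 * a * c) * sin x +
   (c ^+ 2 / 2) * (x + sin x * cos x))).
- by rewrite sin0 /T sin2pi -mulr_natr; field.
- apply: continuous_sqr => x; apply: cvgD; first exact: cvg_cst.
  by apply: cvgM; [exact: cvg_cst|exact: ccos].
- have A1 := antiderivZ (a ^+ 2) antideriv_id.
  have A2 := antiderivZ (2 * a * c) antideriv_sin.
  have A3 := antiderivM antideriv_sin antideriv_cos.
  have A4 := antiderivZ (c ^+ 2 / 2) (antiderivD antideriv_id A3).
  apply: antideriv_eq (antiderivD (antiderivD A1 A2) A4) _ => x /=.
  have -> : 1 + (cos x * cos x + sin x * - sin x) =
    2 * cos x ^+ 2 + (1 - (cos x ^+ 2 + sin x ^+ 2)) by ring.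
  by rewrite cos2Dsin2; field.
Qed.

(** The strict power mean inequality: 9/2 is the mean of (2 + cos)^2, and r = (q + 1) / 2 exceeds 1.
    It is Young's inequality, with first exponent 0, for the logarithm [t] of (2 + cos)^2 divided by
    9/2, whose exponential has mean 1. *)
Let mass_l q : 1 < q -> T * expR ((q + 1) / 2 * ln (9 / 2)) < mass T q l.
Proof.
move=> q1; set r := (q + 1) / 2.
have r0 : 0 < r by rewrite /r; lra.
have r1 : 0 < r - 1 by rewrite /r; lra.
have cl : continuous l by exact: antideriv_continuous lE.
have pl : has_period T l by move=> x; rewrite /l perphi.
pose t x := 2 * l x - ln (9 / 2).
have ct : continuous t.
  by move=> x; apply: cvgB; [apply: cvgM; [exact: cvg_cst|exact: cl]|exact: cvg_cst].
have pt : has_period T t by move=> x; rewrite /t pl.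
pose G x := (r - 1) / r * 1 + r^-1 * expR (r * t x).
have cG : continuous G.
  move=> x; apply: cvgD; first exact: cvg_cst.
  exact: (continuousZl (continuous_expRM (r := r) ct)).
have ce : continuous (fun x => expR (t x)).
  by have := continuous_expRM (r := 1) ct; under eq_fun do rewrite mul1r.
have yg x : expR (t x) <= G x.
  by have := expR_young 0 (t x) r1; rewrite !mulr0 add0r expR0.
have lt : int_per T (fun x => expR (t x)) < int_per T G.
  apply: int_per_lt => //.
  - by move=> x; rewrite pt.
  - by move=> x; rewrite /G pt.
  (* Strictness at 0, where (2 + cos)^2 is 9 and not 9/2. *)
  exists 0; apply/eqP => E.
  have := @expR_young_eq _ r 0 (t 0) r1.
  rewrite !mulr0 add0r expR0 => /(_ E).
  rewrite /t /l /phi cos0 => /esym/eqP; rewrite subr_eq0 => /eqP E2.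
  have : expR (2 * ln 3) = expR (ln (9 / 2 : R)).
    by rewrite -E2; congr (expR (_ * ln _)); ring.
  rewrite mulr_natl mulr2n expRD !lnK ?posrE; lra.
have e1 : int_per T (fun x => expR (t x)) = T.
  have -> : (fun x => expR (t x)) = (fun x => 2 / 9 * (2 + 1 * cos x) ^+ 2).
    apply/funext => x; rewrite /t expRD expRN lnK ?posrE; last lra.
    by rewrite mulr_natl mulr2n expRD !lnK ?posrE // mul1r -expr2 -/(phi x); field.
  rewrite int_perZ; first by rewrite int_per_cos_sqr /T -mulr_natr; field.
  apply: continuous_sqr => x; apply: cvgD; first exact: cvg_cst.
  by apply: cvgM; [exact: cvg_cst|exact: continuous_cos].
have e2 : int_per T G = (r - 1) / r * T + r^-1 * (expR (- (r * ln (9 / 2))) * mass T q l).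
  rewrite /G int_perD; first last.
  - exact/continuousZl/continuous_expRM.
  - exact: cst_continuous.
  rewrite int_per_cst // mulr1 int_perZ; last exact: continuous_expRM.
  congr (_ + _ * _); rewrite /mass -int_perZ; last exact: continuous_expRM.
  by congr int_per; apply/funext => x; rewrite -expRD /t /r; congr expR; field.
rewrite e1 e2 in lt.
have : T < expR (- (r * ln (9 / 2))) * mass T q l.
  rewrite -(ltr_pM2l (x := r^-1)) ?invr_gt0 //.
  have -> : r^-1 * T = T - (r - 1) / r * T by field; exact: lt0r_neq0.
  lra.
by rewrite expRN mulrC ltr_pdivlMr ?expR_gt0.
Qed.

(* [2 + cos] beats the constant by a margin independent of [b]. *)
Lemma dual_energy_test q : 1 < q -> exists2 b1 : R, 1 <= b1 &
  forall b, 0 < b -> b1 <= b ^+ 2 -> exists l', [/\ log_lip T b l', mass T q l' = 1 &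
    expR ((2 / (q + 1) - 1) * ln T) / b ^+ 4 < dual_energy T b q l'].
Proof.
move=> q1; set p := q + 1; have p0 : 0 < p by rewrite /p; lra.
set N := mass T q l; have Nlb := mass_l q1; rewrite -/N in Nlb.
have N0 : 0 < N by apply: le_lt_trans Nlb; rewrite mulr_ge0 ?expR_ge0 // ltW.
(* The mean of (2 + cos)^p raised to 2 / p; its excess over the mean 9/2 of the square is the margin
   announced. *)
pose k := expR (2 / p * (ln N - ln T)).
have k9 : 9 / 2 < k.
  have -> : 9 / 2 = expR (ln (9 / 2)) :> R by rewrite lnK // posrE; lra.
  rewrite ltr_expR; move: Nlb; rewrite -ltr_ln ?posrE // ?mulr_gt0 ?expR_gt0 //.
  rewrite lnM ?posrE ?expR_gt0 // expRK -/p => h.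
  have -> : ln (9 / 2) = 2 / p * (p / 2 * ln (9 / 2)) :> R by field; exact: lt0r_neq0.
  by rewrite ltr_pM2l ?divr_gt0 //; lra.
have e0 : 0 < 2 * k - 9 by lra.
(* The final comparison reads 2 b^2 + 1 < (2 k - 9) b^4. For b >= 1 it follows from 3 < (2 k - 9)
   b^2. The added 1 gives b >= 1, which also makes ln (2 + cos) b-Lipschitz. *)
exists (3 / (2 * k - 9) + 1); first by rewrite lerDr divr_ge0 // ltW.
move=> b b0 bb.
have b1 : 1 <= b ^+ 2 by apply: le_trans bb; rewrite lerDr divr_ge0 // ltW.
have bge1 : 1 <= b by rewrite -(@expr_ge1 _ 2) // ltW.
have ll := log_lip_l bge1.
exists (fun x => l x - ln N / p); split.
- exact: log_lipD.
- exact: (mass_normalize T0 b0 q1 ll).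
rewrite dual_energyD //.
(* [w] is (b^2 - D^2) applied to [phi], and [h] is (b^2 - D^2) applied to [w], so that [phi] is
   recovered from [h] by two resolvents. *)
pose w x := 2 * b ^+ 2 + (1 + b ^+ 2) * cos x.
pose h x := 2 * b ^+ 4 + (1 + b ^+ 2) ^+ 2 * cos x.
have ch : continuous h.
  move=> x; apply: cvgD; first exact: cvg_cst.
  by apply: cvgM; [exact: cvg_cst|exact: continuous_cos].
have cosT x : cos (x + T) = cos x by rewrite /T mulr2n addrA !cosDpi opprK.
have sinT x : sin (x + T) = sin x by rewrite /T mulr2n addrA !sinDpi opprK.
have Hw : resolvent T b h w.
  split; first by move=> x; rewrite /w cosT.
  exists (fun x => (1 + b ^+ 2) * - sin x); first by move=> x; rewrite sinT.
  split.
    apply: antideriv_eq (antiderivD (antideriv_cst _) (antiderivZ _ antideriv_cos)) _ => x.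
    by rewrite add0r.
  apply: antideriv_eq (antiderivZ _ (antiderivN antideriv_sin)) _ => x.
  by rewrite /w /h; ring.
have Hphi : resolvent T b w phi.
  split=> //; exists (fun x => - sin x); first by move=> x; rewrite sinT.
  split=> //; apply: antideriv_eq (antiderivN antideriv_sin) _ => x.
  by rewrite /w /phi; ring.
set Q := pi * (2 * (2 * b ^+ 2) ^+ 2 + (1 + b ^+ 2) ^+ 2).
have Q0 : 0 < Q by rewrite /Q mulr_gt0 ?pi_gt0 //; nra.
have IQ : int_per T (fun x => w x ^+ 2) = Q by exact: int_per_cos_sqr.
have IN : int_per T (fun x => source q l x * phi x) = N.
  rewrite /N /mass; congr int_per; apply/funext => x.
  by rewrite /source mulrDl mul1r expRD /l lnK // posrE.
have lb : N ^+ 2 / Q <= dual_energy T b q l.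
  have ph : has_period T h by move=> x; rewrite /h cosT.
  (* N / Q maximizes 2 s N - s^2 Q, with value N^2 / Q. *)
  have := @dual_energy_lb R T b q T0 b0 l h w phi (N / Q) ll ch ph Hw Hphi.
  rewrite IQ IN; congr (_ <= _); field; exact: lt0r_neq0.
apply: (@lt_le_trans _ _ (expR (- 2 * q * (ln N / p)) * (N ^+ 2 / Q))); last first.
  by rewrite ler_pM2l ?expR_gt0.
have -> : expR (- 2 * q * (ln N / p)) * (N ^+ 2 / Q) = expR (2 / p * ln N) / Q.
  rewrite mulrA; congr (_ / _).
  have -> : N ^+ 2 = expR (2 * ln N).
    by rewrite mulr_natl mulr2n expRD lnK ?posrE.
  by rewrite -expRD; congr expR; rewrite /p; field; rewrite -/p; exact: lt0r_neq0.
rewrite ltr_pdivrMr ?exprn_gt0 // mulrAC ltr_pdivlMr //.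
have -> : expR (2 / p * ln N) = k * expR (2 / p * ln T).
  by rewrite /k -expRD; congr expR; ring.
have -> : expR ((2 / p - 1) * ln T) = expR (2 / p * ln T) / T.
  rewrite mulrBl mul1r expRD expRN lnK // posrE //.
rewrite [k * _]mulrC -!mulrA ltr_pM2l ?expR_gt0 // mulrC ltr_pdivrMr //.
rewrite /Q /T -[pi *+ 2]mulr_natl.
have pi0 := @pi_gt0 R.
have : 8 * b ^+ 4 + (1 + b ^+ 2) ^+ 2 < 2 * k * b ^+ 4.
  have H : 3 < (2 * k - 9) * b ^+ 2.
    rewrite mulrC -ltr_pdivrMr //; lra.
  have -> : b ^+ 4 = b ^+ 2 * b ^+ 2 by rewrite -exprD.
  nra.
move=> H; have : pi * (8 * b ^+ 4 + (1 + b ^+ 2) ^+ 2) < pi * (2 * k * b ^+ 4).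
  by rewrite ltr_pM2l.
lra.
Qed.

End test_function_energy.

(** The Euler equation K(exp(q l)) = lambda exp l becomes the differential equation after
    multiplying exp l by a constant, the two sides having different degrees of homogeneity. *)
Lemma periodic_solution {R : realType} (q : R) : 1 < q ->
  exists2 a0 : R, 0 < a0 & forall a, a0 <= a -> exists V V1 V2 V3 : R -> R,
    [/\ forall x, 0 < V x, has_period (pi *+ 2) V,
        [/\ antideriv V V1, antideriv V1 V2, antideriv V2 V3 &
          antideriv V3 (fun x => a * V2 x - a ^+ 2 / 4 * V x + V x `^ q)] &
        int_per (pi *+ 2) (fun x => V x `^ (q + 1)) <
          pi *+ 2 * ((a ^+ 2 / 4) `^ (q - 1)^-1) `^ (q + 1)].
Proof.
move=> q1; set T := pi *+ 2; have T0 : 0 < T by rewrite /T mulrn_wgt0 // pi_gt0.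
have [b1 b1_ge1 H] := dual_energy_test q1.
exists (2 * b1) => [|a ab]; first by lra.
have a0 : 0 < a by lra.
pose b := Num.sqrt (a / 2).
have b0 : 0 < b by rewrite sqrtr_gt0 divr_gt0.
have b2 : b ^+ 2 = a / 2 by rewrite sqr_sqrtr // divr_ge0 // ltW.
have [|l' [ll' m1' lb]] := H b b0; first by rewrite b2; lra.
have [l [ll m1 lmax]] := dual_energy_maximizer T0 b0 q1.
have {}lb := lt_le_trans lb (lmax l' ll' m1').
have E := maximizer_euler T0 b0 q1 ll m1 lmax.
set lam := dual_energy T b q l in lb E.
have lam0 : 0 < lam.
  by apply: le_lt_trans lb; rewrite mulr_ge0 ?expR_ge0 // invr_ge0 exprn_ge0 // ltW.
have G := source_resolvent q T0 b0 ll.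
set g := green T b (source q l) in E G.
set A := (fun x => lam * expR (l x)) in E.
have [pA [A1 pA1 [AE A1E]]] := E; have [pg [g1 pg1 [gE g1E]]] := G.
have q10 : 0 < q - 1 by lra.
(* Chosen so that exp((q - 1) m) lambda = 1, the condition for V = exp(l + m) to satisfy K(V^q) =
   V. *)
pose m := - ln lam / (q - 1).
pose k := expR m / lam.
have VE x : k * A x = expR (l x + m).
  by rewrite /k /A mulrA divfK ?gt_eqF // expRD mulrC.
(* The second derivative is read off the resolvent equation A'' = b^2 A - g, and the fourth then
   uses that of [g]. *)
exists (fun x => k * A x), (fun x => k * A1 x),
  (fun x => k * (b ^+ 2 * A x - g x)), (fun x => k * (b ^+ 2 * A1 x - g1 x)).
split.
- by move=> x; rewrite VE expR_gt0.
- by move=> x; rewrite pA.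
- split; [exact: (antiderivZ k AE)|exact: (antiderivZ k A1E)|
    exact: (antiderivZ k (antiderivB (antiderivZ (b ^+ 2) AE) gE))|].
  apply: antideriv_eq (antiderivZ k (antiderivB (antiderivZ (b ^+ 2) A1E) g1E)) _ => x.
  have -> : (k * A x) `^ q = k * source q l x.
    rewrite VE /powR gt_eqF ?expR_gt0 // expRK /source /k mulrAC -expRD.
    rewrite -[in RHS](@lnK _ lam) ?posrE // -expRN -expRD; congr expR.
    by rewrite /m; field; exact: lt0r_neq0.
  have -> : a = 2 * b ^+ 2 by rewrite b2; field.
  by field.
set p := q + 1; have p0 : 0 < p by rewrite /p; lra.
have -> : int_per T (fun x => (k * A x) `^ p) = expR (p * m).
  rewrite -[RHS]mulr1 -m1 /mass -int_perZ; last exact/continuous_expRM/(log_lip_continuous b0 ll).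
  congr int_per; apply/funext => x.
  by rewrite VE /powR gt_eqF ?expR_gt0 // expRK -expRD mulrDr addrC.
have b4 : a ^+ 2 / 4 = b ^+ 4.
  by rewrite -[4%N]/((2 * 2)%N) exprM b2; field.
have b40 : 0 < b ^+ 4 by exact: exprn_gt0.
rewrite b4 -powRrM /powR gt_eqF // -[X in X * expR _](@lnK _ T) ?posrE // -expRD ltr_expR.
move: lb; rewrite -ltr_ln ?posrE ?divr_gt0 ?expR_gt0 // ln_div ?posrE ?expR_gt0 // expRK.
rewrite -/p => lb.
(* The energy is lambda to the power - p / (q - 1), so the strict lower bound on lambda is a strict
   upper bound on the energy; the value T^(2/p - 1) / b^4 of lambda would give exactly the energy of
   the constant. *)
have -> : p * m = - (p / (q - 1)) * ln lam by rewrite /m; field; exact: lt0r_neq0.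
have c0 : 0 < p / (q - 1) by rewrite divr_gt0.
have : (p / (q - 1)) * ((2 / p - 1) * ln T - ln (b ^+ 4)) < p / (q - 1) * ln lam.
  by rewrite ltr_pM2l.
have -> : p / (q - 1) * ((2 / p - 1) * ln T - ln (b ^+ 4)) =
   - ln T - (q - 1)^-1 * p * ln (b ^+ 4).
  by rewrite /p; field; rewrite -/p; apply/andP; split; exact: lt0r_neq0.
lra.
Qed.

(** * Smooth functions *)

Section near_differentiable.
Context {K : numFieldType} {V W : normedModType K}.
Implicit Types f g e : V -> W.

(** The case of a germ equal to 0. Differentiability then depends only on the germ, because two
    functions with the same germ differ by such a function. *)
Lemma near0_differentiable e (x : V) : (\near x, e x = 0) -> differentiable e x.
Proof.
move=> e0; have ex0 : e x = 0 by exact: nbhs_singleton e0.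
apply/diffP => /=.
apply: (@getPex _ (fun (df : {linear V -> W}) => continuous df /\
  forall y, e y = e (lim (nbhs x)) + df (y - lim (nbhs x))
                  +o_(y \near x) (y - lim (nbhs x)))).
exists (\0 : {linear V -> W}); split; first exact: cst_continuous.
apply: (eqaddoEx (h := e)) => z; rewrite lim_id // ex0 /= !add0r littleoE //.
move=> eps eps0; near=> h; rewrite (near e0 h) // normr0 mulr_ge0 // ltW //.
Unshelve. all: by end_near. Qed.

Lemma near_differentiable f g (x : V) : (\near x, f x = g x) ->
  differentiable f x -> differentiable g x.
Proof.
move=> fg df; have -> : g = f + (g - f) by rewrite addrC subrK.
apply: differentiableD => //; apply: near0_differentiable.
by apply: filterS fg => y fgy; rewrite !fctE fgy subrr.
Qed.

End near_differentiable.

Section smooth.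
Context {R : realType} {d : nat}.
Implicit Types (O A : set 'rV[R]_d) (f g : 'rV[R]_d -> R) (x : 'rV[R]_d) (a b : 'I_d).

(* Regularity of order [k]: unlike [smooth_on], it lends itself to induction. *)
Fixpoint differentiable_upto (k : nat) O f : Prop :=
  (forall x, O x -> differentiable f x) /\
  if k is k'.+1 then forall a, differentiable_upto k' O (partial a f) else True.

Lemma differentiable_upto0 k O f : differentiable_upto k O f ->
  forall x, O x -> differentiable f x.
Proof. by case: k => [|k] []. Qed.

Lemma smooth_onP O f : smooth_on O f <-> forall k, differentiable_upto k O f.
Proof.
split=> [sf k|H s].
  elim: k f sf => [|k IH] f sf /=; first by split => // x; exact: (sf [::]).
  split; first by move=> x; exact: (sf [::]).
  by move=> a; apply: IH => s x Ox; have := sf (rcons s a) x Ox; rewrite foldr_rcons.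
(* [foldr] applies the last index of the list first, hence the induction from the right. *)
have {}H := H (size s); move: H; elim/last_ind: s f => [|s a IH] f H x Ox /=.
  exact: H.1.
rewrite foldr_rcons; move: H; rewrite size_rcons => -[_ H]; exact: IH (H a) x Ox.
Qed.

Lemma eq_partial O f g a x : open O -> (forall y, O y -> f y = g y) -> O x ->
  partial a f x = partial a g x.
Proof.
move=> oO fg Ox; apply: near_eq_derive.
by near=> y; apply: fg; near: y; exact: open_nbhs_nbhs.
Unshelve. all: by end_near. Qed.

Lemma eq_differentiable_upto k O f g : open O -> (forall y, O y -> f y = g y) ->
  differentiable_upto k O f -> differentiable_upto k O g.
Proof.
move=> oO; elim: k f g => [|k IH] f g fg /= [H1 H2].
  split=> // x Ox; apply: (near_differentiable _ (H1 x Ox)).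
  by near=> y; apply: fg; near: y; exact: open_nbhs_nbhs.
split=> [x Ox|a].
  apply: (near_differentiable _ (H1 x Ox)).
  by near=> y; apply: fg; near: y; exact: open_nbhs_nbhs.
by apply: IH (H2 a) => y Oy; exact: eq_partial Oy.
Unshelve. all: by end_near. Qed.

Lemma differentiable_upto_pred k O f :
  differentiable_upto k.+1 O f -> differentiable_upto k O f.
Proof.
elim: k f => [|k IH] f [H1 H2]; split => // a; exact: IH.
Qed.

Lemma partial_cst (c : R) a : partial a (fun=> c) = fun=> 0.
Proof. by apply/funext => x; exact: derive_cst. Qed.

Lemma differentiable_upto_cst k O (c : R) : differentiable_upto k O (fun=> c).
Proof.
elim: k c => [|k IH] c; split=> // a; last by rewrite partial_cst.
Qed.

Lemma partialD f g a x : differentiable f x -> differentiable g x ->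
  partial a (fun y => f y + g y) x = partial a f x + partial a g x.
Proof. by move=> df dg; apply: deriveD; exact: diff_derivable. Qed.

Lemma partialM f g a x : differentiable f x -> differentiable g x ->
  partial a (fun y => f y * g y) x = partial a f x * g x + f x * partial a g x.
Proof.
move=> df dg; rewrite /partial deriveM; try exact: diff_derivable.
by rewrite addrC; congr (_ + _); rewrite /GRing.scale /= mulrC.
Qed.

Lemma partialZ (c : R) f a x : differentiable f x ->
  partial a (fun y => c * f y) x = c * partial a f x.
Proof.
by move=> df; rewrite (@partialM (fun=> c)) // partial_cst mul0r add0r.
Qed.

Lemma partial_comp (h : R -> R) (dh : R) f a x : differentiable f x ->
  is_derive (f x) 1 h dh -> partial a (h \o f) x = dh * partial a f x.
Proof.
move=> df hh; have Dh : differentiable h (f x) by apply/derivable1_diffP.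
rewrite /partial deriveE; last exact: differentiable_comp.
have -> : 'd (h \o f) x (delta_mx 0 a) = 'd h (f x) ('d f x (delta_mx 0 a)).
  by rewrite (diff_comp df Dh).
rewrite -(deriveE _ df); set z := 'D_ _ _ _.
have <- : z *: (1 : R) = z by rewrite /GRing.scale /= mulr1.
by rewrite linearZ -(deriveE _ Dh) derive_val /GRing.scale /= mulr1 mulrC.
Qed.

Lemma differentiable_uptoD k O f g : open O ->
  differentiable_upto k O f -> differentiable_upto k O g ->
  differentiable_upto k O (fun y => f y + g y).
Proof.
move=> oO; elim: k f g => [|k IH] f g [f1 f2] [g1 g2]; split=> //;
  try by move=> x Ox; apply: differentiableD; [exact: f1|exact: g1].
move=> a; apply: eq_differentiable_upto (IH _ _ (f2 a) (g2 a)) => // y Oy.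
by rewrite partialD; [|exact: f1|exact: g1].
Qed.

Lemma differentiable_uptoM k O f g : open O ->
  differentiable_upto k O f -> differentiable_upto k O g ->
  differentiable_upto k O (fun y => f y * g y).
Proof.
move=> oO; elim: k f g => [|k IH] f g F G; have [f1 f2] := F; have [g1 g2] := G; split=> //;
  try by move=> x Ox; apply: differentiableM; [exact: f1|exact: g1].
move=> a; apply: (@eq_differentiable_upto _ _
   (fun y => partial a f y * g y + f y * partial a g y)) => // [y Oy|].
  by rewrite partialM; [|exact: f1|exact: g1].
have {}F := differentiable_upto_pred F; have {}G := differentiable_upto_pred G.
by apply: differentiable_uptoD => //; apply: IH => //; [exact: f2|exact: g2].
Qed.

(* The derivative of a power is a multiple of another power, hence the
   induction bears on all the exponents at once. *)
Lemma differentiable_upto_powR k O f (r : R) : open O ->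
  (forall x, O x -> 0 < f x) ->
  differentiable_upto k O f -> differentiable_upto k O (fun y => f y `^ r).
Proof.
move=> oO f0 F.
have D x s : O x -> is_derive (f x) 1 (fun z => z `^ s) (s * f x `^ (s - 1)).
  by move=> Ox; apply: is_derive1_powR; exact: f0.
have Dx s x : O x -> differentiable (fun y => f y `^ s) x.
  move=> Ox; apply: (@differentiable_comp _ _ _ _ f (fun z => z `^ s)).
    exact: differentiable_upto0 F x Ox.
  by apply/derivable1_diffP; exact: (@ex_derive _ _ _ _ _ _ _ (D x s Ox)).
elim: k r F => [|k IH] r F; first by split=> // x; exact: Dx.
have [F1 F2] := F; split=> [x|a]; first exact: Dx.
apply: (@eq_differentiable_upto _ _ (fun y => r * f y `^ (r - 1) * partial a f y)) => //.
  move=> y Oy; rewrite -(partial_comp a (F1 y Oy) (D y r Oy)) //.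
apply: (@differentiable_uptoM _ _ (fun y => r * f y `^ (r - 1)) _ oO _ (F2 a)).
apply: differentiable_uptoM => //; first exact: differentiable_upto_cst.
by apply: IH; exact: differentiable_upto_pred.
Qed.

Lemma smooth_on_differentiable O f x : smooth_on O f -> O x -> differentiable f x.
Proof. by move=> sf; exact: (sf [::]). Qed.

Lemma smooth_on_continuous O f x : smooth_on O f -> O x -> {for x, continuous f}.
Proof. by move=> sf Ox; apply/differentiable_continuous/(smooth_on_differentiable sf). Qed.

Lemma smooth_on_sub O A f : A `<=` O -> smooth_on O f -> smooth_on A f.
Proof. by move=> AO sf s x Ax; apply: sf; exact: AO. Qed.

Lemma smooth_onU O A f : smooth_on O f -> smooth_on A f -> smooth_on (O `|` A) f.
Proof. by move=> sf tf s x [Ox|Ax]; [exact: sf|exact: tf]. Qed.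

Lemma smooth_on_partial O f a : smooth_on O f -> smooth_on O (partial a f).
Proof. by move=> sf s x Ox; have := sf (rcons s a) x Ox; rewrite foldr_rcons. Qed.

Lemma smooth_on_cst O (c : R) : smooth_on O (fun=> c).
Proof. by apply/smooth_onP => k; exact: differentiable_upto_cst. Qed.

Variable O : set 'rV[R]_d.
Hypothesis oO : open O.

Lemma eq_smooth_on f g : (forall y, O y -> f y = g y) -> smooth_on O f -> smooth_on O g.
Proof.
move=> fg /smooth_onP sf; apply/smooth_onP => k; exact: eq_differentiable_upto (sf k).
Qed.

Lemma smooth_onD f g : smooth_on O f -> smooth_on O g -> smooth_on O (fun y => f y + g y).
Proof.
move=> /smooth_onP sf /smooth_onP sg; apply/smooth_onP => k.
exact: differentiable_uptoD.
Qed.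

Lemma smooth_onM f g : smooth_on O f -> smooth_on O g -> smooth_on O (fun y => f y * g y).
Proof.
move=> /smooth_onP sf /smooth_onP sg; apply/smooth_onP => k.
exact: differentiable_uptoM.
Qed.

Lemma smooth_onZ (c : R) f : smooth_on O f -> smooth_on O (fun y => c * f y).
Proof. by move=> sf; apply: smooth_onM => //; exact: smooth_on_cst. Qed.

Lemma smooth_onN f : smooth_on O f -> smooth_on O (fun y => - f y).
Proof.
by move=> /(smooth_onZ (-1)); apply: eq_smooth_on => y _; rewrite mulN1r.
Qed.

Lemma smooth_on_powR f (r : R) : (forall x, O x -> 0 < f x) -> smooth_on O f ->
  smooth_on O (fun y => f y `^ r).
Proof.
move=> f0 /smooth_onP sf; apply/smooth_onP => k; exact: differentiable_upto_powR.
Qed.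

Lemma smooth_on_inv f : (forall x, O x -> 0 < f x) -> smooth_on O f ->
  smooth_on O (fun y => (f y)^-1).
Proof.
move=> f0 /(smooth_on_powR (-1) f0); apply: eq_smooth_on => y Oy.
by rewrite powR_inv1 // ltW // f0.
Qed.

Lemma smooth_on_sqrt f : (forall x, O x -> 0 < f x) -> smooth_on O f ->
  smooth_on O (fun y => Num.sqrt (f y)).
Proof.
move=> f0 /(smooth_on_powR (2^-1) f0); apply: eq_smooth_on => y Oy.
by rewrite powR12_sqrt // ltW // f0.
Qed.

Lemma smooth_on_sum (I : Type) (s : seq I) (F : I -> 'rV[R]_d -> R) :
  (forall i, smooth_on O (F i)) -> smooth_on O (fun y => \sum_(i <- s) F i y).
Proof.
move=> sF; elim: s => [|i s IH].
  by under eq_fun do rewrite big_nil; exact: smooth_on_cst.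
by under eq_fun do rewrite big_cons; exact: smooth_onD.
Qed.

Lemma smooth_on_prod (I : Type) (s : seq I) (F : I -> 'rV[R]_d -> R) :
  (forall i, smooth_on O (F i)) -> smooth_on O (fun y => \prod_(i <- s) F i y).
Proof.
move=> sF; elim: s => [|i s IH].
  by under eq_fun do rewrite big_nil; exact: smooth_on_cst.
by under eq_fun do rewrite big_cons; exact: smooth_onM.
Qed.

Lemma smooth_on_det n (G : 'rV[R]_d -> 'M[R]_n) :
  (forall i j, smooth_on O (fun y => G y i j)) -> smooth_on O (fun y => \det (G y)).
Proof.
move=> sG; apply: smooth_on_sum => s; apply: smooth_onZ; exact: smooth_on_prod.
Qed.

Lemma smooth_on_invmx n (G : 'rV[R]_d -> 'M[R]_n) i j :
  (forall i j, smooth_on O (fun y => G y i j)) ->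
  (forall y, O y -> 0 < \det (G y)) ->
  smooth_on O (fun y => invmx (G y) i j).
Proof.
move=> sG G0.
apply: (@eq_smooth_on (fun y => (\det (G y))^-1 * cofactor (G y) j i)).
  move=> y Oy; rewrite /invmx unitmxE unitfE gt_eqF ?G0 //=.
  by rewrite !mxE.
apply: smooth_onM; first by apply: smooth_on_inv => //; exact: smooth_on_det.
apply: smooth_onZ; apply: smooth_on_det => i' j'.
by under eq_fun do rewrite !mxE; exact: sG.
Qed.

(** Smoothness on [O] suffices, as [O] and the open complement of [K], where [f] vanishes, cover the
    whole space. *)
Lemma test_functionP f K : compact K -> K `<=` O -> (forall x, ~ K x -> f x = 0) ->
  smooth_on O f -> test_function O f.
Proof.
move=> cK KO f0 sf; split; last by exists K.
have cK' : closed K.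
  by apply: compact_closed => //; exact: norm_hausdorff.
have -> : setT = O `|` ~` K.
  apply/esym/seteqP; split=> // x _; have [Kx|nK] := pselect (K x); first by left; exact: KO.
  by right.
apply: smooth_onU => //.
have : smooth_on (~` K) (fun=> 0 : R) by exact: smooth_on_cst.
move=> /smooth_onP s0; apply/smooth_onP => k.
apply: eq_differentiable_upto (s0 k); first exact: closed_openC.
by move=> y Ky; rewrite f0.
Qed.

Lemma test_functionM f g : smooth_on O f -> test_function O g ->
  test_function O (fun y => f y * g y).
Proof.
move=> sf [sg [K [cK KO g0]]]; apply: (test_functionP cK KO).
  by move=> x Kx; rewrite g0 // mulr0.
by apply: smooth_onM => //; exact: smooth_on_sub sg.
Qed.

Lemma test_functionD f g : test_function O f -> test_function O g ->
  test_function O (fun y => f y + g y).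
Proof.
move=> [sf [K [cK KO f0]]] [sg [L [cL LO g0]]].
apply: (test_functionP (compactU cK cL)).
- by rewrite subUset.
- by move=> x /not_orP [Kx Lx]; rewrite f0 // g0 // addr0.
- by apply: smooth_onD; [exact: smooth_on_sub sf|exact: smooth_on_sub sg].
Qed.

Lemma test_function0 : test_function O (fun=> 0).
Proof.
apply: (@test_functionP _ set0) => //; first exact: compact0.
exact: smooth_on_cst.
Qed.

Lemma test_function_sum (I : Type) (s : seq I) (F : I -> 'rV[R]_d -> R) :
  (forall i, test_function O (F i)) -> test_function O (fun y => \sum_(i <- s) F i y).
Proof.
move=> sF; elim: s => [|i s IH].
  by under eq_fun do rewrite big_nil; exact: test_function0.
by under eq_fun do rewrite big_cons; exact: test_functionD.
Qed.

Lemma test_function_partial f a : test_function O f -> test_function O (partial a f).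
Proof.
move=> [sf [K [cK KO f0]]]; apply: (test_functionP cK KO); last first.
  by apply: smooth_on_partial; exact: smooth_on_sub sf.
move=> x Kx; have cK' : closed K.
  by apply: compact_closed => //; exact: norm_hausdorff.
rewrite (@eq_partial (~` K) f (fun=> 0)) ?partial_cst //.
exact: closed_openC.
Qed.

End smooth.

(** * Lebesgue measure on row vectors *)

Section row_measure.
Context {R : realType}.

Lemma row_norm_le d (x : 'rV[R]_d) (e : R) : 0 <= e ->
  `|x| <= e <-> forall a, `|x 0 a| <= e.
Proof.
move=> e0; rewrite /Num.Def.normr /= mx_normrE; split=> [H a|H].
  exact: (le_trans (le_bigmax _ (fun i => `|x i.1 i.2|) (0, a)) H).
by apply: bigmax_le => // -[i j] _ /=; rewrite (ord1 i); exact: H.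
Qed.

Lemma row_coord_norm d (x : 'rV[R]_d) a : `|x 0 a| <= `|x|.
Proof. by have /row_norm_le := lexx `|x|; apply. Qed.

Lemma open_row_box d (O : set 'rV[R]_d) x : open O -> O x ->
  exists2 e : R, 0 < e & forall y : 'rV[R]_d, (forall a, `|x 0 a - y 0 a| < e) -> O y.
Proof.
rewrite openE => oO /oO /nbhs_ballP [e /= e0 eO]; exists e => // y xy.
apply: eO; split=> // i j; rewrite (ord1 i); exact: xy.
Qed.

Definition rowt_box d (c : 'I_d -> R) (r : R) : set (d.-tuple R) :=
  [set t | forall a, `|tnth t a - c a| <= r].

Lemma measurable_rowt_box d (c : 'I_d -> R) (r : R) : measurable (rowt_box c r).
Proof.
rewrite (_ : rowt_box c r =
   \bigcap_(a in setT) ((fun t => tnth t a) @^-1` [set s | `|s - c a| <= r])).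
  apply: fin_bigcap_measurable; first exact: finite_finset.
  move=> a _; rewrite -[X in measurable X]setTI; apply: measurable_tnth => //.
  rewrite (_ : [set s | _] = `[c a - r, c a + r]%classic); first exact: measurable_itv.
  by apply/seteqP; split=> s /=; rewrite in_itv /= ler_distl.
by apply/seteqP; split=> t /= H; [move=> a _; exact: H|move=> a; exact: (H a I)].
Qed.

(* Boxes with rational centers and radii [1 / (k + 1)] form a countable basis. *)
Lemma measurable_rowt_open d (O : set 'rV[R]_d) : open O ->
  measurable (@rowt R d @^-1` O).
Proof.
move=> oO.
pose F (i : 'rV[rat]_d * nat) := rowt_box (fun a => ratr (i.1 0 a)) (i.2.+1%:R^-1).
pose G i := if `[< F i `<=` @rowt R d @^-1` O >] then F i else set0.
rewrite (_ : _ @^-1` O = \bigcup_i G i).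
  apply: countable_bigcupT_measurable => // i; rewrite /G.
  by case: ifP => _; [exact: measurable_rowt_box|exact: measurable0].
apply/seteqP; split=> t; last first.
  by move=> [i _]; rewrite /G; case: asboolP => //; apply.
move=> /= Ot; have [e e0 eO] := open_row_box oO Ot.
pose k := Num.truncn (2 / e).
have k0 : 0 < k.+1%:R^-1 :> R by rewrite invr_gt0 ltr0n.
have ke : k.+1%:R^-1 < e / 2.
  rewrite -[e / 2]invrK ltf_pV2 ?posrE ?invr_gt0 ?divr_gt0 ?ltr0n // invf_div.
  exact: truncnS_gt.
clearbody k.
have /choice [q qP] a : exists q : rat, `|tnth t a - ratr q| < k.+1%:R^-1.
  have [|q] := @rat_in_itvoo R (tnth t a - k.+1%:R^-1) (tnth t a + k.+1%:R^-1).
    by rewrite ltrD2l gtrN.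
  by rewrite in_itv /= => /andP[q1 q2]; exists q; rewrite distrC ltr_distl q1.
exists (\row_a q a, k) => //; rewrite /G; case: asboolP => [_ a|[]].
  by rewrite mxE ltW.
move=> s sF /=; apply: eO => a; rewrite !mxE.
move: (sF a) (qP a) ke; rewrite /= mxE; move: _.+1%:R^-1 => r + + re.
rewrite ltr_norml ler_norml => /andP[? ?] /andP[? ?].
by rewrite ltr_norml; apply/andP; split; lra.
Qed.

Lemma measurable_rowt_closed d (K : set 'rV[R]_d) : closed K ->
  measurable (@rowt R d @^-1` K).
Proof.
move=> cK; rewrite -[X in measurable X]setCK; apply: measurableC.
by apply: (@measurable_rowt_open _ (~` K)); exact: closed_openC.
Qed.

Lemma measurable_rowt d (O : set 'rV[R]_d) (f : 'rV[R]_d -> R) : open O ->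
  (forall x, O x -> {for x, continuous f}) ->
  measurable_fun (@rowt R d @^-1` O) (f \o @rowt R d).
Proof.
move=> oO cf _; apply: (measurability _ (measurable_realfun.RGenOpens.measurableE R));
  last exact: measurable_rowt_open.
move=> _ [_ [a [b ->] <-]].
apply: (@measurable_rowt_open _ (O `&` f @^-1` `]a, b[%classic)).
rewrite openE => x [Ox fx]; apply: filterI; first exact: open_nbhs_nbhs.
by apply: (cf x Ox); apply: open_nbhs_nbhs; split=> //; exact: interval_open.
Qed.

Lemma leb_rowt_box d (c : 'I_d -> R) (r : R) : 0 <= r ->
  leb R d (rowt_box c r) = ((2 * r) ^+ d)%:E.
Proof.
move=> r0; elim: d c => [|d IH] c.
  rewrite /= diracE expr0 mem_set //.
  by case.
transitivity (((@lebesgue_measure R) \x leb R d)%E ((@consT R d) @^-1` rowt_box c r)).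
  by [].
have -> : (@consT R d) @^-1` (rowt_box c r) =
    `[c 0 - r, c 0 + r]%classic `*` rowt_box (fun a => c (lift 0 a)) r.
  apply/seteqP; split=> -[s t] /=.
    move=> H; split=> [|a].
      by have := H 0; rewrite tnth0 in_itv /= ler_distl.
    by have := H (lift 0 a); rewrite tnthS.
  move=> [H1 H2] a; case: (unliftP 0 a) => [j|] ->.
    by rewrite tnthS; exact: H2.
  by rewrite tnth0; move: H1; rewrite in_itv /= ler_distl.
rewrite product_measure1E //; last exact: measurable_rowt_box.
rewrite IH.
have := @lebesgue_measure_itv R `[c 0 - r, c 0 + r]; rewrite /= lte_fin => ->.
have [rr|] := ltP (c 0 - r) (c 0 + r).
  by rewrite -EFinB -EFinM exprS; congr (_ * _)%:E; ring.
move=> rr; have -> : r = 0 by apply/eqP; rewrite eq_le r0; lra.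
by rewrite mulr0 mul0e expr0n.
Qed.

End row_measure.

(** * Tonelli and Fubini for the iterated Lebesgue measure *)

Section leb_fubini.
Context {R : realType} {d : nat}.
Notation mu := (@lebesgue_measure R).
Local Open Scope ereal_scope.
Implicit Type G : d.+1.-tuple R -> \bar R.

Lemma leb_tonelli_prod G : measurable_fun setT G -> (forall t, 0 <= G t) ->
  \int[leb R d.+1]_t G t = \int[mu \x leb R d]_z G (consT z).
Proof.
move=> mG G0; transitivity (\int[pushforward (mu \x leb R d) (@consT R d)]_t G t).
  by [].
by rewrite ge0_integral_pushforward //; exact: measurable_consT.
Qed.

Lemma leb_tonelli1 G : measurable_fun setT G -> (forall t, 0 <= G t) ->
  \int[leb R d.+1]_t G t = \int[mu]_s \int[leb R d]_t G (consT (s, t)).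
Proof.
move=> mG G0; rewrite leb_tonelli_prod // fubini_tonelli1 //.
exact: (measurableT_comp mG (@measurable_consT R d)).
Qed.

Lemma leb_tonelli2 G : measurable_fun setT G -> (forall t, 0 <= G t) ->
  \int[leb R d.+1]_t G t = \int[leb R d]_t \int[mu]_s G (consT (s, t)).
Proof.
move=> mG G0; rewrite leb_tonelli_prod // fubini_tonelli2 //.
exact: (measurableT_comp mG (@measurable_consT R d)).
Qed.

Lemma leb_integrable_prod G : (leb R d.+1).-integrable setT G ->
  (mu \x leb R d).-integrable setT (G \o (@consT R d)).
Proof.
move=> /integrableP[mG G1]; apply/integrableP; split.
  exact: (measurableT_comp mG (@measurable_consT R d)).
move: G1; rewrite leb_tonelli_prod //.
exact: measurableT_comp.
Qed.

Lemma leb_fubini_prod G : (leb R d.+1).-integrable setT G ->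
  \int[leb R d.+1]_t G t = \int[mu \x leb R d]_z G (consT z).
Proof.
move=> iG; transitivity (\int[pushforward (mu \x leb R d) (@consT R d)]_t G t).
  by [].
rewrite integral_pushforward //; first exact: measurable_consT.
- by case/integrableP : iG.
- exact: leb_integrable_prod.
Qed.

Lemma leb_fubini1 G : (leb R d.+1).-integrable setT G ->
  \int[leb R d.+1]_t G t = \int[mu]_s \int[leb R d]_t G (consT (s, t)).
Proof.
move=> iG; rewrite leb_fubini_prod // -(integral12_prod_meas1 (leb_integrable_prod iG)).
by [].
Qed.

Lemma leb_fubini2 G : (leb R d.+1).-integrable setT G ->
  \int[leb R d.+1]_t G t = \int[leb R d]_t \int[mu]_s G (consT (s, t)).
Proof.
move=> iG; rewrite leb_fubini_prod // -(integral21_prod_meas1 (leb_integrable_prod iG)).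
by [].
Qed.

End leb_fubini.

Section leint_theory.
Context {R : realType}.
Notation mu := (@lebesgue_measure R).

Definition consr d (s : R) (x : 'rV[R]_d) : 'rV[R]_(1 + d) := row_mx (const_mx s) x.

Lemma rowt_consT d (s : R) (t : d.-tuple R) :
  rowt (consT (s, t) : (1 + d).-tuple R) = consr s (rowt t).
Proof.
apply/rowP => a; rewrite !mxE; case: splitP => j ja.
  rewrite mxE (_ : a = 0) ?tnth0 //; apply/val_inj => /=.
  by rewrite [LHS]ja (ord1 j).
by rewrite mxE (_ : a = lift 0 j) ?tnthS //; exact/val_inj.
Qed.

Definition compactly_supported d (f : 'rV[R]_d -> R) :=
  exists2 M : R, 0 <= M & forall x, M < `|x| -> f x = 0.

Lemma closed_row_ball d (M : R) : closed [set x : 'rV[R]_d | `|x| <= M].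
Proof.
apply: (@closed_comp _ _ (fun x : 'rV[R]_d => `|x| : R) [set y | y <= M]).
  by move=> x _; exact: norm_continuous.
exact: closed_le.
Qed.

Lemma leb_rowt_ball d (M : R) : 0 <= M ->
  leb R d (@rowt R d @^-1` [set x | `|x| <= M]) = ((2 * M) ^+ d)%:E.
Proof.
move=> M0; rewrite -(leb_rowt_box (fun=> 0)) //; congr (leb _ _ _).
apply/seteqP; split=> t /=.
  by move=> /(row_norm_le _ M0) H a; have := H a; rewrite mxE subr0.
by move=> H; apply/(row_norm_le _ M0) => a; rewrite mxE -[X in `|X|]subr0; exact: H.
Qed.

Lemma measurable_rowt_ball d (M : R) : measurable (@rowt R d @^-1` [set x | `|x| <= M]).
Proof.
apply: measurable_rowt_closed; exact: closed_row_ball.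
Qed.

Lemma bounded_integrable d (D : set (d.-tuple R)) (g : d.-tuple R -> R) (B : R) :
  measurable D -> (leb R d D < +oo)%E -> measurable_fun D g ->
  (forall t, D t -> `|g t| <= B) -> (leb R d).-integrable D (EFin \o g).
Proof.
move=> mD D1 mg gB; apply: measurable_bounded_integrable => //.
by exists B; split; [exact: num_real|move=> r Br t /gB /le_trans; apply; exact: ltW].
Qed.

Lemma continuous_bounded_ball d (f : 'rV[R]_d -> R) (M : R) : continuous f ->
  exists B, forall x, `|x| <= M -> `|f x| <= B.
Proof.
move=> cf.
have cK : compact [set x : 'rV[R]_d | `|x| <= M].
  apply: bounded_closed_compact.
    by exists M; split; [exact: num_real|move=> r Mr x /= /le_trans; apply; exact: ltW].
  exact: closed_row_ball.
have cfK : compact (f @` [set x : 'rV[R]_d | `|x| <= M]).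
  by apply: continuous_compact => //; exact: continuous_subspaceT.
have [B [_ HB]] := compact_bounded cfK.
exists (B + 1) => x xM; apply: (HB (B + 1)); first by rewrite ltrDl.
by exists x.
Qed.

Lemma compactly_supported_integrable d (f : 'rV[R]_d -> R) : continuous f ->
  compactly_supported f -> (leb R d).-integrable setT (EFin \o (f \o @rowt R d)).
Proof.
move=> cf [M M0 fM].
pose D := @rowt R d @^-1` [set x | `|x| <= M].
have mD : measurable D by exact: measurable_rowt_ball.
have mf : measurable_fun setT (f \o @rowt R d).
  by apply: (@measurable_rowt _ d setT) => //; [exact: openT|move=> x _; exact: cf].
have [B fB] := continuous_bounded_ball M cf.
have := @bounded_integrable d D (f \o @rowt R d) B mD.
rewrite leb_rowt_ball // ltry => /(_ isT) H.
have {}H : (leb R d).-integrable D (EFin \o (f \o @rowt R d)).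
  by apply: H; [exact: measurable_funTS|move=> t; exact: fB].
have -> : EFin \o (f \o @rowt R d) = (EFin \o (f \o @rowt R d)) \_ D.
  apply/funext => t; rewrite patchE; case: ifPn => //; rewrite notin_setE /= => /negP.
  by rewrite -ltNge => /fM ->.
by apply/integrable_restrict => //; rewrite setTI.
Qed.

End leint_theory.

Section derive_along_map.
Context {R : numFieldType} {U V W : normedModType R}.
Variables (L : U -> V) (w : U) (v : V) (f : V -> W) (y : U).
Hypothesis Lw : forall h : R, L (h *: w + y) = h *: v + L y.

(** Along the line through [y] with direction [w], f o L has literally the difference quotients of
    [f], so no chain rule and no differentiability are required. The map [L] will insert or project
    coordinates. *)
Let growth_rate : (fun h => h^-1 *: (((f \o L) \o shift y) (h *: w) - (f \o L) y))
  = (fun h => h^-1 *: ((f \o shift (L y)) (h *: v) - f (L y))).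
Proof. by apply/funext => h /=; rewrite Lw. Qed.

Lemma derive_along_map : 'D_w (f \o L) y = 'D_v f (L y).
Proof. by rewrite /derive growth_rate. Qed.

Lemma derivable_along_map : derivable (f \o L) y w <-> derivable f (L y) v.
Proof. by rewrite /derivable growth_rate. Qed.

End derive_along_map.

(** * Integration by parts in several variables *)

Section integration_by_parts_rV.
Context {R : realType}.
Notation mu := (@lebesgue_measure R).

Lemma consr_line d (s h : R) (x : 'rV[R]_d) :
  consr (h *: 1 + s) x = h *: delta_mx 0 (lshift d 0) + consr s x.
Proof.
apply/rowP => a; rewrite !mxE eqxx /=; case: splitP => j ja; rewrite ?mxE.
  have -> : a = lshift d 0 by apply/val_inj; rewrite [LHS]ja (ord1 j).
  by rewrite eqxx.
have -> : (a == lshift d 0) = false.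
  by apply/negP => /eqP E; move: ja; rewrite E.
by rewrite mulr0 add0r.
Qed.

Lemma consr_shift d (s h : R) (x : 'rV[R]_d) (b : 'I_d) :
  consr s (h *: delta_mx 0 b + x) = h *: delta_mx 0 (rshift 1 b) + consr s x.
Proof.
apply/rowP => a; rewrite !mxE eqxx /=; case: splitP => j ja; rewrite ?mxE.
  have -> : (a == rshift 1 b) = false.
    by apply/negP => /eqP E; move: ja (ltn_ord j); rewrite E /= => <-.
  by rewrite mulr0 add0r.
rewrite eqxx /=; have -> // : (a == rshift 1 b) = (j == b).
apply/eqP/eqP => [E|<-]; last exact/val_inj.
by apply/val_inj => /=; move: ja; rewrite E /= => -[].
Qed.

Lemma consr_continuousl d (x : 'rV[R]_d) : continuous (fun s : R => consr s x).
Proof.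
move=> s; apply/cvgrPdist_lt => e e0; near=> t.
apply: (@le_lt_trans _ _ `|s - t|); last first.
  by near: t; apply/(nbhs_ballP s); exists e.
apply/row_norm_le => // a; rewrite !mxE; case: splitP => j _; rewrite ?mxE //.
by rewrite subrr normr0.
Unshelve. all: by end_near. Qed.

Lemma consr_continuousr d (s : R) : continuous (@consr R d s).
Proof.
move=> x; apply/(@cvgrPdist_lt _ _ _ (nbhs x) _ (consr s)) => e e0; near=> t.
apply: (@le_lt_trans _ _ `|x - t|); last first.
  by near: t; apply/(@nbhs_ballP _ 'rV[R]_d); exists e => // z; rewrite mx_norm_ball.
apply/row_norm_le => // a; rewrite !mxE; case: splitP => j _; rewrite ?mxE //.
  by rewrite subrr normr0.
by have := row_coord_norm (x - t) j; rewrite !mxE.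
Unshelve. all: by end_near. Qed.

Lemma consr_norm_ge d (s : R) (x : 'rV[R]_d) : `|s| <= `|consr s x| /\ `|x| <= `|consr s x|.
Proof.
split.
  have := row_coord_norm (consr s x) (lshift d 0); rewrite mxE.
  by case: splitP => j ja; rewrite ?mxE.
apply/row_norm_le => // a.
by have := row_coord_norm (consr s x) (rshift 1 a); rewrite row_mxEr.
Qed.

Lemma partial_compactly_supported d (f : 'rV[R]_d -> R) a :
  compactly_supported f -> compactly_supported (partial a f).
Proof.
move=> [M M0 fM]; exists M => // x Mx.
rewrite (@eq_partial _ _ [set y | M < `|y|] f (fun=> 0)) ?partial_cst //.
rewrite (_ : [set _ | _] = ~` [set y | `|y| <= M]).
  exact/closed_openC/closed_row_ball.
by apply/seteqP; split=> y /=; rewrite ltNge => /negP.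
Qed.

Lemma integral_derive_compact (h h' : R -> R) (M : R) : 0 <= M -> antideriv h h' ->
  continuous h' -> (forall s, M < `|s| -> h s = 0) -> (forall s, M < `|s| -> h' s = 0) ->
  (\int[mu]_s (h' s)%:E = 0)%E.
Proof.
move=> M0 hE ch' hM hM'.
(* With M + 1 in place of M, both endpoints lie strictly outside the region where [h] may be
   nonzero. *)
have E : (fun s => (h' s)%:E) = (EFin \o h') \_ (`[- (M + 1), M + 1]%classic).
  apply/funext => s; rewrite patchE; case: ifPn => //; rewrite notin_setE /= in_itv /= => /negP.
  rewrite -ler_norml -ltNge => Ms; rewrite hM' //.
  by apply: lt_trans Ms; rewrite ltrDl.
rewrite E -integral_mkcond (@continuous_FTC2 _ h' h).
- rewrite !hM; first by rewrite subee.
  + by rewrite normrN ger0_norm ?ltrDl // addr_ge0.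
  + by rewrite ger0_norm ?ltrDl // addr_ge0.
- lra.
- exact: continuous_subspaceT.
- have ch := antideriv_continuous hE; split.
  + by move=> x _; exact: (@ex_derive _ _ _ _ _ _ _ (hE x)).
  + exact/cvg_at_right_filter/ch.
  + exact/cvg_at_left_filter/ch.
- by move=> x _; rewrite derive1E (@derive_val _ _ _ _ _ _ _ (hE x)).
Qed.

(** By Fubini: in the direction of the first coordinate, the inner integral is that of the
    derivative of a compactly supported function on the line; any other direction is covered by the
    induction hypothesis on the slices. *)
Lemma integral_partial d (f : 'rV[R]_d -> R) (a : 'I_d) :
  (forall x, derivable f x (delta_mx 0 a)) -> continuous f -> continuous (partial a f) ->
  compactly_supported f -> (\int[leb R d]_t (partial a f (rowt t))%:E = 0)%E.
Proof.
elim: d f a => [|d IH] f a df cf cdf sf; first by have := ltn_ord a.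
have iG := compactly_supported_integrable cdf (partial_compactly_supported a sf).
have [M M0 fM] := sf; have [M' M'0 fM'] := partial_compactly_supported a sf.
have rt (s : R) (t : d.-tuple R) : rowt (consT (s, t)) = consr s (rowt t) :> 'rV_d.+1.
  exact: rowt_consT.
case: (unliftP 0 a) => [b|] ab.
  rewrite leb_fubini1 // (_ : (fun s => _) = cst 0%E) ?integral_cst //; last first.
    apply/funext => s /=; under eq_integral do rewrite rt.
    have ab' : a = rshift 1 b by rewrite ab; exact/val_inj.
    have E x : partial b (f \o @consr R d s) x = partial a f (consr s x).
      rewrite /partial (derive_along_map (v := delta_mx 0 a)) // => h.
      by rewrite ab' consr_shift.
    under eq_integral do rewrite -E.
    apply: IH.
    - move=> x; apply/(derivable_along_map (v := delta_mx 0 a)); last exact: df.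
      by move=> h; rewrite ab' consr_shift.
    - by move=> x; apply: continuous_comp; [exact: consr_continuousr|exact: cf].
    - have -> : partial b (f \o @consr R d s) = partial a f \o @consr R d s by apply/funext.
      by move=> x; apply: continuous_comp; [exact: consr_continuousr|exact: cdf].
    - exists M => // x Mx; apply: fM; apply: lt_le_trans Mx _.
      by case: (consr_norm_ge s x).
  by rewrite mul0e.
rewrite leb_fubini2 // (_ : (fun t => _) = cst 0%E) ?integral_cst ?mul0e //.
apply/funext => t /=; under eq_integral do rewrite rt.
have ab' : a = @lshift 1 d 0 by rewrite ab; exact/val_inj.
have L s h : consr (h *: 1 + s) (rowt t) = h *: delta_mx 0 a + consr s (rowt t) :> 'rV[R]_d.+1.
  by rewrite ab' consr_line.
pose M2 := Num.max M M'.
apply: (@integral_derive_compact (fun s => f (consr s (rowt t))) _ M2).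
- by rewrite le_max M0.
- move=> s; apply: DeriveDef.
    exact: ((derivable_along_map (L := fun s => consr s (rowt t)) f (L s)).2 (df _)).
  exact: (derive_along_map (L := fun s => consr s (rowt t)) f (L s)).
- by move=> s; apply: (@continuous_comp _ _ _ (fun s => consr s (rowt t)));
    [exact: consr_continuousl|exact: cdf].
- move=> s; rewrite gt_max => /andP[Ms _]; apply: fM; apply: lt_le_trans Ms _.
  by case: (consr_norm_ge s (rowt t)).
- move=> s; rewrite gt_max => /andP[_ Ms]; apply: fM'; apply: lt_le_trans Ms _.
  by case: (consr_norm_ge s (rowt t)).
Qed.

End integration_by_parts_rV.

(** * Test functions and weak derivatives *)

Section leint_test_functions.
Context {R : realType} {d : nat}.
Implicit Types (O : set 'rV[R]_d) (f g phi : 'rV[R]_d -> R) (x : 'rV[R]_d) (a : 'I_d).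

Lemma eq_leint O f g : (forall x, O x -> f x = g x) -> leint O f = leint O g.
Proof. by move=> fg; apply: eq_integral => t; rewrite inE /= => Ot; rewrite fg. Qed.

Lemma leint_setT O f : (forall x, ~ O x -> f x = 0) -> leint O f = leint setT f.
Proof.
move=> f0; rewrite /leint preimage_setT integral_mkcond; apply: eq_integral => t _.
by rewrite patchE; case: ifPn => //; rewrite notin_setE /= => /f0 ->.
Qed.

Lemma test_function_outside O f x : test_function O f -> ~ O x -> f x = 0.
Proof. by move=> [_ [K [_ KO f0]]] Ox; apply: f0 => /KO. Qed.

Lemma test_function_compactly_supported O f : test_function O f -> compactly_supported f.
Proof.
move=> [_ [K [cK _ f0]]]; have [M [_ HM]] := compact_bounded cK.
exists (Num.max 0 (M + 1)); first by rewrite le_max lexx.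
move=> x; rewrite gt_max => /andP[_ Mx]; apply: f0 => Kx.
have := HM (M + 1); rewrite ltrDl ltr01 => /(_ isT x Kx) /=.
by rewrite leNgt Mx.
Qed.

Lemma test_function_continuous O f : test_function O f -> continuous f.
Proof. by move=> [sf _] x; exact: smooth_on_continuous sf I. Qed.

Lemma test_function_integrable O f : test_function O f ->
  (leb R d).-integrable setT (EFin \o (f \o @rowt R d)).
Proof.
move=> tf; apply: compactly_supported_integrable.
  exact: test_function_continuous tf.
exact: test_function_compactly_supported tf.
Qed.

Lemma leint_test O f : test_function O f -> leint O f = leint setT f.
Proof. by move=> tf; apply: leint_setT => x; exact: test_function_outside. Qed.

Lemma leint_test_fin O f : test_function O f -> leint O f \is a fin_num.
Proof.
move=> tf; rewrite leint_test // /leint preimage_setT; apply: integrable_fin_num => //.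
exact: test_function_integrable tf.
Qed.

Lemma leint_testD O f g : open O -> test_function O f -> test_function O g ->
  (leint O (fun x => (f x + g x)%R) = leint O f + leint O g)%E.
Proof.
move=> oO tf tg; rewrite !leint_test //; last exact: test_functionD.
rewrite /leint preimage_setT; under eq_integral do rewrite EFinD.
have itf := test_function_integrable tf; have itg := test_function_integrable tg.
by rewrite integralD.
Qed.

Lemma leint_test_partial O f a : open O -> test_function O f ->
  leint O (partial a f) = 0%E.
Proof.
move=> oO tf; have td := test_function_partial a tf.
rewrite leint_test // /leint preimage_setT; apply: integral_partial.
- move=> x; apply: diff_derivable; exact: smooth_on_differentiable tf.1 I.
- exact: test_function_continuous tf.
- exact: test_function_continuous td.
- exact: test_function_compactly_supported tf.
Qed.

Lemma leint_test_sum_partial O (F : 'I_d -> 'rV[R]_d -> R) : open O ->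
  (forall a, test_function O (F a)) ->
  leint O (fun x => \sum_a partial a (F a) x) = 0%E.
Proof.
move=> oO tF; elim: (index_enum _) => [|a s IH].
  under [X in leint O X]eq_fun do rewrite big_nil.
  by apply: integral0.
under [X in leint O X]eq_fun do rewrite big_cons.
rewrite leint_testD //; first by rewrite IH leint_test_partial // adde0.
  exact: test_function_partial.
by apply: test_function_sum => // b; exact: test_function_partial.
Qed.

Lemma smooth_on_loc_integrable O f : open O -> smooth_on O f -> loc_integrable O f.
Proof.
move=> oO sf; split.
  by apply: measurable_rowt => // x Ox; exact: smooth_on_continuous sf Ox.
move=> K cK KO.
have cfK : {within K, continuous f}.
  by apply: continuous_in_subspaceT => x; rewrite inE => /KO; exact: smooth_on_continuous.
have [B [_ HB]] := compact_bounded (continuous_compact cfK cK).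
have [M [_ HM]] := compact_bounded cK.
have clK : closed K by apply: compact_closed => //; exact: norm_hausdorff.
have mK := measurable_rowt_closed clK.
have K1 : (leb R d (@rowt R d @^-1` K) < +oo)%E.
  apply: (@le_lt_trans _ _ (leb R d (@rowt R d @^-1` [set x | `|x| <= `|M| + 1]))).
    apply: le_measure; rewrite ?inE //; first exact: measurable_rowt_ball.
    move=> t Kt /=; apply: (HM (`|M| + 1)) => //.
    by apply: (le_lt_trans (ler_norm M)); rewrite ltrDl.
  by rewrite leb_rowt_ball ?ltry // addr_ge0.
have := @bounded_integrable _ _ _ (f \o @rowt R d) (`|B| + 1) mK K1.
have mf : measurable_fun (@rowt R d @^-1` K) (f \o @rowt R d).
  apply: (@measurable_funS _ _ _ _ (@rowt R d @^-1` O)).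
  - exact: measurable_rowt_open.
  - by move=> t /=; exact: KO.
  - by apply: measurable_rowt => // x Ox; exact: smooth_on_continuous sf Ox.
move=> /(_ mf) H; suff /H/integrableP[_] : forall t, (@rowt R d @^-1` K) t ->
    `|(f \o @rowt R d) t| <= `|B| + 1 by [].
move=> t Kt; apply: (HB (`|B| + 1)); last by exists (rowt t).
by apply: (le_lt_trans (ler_norm B)); rewrite ltrDl.
Qed.

Lemma weak_partial_smooth O f a : open O -> smooth_on O f ->
  weak_partial O a f (partial a f).
Proof.
move=> oO sf; split.
- exact: smooth_on_loc_integrable.
- by apply: smooth_on_loc_integrable => //; exact: smooth_on_partial.
move=> phi tphi.
have t1 : test_function O (fun x => f x * partial a phi x).
  by apply: test_functionM => //; exact: test_function_partial.
have t2 : test_function O (fun x => partial a f x * phi x).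
  by apply: test_functionM => //; exact: smooth_on_partial.
have H := leint_test_partial a oO (test_functionM oO sf tphi).
(* The integral of the derivative of f phi, which is a test function although [f] is only smooth on
   [O]. Both terms are finite, so one may be moved across the equality. *)
have E : (leint O (fun x => (f x * partial a phi x)%R) +
    leint O (fun x => (partial a f x * phi x)%R) = 0)%E.
  rewrite -leint_testD // -[RHS]H; apply: eq_leint => x Ox.
  rewrite partialM; first by rewrite addrC.
    exact: smooth_on_differentiable sf Ox.
  exact: smooth_on_differentiable tphi.1 I.
move: E (leint_test_fin t1) (leint_test_fin t2).
case: (leint O _) => // r; case: (leint O _) => // s; rewrite -EFinD => -[rs] _ _.
by rewrite -EFinN; congr (_%:E); lra.
Qed.

End leint_test_functions.

(** * Positive definite matrices *)

Section positive_definite.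
Context {R : realType}.

Definition quad_form n (G : 'M[R]_n) (v : 'rV[R]_n) : R := (v *m G *m v^T) 0 0.

Definition posdef n (G : 'M[R]_n) : Prop :=
  G^T = G /\ forall v : 'rV[R]_n, v != 0 -> 0 < quad_form G v.

Lemma quad_formE n (G : 'M[R]_n) v :
  quad_form G v = \sum_a \sum_b v 0 a * G a b * v 0 b.
Proof.
rewrite /quad_form mxE exchange_big /=; apply: eq_bigr => b _.
by rewrite !mxE mulr_suml.
Qed.

Variable n : nat.
Implicit Type G : 'M[R]_(1 + n).

Definition pivot G : R := G 0 0.
Definition pivot_row G : 'rV[R]_n := ursubmx G.
Definition schur G : 'M[R]_n :=
  drsubmx G - (pivot G)^-1 *: ((pivot_row G)^T *m pivot_row G).
(** The translation of the first coordinate that completes the square, as a function of the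
    remaining coordinates. *)
Definition schur_shift G (z : 'rV[R]_n) : R :=
  (pivot G)^-1 * (pivot_row G *m z^T) 0 0.

Lemma pivotE G : ulsubmx G = (pivot G)%:M.
Proof.
apply/matrixP => i j; rewrite !mxE !ord1 eqxx mulr1n /pivot.
by congr (G _ _); exact/val_inj.
Qed.

Lemma sym_dlsubmx G : G^T = G -> dlsubmx G = (pivot_row G)^T.
Proof. by move=> GT; rewrite /pivot_row trmx_ursub GT. Qed.

(** One step of Gaussian elimination: [L] has determinant 1 and clears the column below the
    pivot. *)
Lemma det_schur G : G^T = G -> pivot G != 0 -> \det G = pivot G * \det (schur G).
Proof.
move=> GT p0.
pose L : 'M[R]_(1 + n) := block_mx 1%:M 0 (- (pivot G)^-1 *: (pivot_row G)^T) 1%:M.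
have LG : L *m G = block_mx (pivot G)%:M (pivot_row G) 0 (schur G).
  rewrite -{1}[G]submxK mulmx_block !mul1mx !mul0mx !addr0 pivotE sym_dlsubmx //.
  congr block_mx.
    rewrite -scalemxAl mul_mx_scalar scalerA mulNr mulVf // scaleN1r addNr //.
  rewrite -scalemxAl scaleNr addrC //.
have := congr1 determinant LG.
by rewrite det_mulmx det_ublock det_lblock !det1 !mul1r det_scalar1.
Qed.

Lemma quad_form_schur G (s : R) (z : 'rV[R]_n) : G^T = G -> pivot G != 0 ->
  quad_form G (consr s z) =
    pivot G * (s + schur_shift G z) ^+ 2 + quad_form (schur G) z.
Proof.
move=> GT p0; rewrite /quad_form -{1}[G]submxK pivotE sym_dlsubmx //.
rewrite /consr mul_row_block tr_row_mx mul_row_col -/(pivot_row G).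
set b := pivot_row G; set H := drsubmx G.
have c1 : (const_mx s : 'rV[R]_1) = s%:M.
  by apply/matrixP => i j; rewrite !mxE !ord1 eqxx mulr1n.
rewrite /schur -/b -/H /schur_shift -/b c1 tr_scalar_mx.
set beta := (b *m z^T) 0 0.
have E1 : z *m b^T = beta%:M.
  have -> : z *m b^T = (b *m z^T)^T by rewrite trmx_mul trmxK.
  by apply/matrixP => i j; rewrite !mxE !ord1 eqxx mulr1n /beta mxE.
have E2 : b *m z^T = beta%:M.
  by apply/matrixP => i j; rewrite /beta !ord1 [RHS]mxE eqxx mulr1n.
have E3 : z *m (H - (pivot G)^-1 *: (b^T *m b)) *m z^T =
    z *m H *m z^T - ((pivot G)^-1 * (beta * beta))%:M.
  rewrite mulmxBr mulmxBl; congr (_ - _).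
  rewrite -scalemxAr -scalemxAl !mulmxA E1 -mulmxA E2 -scalar_mxM.
  by rewrite scale_scalar_mx.
rewrite E3 E1 [(s%:M *m b + _) *m _]mulmxDl -(mulmxA s%:M b) E2 -!scalar_mxM -raddfD /= -scalar_mxM.
rewrite !mxE !eqxx /= !mulr1n; field; exact: p0.
Qed.

End positive_definite.

Section posdef_theory.
Context {R : realType}.

Lemma consr_eq0 n (s : R) (z : 'rV[R]_n) : z != 0 -> consr s z != 0.
Proof.
by apply: contra => /eqP /(congr1 rsubmx); rewrite row_mxKr => ->; rewrite raddf0.
Qed.

Lemma posdef_pivot n (G : 'M[R]_(1 + n)) : posdef G -> 0 < pivot G.
Proof.
move=> [_ G0]; have := G0 (delta_mx 0 0).
rewrite /quad_form -rowE trmx_delta -colE !mxE; apply.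
apply/negP => /eqP /rowP /(_ 0); rewrite !mxE !eqxx /=.
by move/eqP; rewrite oner_eq0.
Qed.

Lemma posdef_schur n (G : 'M[R]_(1 + n)) : posdef G -> posdef (schur G).
Proof.
move=> pG; have [GT G0] := pG; have p0 := lt0r_neq0 (posdef_pivot pG).
split.
  by rewrite /schur linearB /= linearZ /= trmx_mul trmxK trmx_drsub GT.
move=> z z0; have := G0 _ (consr_eq0 (- schur_shift G z) z0).
by rewrite quad_form_schur // addNr expr0n mulr0 add0r.
Qed.

(** Induction through the Schur complement, which is again positive definite. *)
Lemma posdef_det n (G : 'M[R]_n) : posdef G -> 0 < \det G.
Proof.
elim: n G => [|n IH] G pG; first by rewrite det_mx00.
have p0 := posdef_pivot (pG : posdef (G : 'M[R]_(1 + n))).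
rewrite (@det_schur _ _ (G : 'M[R]_(1 + n))) ?gt_eqF //; last by case: pG.
by apply: mulr_gt0 => //; exact/IH/posdef_schur.
Qed.

Lemma continuous_sum (V : topologicalType) (I : Type) (s : seq I) (F : I -> V -> R) :
  (forall i, continuous (F i)) -> continuous (fun x => \sum_(i <- s) F i x).
Proof.
move=> cF; elim: s => [|i s IH].
  by under eq_fun do rewrite big_nil; exact: cst_continuous.
under eq_fun do rewrite big_cons.
by move=> x; apply: cvgD; [exact: cF|exact: IH].
Qed.

Lemma quad_form_continuous n (G : 'M[R]_n) : continuous (quad_form G).
Proof.
have -> : quad_form G = fun v => \sum_a \sum_b v 0 a * G a b * v 0 b.
  by apply/funext => v; exact: quad_formE.
apply: continuous_sum => a; apply: continuous_sum => b x.
apply: (@differentiable_continuous _ _ _ x (fun y : 'rV[R]_n => y 0 a * G a b * y 0 b)).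
apply: (@differentiableM _ _ (fun y : 'rV[R]_n => y 0 a * G a b) (fun y => y 0 b)); last exact: differentiable_coord.
apply: (@differentiableM _ _ (fun y : 'rV[R]_n => y 0 a) (fun=> G a b)); last exact: differentiable_cst.
exact: differentiable_coord.
Qed.

Definition ellipsoid n (G : 'M[R]_n) (y : 'rV[R]_n) (r : R) : set 'rV[R]_n :=
  [set x | quad_form G (x - y) <= r ^+ 2].

Lemma closed_ellipsoid n (G : 'M[R]_n) y r : closed (ellipsoid G y r).
Proof.
apply: (@closed_comp _ _ (fun x : 'rV[R]_n => quad_form G (x - y) : R) [set s | s <= r ^+ 2]).
  move=> x _; apply: (@continuous_comp _ _ _ (fun x : 'rV[R]_n => x - y) (quad_form G)).
    by apply: differentiable_continuous; apply: differentiableB.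
  exact: quad_form_continuous.
exact: closed_le.
Qed.

Lemma measurable_ellipsoid n (G : 'M[R]_n) y r :
  measurable (@rowt R n @^-1` ellipsoid G y r).
Proof. by apply: measurable_rowt_closed; exact: closed_ellipsoid. Qed.

Lemma consrB n (s : R) (z : 'rV[R]_n) (y : 'rV[R]_(1 + n)) :
  consr s z - y = consr (s - lsubmx y 0 0) (z - rsubmx y).
Proof.
rewrite -{1}[y]hsubmxK /consr opp_row_mx add_row_mx; congr row_mx.
by apply/matrixP => i j; rewrite !mxE !ord1.
Qed.

(* Completing the square in the first coordinate, the sections of an ellipsoid
   are intervals, over an ellipsoid of the Schur complement. *)
Lemma leb_ellipsoid_schur n (G : 'M[R]_(1 + n)) y r : posdef G -> 0 <= r ->
  (leb R (1 + n) (@rowt R (1 + n) @^-1` ellipsoid G y r) <=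
   (2 * r / Num.sqrt (pivot G))%:E *
   leb R n (@rowt R n @^-1` ellipsoid (schur G) (rsubmx y) r))%E.
Proof.
move=> pG r0; have p0 := posdef_pivot pG; have GT := pG.1.
set p := pivot G in p0 *; set S := schur G.
have pS : posdef S by exact: posdef_schur.
set A := _ @^-1` _; set B := @rowt R n @^-1` ellipsoid S (rsubmx y) r.
have mA : measurable A by exact: measurable_ellipsoid.
have mB : measurable B by exact: measurable_ellipsoid.
have sp : 0 < Num.sqrt p by rewrite sqrtr_gt0.
(* The section over [t] is contained in the interval of center [c t] and half-length r / sqrt p, by
   p (s - c t)^2 <= r^2. *)
pose c t := lsubmx y 0 0 - schur_shift G (rowt t - rsubmx y).
have AE s t : A (consT (s, t)) -> B t /\ `|s - c t| <= r / Num.sqrt p.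
  rewrite /A /B /ellipsoid /= (@rowt_consT R n s t) consrB.
  rewrite quad_form_schur ?gt_eqF //.
rewrite -/p -/S => H.
  have q0 v : 0 <= quad_form S v.
    have [->|v0] := eqVneq v 0; first by rewrite /quad_form !mul0mx mxE.
    by apply: ltW; case: pS => _; apply.
  have H1 : p * (s - lsubmx y 0 0 + schur_shift G (rowt t - rsubmx y)) ^+ 2 <= r ^+ 2.
    by apply: le_trans H; rewrite lerDl.
  split; first by apply: le_trans H; rewrite lerDr mulr_ge0 ?sqr_ge0 // ltW.
  rewrite ler_pdivlMr // -(@ler_pXn2r _ 2) // ?nnegrE ?mulr_ge0 ?normr_ge0 ?(ltW sp) //.
  rewrite exprMn sqr_sqrtr ?(ltW p0) // real_normK ?num_real // mulrC.
  by apply: le_trans H1; rewrite /c opprB addrA addrAC.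
have mI : measurable_fun setT (fun t => (\1_A t)%:E : \bar R).
  by apply/measurable_EFinP; exact: measurable_indic.
rewrite -[X in (leb _ _ X <= _)%E]setIT -integral_indic // (@leb_tonelli2 R n) //.
apply: (@le_trans _ _ (\int[leb R n]_t ((2 * r / Num.sqrt p) * \1_B t)%:E)%E).
  apply: ge0_le_integral => //.
  - by move=> t _; apply: integral_ge0 => s _; rewrite lee_fin.
  - apply: (@measurable_fun_fubini_tonelli_G _ _ _ _ _ (@lebesgue_measure R)
      (fun z => (\1_A (consT z))%:E)) => //.
    exact: (measurableT_comp mI (@measurable_consT R n)).
  - by apply/measurable_EFinP; apply: measurable_funM => //; exact: measurable_indic.
  move=> t _; have [Bt|nBt] := pselect (B t); last first.
    have -> : \1_B t = 0 :> R by rewrite indicE memNset.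
    rewrite mulr0.
    rewrite integral0_eq // => s _; rewrite indicE memNset //.
    by move=> /AE [].
  have -> : \1_B t = 1 :> R by rewrite indicE mem_set.
  rewrite mulr1.
  apply: (@le_trans _ _ (\int[@lebesgue_measure R]_s
      (\1_(`[c t - r / Num.sqrt p, c t + r / Num.sqrt p]%classic) s)%:E)%E).
    apply: ge0_le_integral => //.
    + apply: (measurableT_comp (measurableT_comp mI (@measurable_consT R n))).
      by apply/measurable_fun_pairP; split=> /=; [exact: measurable_id|exact: measurable_cst].
    + by apply/measurable_EFinP; exact: measurable_indic.
    move=> s _; rewrite lee_fin !indicE.
    case: (boolP (_ \in A)) => [|_]; last by rewrite ler0n.
    rewrite inE => /AE [_ H]; rewrite mem_set //= in_itv /= -ler_distl.
    exact: H.
  rewrite integral_indic // setIT.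
  have := @lebesgue_measure_itv R `[c t - r / Num.sqrt p, c t + r / Num.sqrt p].
  rewrite /= => ->; rewrite lte_fin; case: ifP => _.
    by rewrite -EFinD lee_fin le_eqVlt; apply/orP; left; apply/eqP; ring.
  by rewrite lee_fin divr_ge0 ?mulr_ge0 // ltW.
under eq_integral do rewrite EFinM.
rewrite ge0_integralZl //.
- by rewrite integral_indic // setIT.
- by apply/measurable_EFinP; exact: measurable_indic.
- by rewrite lee_fin divr_ge0 ?mulr_ge0 // ltW.
Qed.

(** The section estimate is iterated along the factorization of the determinant. The volume of the
    unit ball is only bounded by that of a cube, but the factor 1 / sqrt(det G) is exact, and it
    will cancel the Riemannian density. *)
Lemma leb_ellipsoid n (G : 'M[R]_n) y r : posdef G -> 0 <= r ->
  (leb R n (@rowt R n @^-1` ellipsoid G y r) <= ((2 * r) ^+ n / Num.sqrt (\det G))%:E)%E.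
Proof.
elim: n G y => [|n IH] G y pG r0.
  by rewrite det_mx00 sqrtr1 expr0 divr1 /= diracE lee_fin lern1 leq_b1.
apply: (le_trans (@leb_ellipsoid_schur n G y r pG r0)).
have p0 : 0 < pivot (G : 'M[R]_(1 + n)) by exact: posdef_pivot.
have dS := posdef_det (posdef_schur (pG : posdef (G : 'M[R]_(1 + n)))).
apply: (@le_trans _ _ ((2 * r / Num.sqrt (pivot (G : 'M[R]_(1 + n))))%:E *
    ((2 * r) ^+ n / Num.sqrt (\det (schur (G : 'M[R]_(1 + n)))))%:E)%E).
  apply: lee_wpmul2l; last exact/IH/r0/posdef_schur.
  by rewrite lee_fin divr_ge0 ?mulr_ge0 // sqrtr_ge0.
rewrite -EFinM lee_fin (@det_schur _ _ (G : 'M[R]_(1 + n))) ?gt_eqF //; last by case: pG.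
rewrite sqrtrM; last exact: ltW.
by rewrite invfM exprS le_eqVlt; apply/orP; left; apply/eqP; ring.
Qed.

End posdef_theory.

(** * Green's identity in a chart *)

Section green_identity.
Context {R : realType} {d : nat}.
Variables (O : set 'rV[R]_d) (g : 'rV[R]_d -> 'M[R]_d).
Hypothesis oO : open O.
Hypothesis g_smooth : forall a b, smooth_on O (fun x => g x a b).
Hypothesis g_posdef : forall x, O x -> posdef (g x).
Implicit Types (f chi phi : 'rV[R]_d -> R) (a b : 'I_d).

(** A component of the gradient times the density, so that the Laplacian is minus its Euclidean
    divergence divided by the density. *)
Definition flux f a (y : 'rV[R]_d) : R :=
  vol_density g y * \sum_b invmx (g y) a b * partial b f y.

Lemma laplacianE f x :
  laplacian g f x = - (vol_density g x)^-1 * \sum_a partial a (flux f a) x.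
Proof. by []. Qed.

Let g_det x : O x -> 0 < \det (g x).
Proof. by move=> /g_posdef; exact: posdef_det. Qed.

Lemma vol_density_gt0 x : O x -> 0 < vol_density g x.
Proof. by move=> Ox; rewrite /vol_density sqrtr_gt0 g_det. Qed.

Lemma smooth_vol_density : smooth_on O (vol_density g).
Proof. by apply: smooth_on_sqrt => //; exact: smooth_on_det. Qed.

Lemma smooth_inverse_metric a b : smooth_on O (fun x => invmx (g x) a b).
Proof. exact: smooth_on_invmx. Qed.

Lemma inverse_metric_sym x a b : O x -> invmx (g x) a b = invmx (g x) b a.
Proof.
by move=> /g_posdef [gT _]; have := trmx_inv (g x); rewrite gT => {1}<-; rewrite mxE.
Qed.

Lemma smooth_flux f a : smooth_on O f -> smooth_on O (flux f a).
Proof.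
move=> sf; apply: smooth_onM => //; first exact: smooth_vol_density.
apply: smooth_on_sum => // b; apply: smooth_onM => //; first exact: smooth_inverse_metric.
exact: smooth_on_partial.
Qed.

Lemma test_flux phi a : test_function O phi -> test_function O (flux phi a).
Proof.
move=> tphi; apply: test_functionM => //; first exact: smooth_vol_density.
apply: test_function_sum => // b; apply: test_functionM => //; first exact: smooth_inverse_metric.
exact: test_function_partial.
Qed.

Let smooth_vol_inv : smooth_on O (fun x => - (vol_density g x)^-1).
Proof.
apply: smooth_onN => //; apply: smooth_on_inv => //; first exact: vol_density_gt0.
exact: smooth_vol_density.
Qed.

Lemma smooth_laplacian f : smooth_on O f -> smooth_on O (laplacian g f).
Proof.
move=> sf; apply: smooth_onM => //; apply: smooth_on_sum => // a.
by apply: smooth_on_partial; exact: smooth_flux.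
Qed.

Lemma test_laplacian phi : test_function O phi -> test_function O (laplacian g phi).
Proof.
move=> tphi; apply: test_functionM => //; apply: test_function_sum => // a.
by apply: test_function_partial => //; exact: test_flux.
Qed.

Lemma smooth_shifted_laplacian (alpha : R) f : smooth_on O f ->
  smooth_on O (shifted_laplacian g alpha f).
Proof.
move=> sf; apply: smooth_onD => //; first exact: smooth_laplacian.
exact: smooth_onZ.
Qed.

Lemma test_shifted_laplacian (alpha : R) phi : test_function O phi ->
  test_function O (shifted_laplacian g alpha phi).
Proof.
move=> tphi; apply: test_functionD => //; first exact: test_laplacian.
by apply: test_functionM => //; exact: smooth_on_cst.
Qed.

(** The field f flux(phi) - phi flux(f) has compact support in [O], so its divergence integrates to
    0. The products of first derivatives cancel because the inverse metric is symmetric. *)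
Lemma laplacian_green f phi : smooth_on O f -> test_function O phi ->
  leint O (fun x => f x * laplacian g phi x * vol_density g x) =
  leint O (fun x => laplacian g f x * phi x * vol_density g x).
Proof.
move=> sf tphi.
pose Z a y := f y * flux phi a y + - 1 * (flux f a y * phi y).
have tZ a : test_function O (Z a).
  apply: test_functionD => //; first by apply: test_functionM => //; exact: test_flux.
  apply: test_functionM => //; first exact: smooth_on_cst.
  by apply: test_functionM => //; exact: smooth_flux.
have t1 : test_function O (fun x => vol_density g x * (f x * laplacian g phi x)).
  apply: test_functionM => //; first exact: smooth_vol_density.
  by apply: test_functionM => //; exact: test_laplacian.
have tS : test_function O (fun x => \sum_a partial a (Z a) x).
  by apply: test_function_sum => // a; exact: test_function_partial.
have tphiO x : O x -> differentiable phi x.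
  by move=> _; exact: smooth_on_differentiable tphi.1 I.
transitivity (leint O (fun x => vol_density g x * (f x * laplacian g phi x) +
     \sum_a partial a (Z a) x)).
  rewrite leint_testD // leint_test_sum_partial // adde0.
  by apply: eq_leint => x Ox; rewrite mulrC.
apply: eq_leint => x Ox.
have df := smooth_on_differentiable sf Ox; have dphi := tphiO x Ox.
have dff a := smooth_on_differentiable (smooth_flux a sf) Ox.
have dfp a : differentiable (flux phi a) x.
  exact: smooth_on_differentiable (test_flux a tphi).1 I.
have vE h : vol_density g x * laplacian g h x = - \sum_a partial a (flux h a) x.
  by rewrite laplacianE mulrA mulrN divff ?gt_eqF ?vol_density_gt0 // mulN1r.
have ZE a : partial a (Z a) x =
    (partial a f x * flux phi a x - flux f a x * partial a phi x) +
    (f x * partial a (flux phi a) x - partial a (flux f a) x * phi x).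
  have d1 : differentiable (fun y => f y * flux phi a y) x by exact: differentiableM.
  have d2 : differentiable (fun y => flux f a y * phi y) x by exact: differentiableM.
  have d3 : differentiable (fun y => - 1 * (flux f a y * phi y)) x.
    by apply: differentiableM => //; exact: differentiable_cst.
  rewrite /Z (partialD _ d1 d3) (partialM _ df (dfp a)) (partialZ _ _ d2).
  rewrite (partialM _ (dff a) dphi).
  move: (partial a f x) (f x) (flux phi a x) (partial a (flux phi a) x)
    (partial a (flux f a) x) (flux f a x) (partial a phi x) (phi x) => *; ring.
under eq_bigr do rewrite ZE.
rewrite big_split /= !sumrB.
have -> : \sum_a partial a f x * flux phi a x = \sum_a flux f a x * partial a phi x.
  transitivity (vol_density g x * \sum_a \sum_b invmx (g x) a b * partial a f x * partial b phi x).
    rewrite mulr_sumr; apply: eq_bigr => a _; rewrite /flux mulrCA; congr (_ * _).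
    by rewrite mulr_sumr; apply: eq_bigr => b _; ring.
  rewrite exchange_big mulr_sumr; apply: eq_bigr => b _; rewrite /flux -mulrA; congr (_ * _).
  by rewrite mulr_suml; apply: eq_bigr => a _; rewrite (inverse_metric_sym a b Ox).
rewrite subrr add0r -mulr_sumr -mulr_suml mulrCA vE mulrN addKr.
by rewrite -mulrA [phi x * _]mulrC mulrA [laplacian _ _ _ * _]mulrC vE mulNr.
Qed.

Lemma shifted_laplacian_green (alpha : R) f phi : smooth_on O f -> test_function O phi ->
  leint O (fun x => f x * shifted_laplacian g alpha phi x * vol_density g x) =
  leint O (fun x => shifted_laplacian g alpha f x * phi x * vol_density g x).
Proof.
move=> sf tphi.
have sv := smooth_vol_density.
have t0 : test_function O (fun x => vol_density g x * (alpha / 2 * (f x * phi x))).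
  apply: test_functionM => //; apply: test_functionM => //; first exact: smooth_on_cst.
  exact: test_functionM.
have t1 : test_function O (fun x => f x * laplacian g phi x * vol_density g x).
  under eq_fun do rewrite mulrC.
  by apply: test_functionM => //; apply: test_functionM => //; exact: test_laplacian.
have t2 : test_function O (fun x => laplacian g f x * phi x * vol_density g x).
  under eq_fun do rewrite mulrC.
  by apply: test_functionM => //; apply: test_functionM => //; exact: smooth_laplacian.
transitivity (leint O (fun x => (f x * laplacian g phi x * vol_density g x)%R) +
  leint O (fun x => (vol_density g x * (alpha / 2 * (f x * phi x)))%R))%E.
  rewrite -leint_testD //; apply: eq_leint => x _; rewrite /shifted_laplacian.
  by move: (laplacian g phi x) (vol_density g x) => *; ring.
rewrite laplacian_green // -leint_testD //; apply: eq_leint => x _.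
by rewrite /shifted_laplacian; move: (laplacian g f x) (vol_density g x) => *; ring.
Qed.

Lemma paneitz_green (alpha : R) f phi : smooth_on O f -> test_function O phi ->
  leint O (fun x => f x * paneitz g alpha phi x * vol_density g x) =
  leint O (fun x => paneitz g alpha f x * phi x * vol_density g x).
Proof.
move=> sf tphi; rewrite shifted_laplacian_green //; last exact: test_shifted_laplacian.
by rewrite shifted_laplacian_green //; exact: smooth_shifted_laplacian.
Qed.

End green_identity.

(** * The charts of a compact manifold have finite volume *)

Section integral_subadditive.
Context d (T : measurableType d) (R : realType) (mu : {measure set T -> \bar R}).

Lemma ge0_integral_cover (I : eqType) (s : seq I) (E : set T) (Es : I -> set T)
    (f : T -> \bar R) :
  measurable_fun setT f -> (forall t, 0 <= f t)%E -> measurable E ->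
  (forall i, measurable (Es i)) ->
  (forall t, E t -> exists2 i, i \in s & Es i t) ->
  (\int[mu]_(t in E) f t <= \sum_(i <- s) \int[mu]_(t in Es i) f t)%E.
Proof.
move=> mf f0 mE mEs cov.
rewrite integral_mkcond; under eq_bigr do rewrite integral_mkcond.
have mr A : measurable A -> measurable_fun setT (f \_ A).
  by move=> mA; apply/(measurable_restrictT _ mA); exact: measurable_funTS.
have r0 A t : (0 <= (f \_ A) t)%E by rewrite patchE; case: ifP.
rewrite -ge0_integral_sum //; last by move=> i; exact/mr.
apply: ge0_le_integral => //.
- exact/mr.
- by apply: emeasurable_sum => i; exact/mr.
move=> t _; rewrite {1}patchE; case: ifPn => [|_]; last exact: sume_ge0.
rewrite inE => /cov [i si Eit]; rewrite (big_rem i) //=.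
rewrite {1}patchE mem_set // leeDl //; exact: sume_ge0.
Qed.

End integral_subadditive.

Section quad_form_bounds.
Context {R : realType} {n : nat}.
Implicit Types (G : 'M[R]_n) (u v : 'rV[R]_n).

Definition entry_sum G : R := \sum_a \sum_b `|G a b|.

Lemma entry_sum_ge0 G : 0 <= entry_sum G.
Proof. by apply: sumr_ge0 => a _; exact: sumr_ge0. Qed.

Lemma quad_form_le G v : quad_form G v <= entry_sum G * `|v| ^+ 2.
Proof.
rewrite quad_formE /entry_sum mulr_suml; apply: ler_sum => a _.
rewrite mulr_suml; apply: ler_sum => b _.
apply: (le_trans (ler_norm _)); rewrite !normrM mulrAC mulrC ler_wpM2l //.
by rewrite expr2 ler_pM // row_coord_norm.
Qed.

Lemma quad_form_ge0 G v : posdef G -> 0 <= quad_form G v.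
Proof.
move=> [_ G0]; have [->|v0] := eqVneq v 0; first by rewrite /quad_form !mul0mx mxE.
exact/ltW/G0.
Qed.

(** The parallelogram identity, from which the nonnegative term at u - v is dropped. *)
Lemma quad_formD_le G u v : posdef G ->
  quad_form G (u + v) <= 2 * quad_form G u + 2 * quad_form G v.
Proof.
move=> pG; have := quad_form_ge0 (u - v) pG.
rewrite !quad_formE => H.
rewrite -subr_ge0; apply: (le_trans H); rewrite le_eqVlt; apply/orP; left; apply/eqP.
rewrite !mulr_sumr -!big_split /= -sumrB; apply: eq_bigr => a _.
rewrite !mulr_sumr -!big_split /= -sumrB; apply: eq_bigr => b _.
rewrite !mxE; ring.
Qed.

End quad_form_bounds.

Section row_differentiable.
Context {R : realType} {n m : nat}.
Implicit Type f : 'rV[R]_n -> 'rV[R]_m.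

Lemma differentiable_row f x : (forall a, differentiable (fun y => f y 0 a) x) ->
  differentiable f x.
Proof.
move=> df; have -> : f = \sum_(a < m) (fun y => f y 0 a *: delta_mx 0 a).
  apply/funext => y; rewrite fct_sumE; exact: row_sum_delta.
apply: differentiable_sum => a; apply: differentiableZl; exact: df.
Qed.

Lemma differentiable_row_near f x (e : R) : differentiable f x -> 0 < e ->
  exists2 del : R, 0 < del & forall z, `|z - x| <= del ->
    `|f z - f x - (z - x) *m 'J f x| <= e * `|z - x|.
Proof.
move=> df e0; have /eqaddoP /(_ e e0) /nbhs_ballP [r /= r0 rP] := diff_locally df.
exists (r / 2); first by rewrite divr_gt0.
move=> z zx; have := rP (z - x); rewrite !fctE /= subrK opprD addrA mul_rV_lin1; apply.
rewrite mx_norm_ball /ball_ /= sub0r normrN; apply: (le_lt_trans zx).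
by rewrite ltr_pdivrMr // mulr_natr mulr2n ltrDl.
Qed.

End row_differentiable.

(** * Volume of a compact part of one chart, measured through cubes of another *)

Section chart_theory.
Context {R : realType} {d : nat} (X : rmanifold R d).
Hypothesis cX : compact_riemannian X.
Implicit Types (i j : chart_index X) (p : X) (x y z : 'rV[R]_d).

Notation coord_ i := (Defs.coord (atlas X i)).
Notation param_ i := (param (atlas X i)).
Notation dom_ i := (dom (atlas X i)).
Notation im_ i := (chart_im (atlas X i)).
Notation metric_ i := (metric (atlas X i)).

Lemma param_dom i x : im_ i x -> dom_ i (param_ i x).
Proof. by move=> [p pi <-]; rewrite (coordK cX). Qed.

Lemma paramK i x : im_ i x -> coord_ i (param_ i x) = x.
Proof. by move=> [p pi <-]; rewrite (coordK cX). Qed.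

Lemma chart_posdef i x : im_ i x -> posdef (metric_ i x).
Proof.
by move=> ix; split; [exact: (Defs.metric_sym cX)|move=> v v0; exact: (metric_posdef cX)].
Qed.

Lemma chart_volume_gt0 i x : im_ i x -> 0 < vol_density (metric_ i) x.
Proof. by apply: vol_density_gt0 => y; exact: chart_posdef. Qed.

Lemma chart_volume_continuous i x : im_ i x -> {for x, continuous (vol_density (metric_ i))}.
Proof.
move=> ix; apply: (smooth_on_continuous _ ix).
apply: smooth_vol_density; first exact: (chart_im_open cX).
  by move=> a b; exact: (metric_smooth cX).
by move=> y; exact: chart_posdef.
Qed.

(* The transition map is an isometry, hence to first order it maps small balls
   around [x] into ellipsoids of the metric at the image of [x]. *)
Lemma transition_ellipsoid i j p (L : R) :
  dom_ i p -> dom_ j p -> (forall h, quad_form (metric_ j (coord_ j p)) h <= L * `|h| ^+ 2) ->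
  exists2 del : R, 0 < del & forall z, `|z - coord_ j p| <= del ->
    quad_form (metric_ i (coord_ i p)) (coord_ i (param_ j z) - coord_ i p)
      <= (2 * L + 2) * `|z - coord_ j p| ^+ 2.
Proof.
move=> pi pj HL.
set x := coord_ j p; set y := coord_ i p; set G := metric_ i y.
pose tau z := coord_ i (param_ j z).
have tx : tau x = y by rewrite /tau /x (coordK cX).
have dtau : differentiable tau x.
  apply: differentiable_row => a.
  have H := @transition_smooth _ _ _ cX j i a [::] x; apply: H.
  by exists p.
have iG : posdef G by apply: chart_posdef; exists p.
pose c := entry_sum G.
have c0 : 0 <= c := entry_sum_ge0 G.
(* With this precision the remainder contributes at most c |h|^2 / (1 + c)^2 <= |h|^2 to the
   quadratic form. *)
have e0 : 0 < (1 + c)^-1 by rewrite invr_gt0; lra.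
have [del del0 H] := differentiable_row_near dtau e0.
exists del => // z zx; rewrite -/(tau z) -/x -/y.
have {}H := H z zx; rewrite tx in H.
set h := z - x in H *.
have -> : tau z - y = h *m 'J tau x + (tau z - y - h *m 'J tau x) by rewrite [RHS]addrC subrK.
apply: (le_trans (quad_formD_le _ _ iG)).
have q1 : quad_form G (h *m 'J tau x) <= L * `|h| ^+ 2.
  have -> : quad_form G (h *m 'J tau x) = quad_form (metric_ j x) h.
    rewrite /quad_form /x (@metric_transition _ _ _ cX j i p pj pi).
    by rewrite trmx_mul !mulmxA.
  exact: HL.
have q2 : quad_form G (tau z - y - h *m 'J tau x) <= `|h| ^+ 2.
  apply: (le_trans (quad_form_le _ _)); rewrite -/c.
  apply: (@le_trans _ _ (c * ((1 + c)^-1 * `|h|) ^+ 2)).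
    by rewrite ler_wpM2l // lerXn2r // nnegrE ?normr_ge0 // mulr_ge0 // ltW.
  rewrite exprMn mulrA -[X in _ <= X]mul1r ler_wpM2r ?sqr_ge0 //.
  rewrite exprVn ler_pdivrMr ?mul1r ?exprn_gt0 //; [nra|lra].
lra.
Qed.

Lemma param_near j x : im_ j x -> forall A : set X, nbhs (param_ j x) A ->
  \near x, A (param_ j x).
Proof. by move=> jx A nA; exact: (param_continuous cX jx). Qed.

Lemma param_compact_closed j (K : set 'rV[R]_d) : compact K -> K `<=` im_ j ->
  closed (param_ j @` K).
Proof.
move=> cK Kj; apply: compact_closed; first exact: (space_hausdorff cX).
apply: continuous_compact => //; apply: continuous_in_subspaceT => x; rewrite inE => Kx.
exact/(param_continuous cX)/Kj.
Qed.

Definition cube (x : 'rV[R]_d) (r : R) : set 'rV[R]_d := [set z | `|z - x| <= r].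

Lemma compact_cube x r : compact (cube x r).
Proof.
apply: bounded_closed_compact.
  exists (`|x| + r); split; first exact: num_real.
  move=> s sr z /= zr; apply: le_trans (ltW sr).
  rewrite -[z](subrK x) addrC; apply: (le_trans (ler_normD _ _)); exact: lerD.
apply: (@closed_comp _ _ (fun z : 'rV[R]_d => `|z - x| : R) [set s | s <= r]).
  move=> z _; apply: (@continuous_comp _ _ _ (fun z : 'rV[R]_d => z - x) (fun z => `|z| : R)).
    by apply: differentiable_continuous; apply: differentiableB.
  exact: norm_continuous.
exact: closed_le.
Qed.

Lemma cube_halves x r z : 0 <= r -> cube x r z ->
  exists s : {ffun 'I_d -> bool}, cube (x + \row_a ((-1) ^+ s a * (r / 2))) (r / 2) z.
Proof.
move=> r0 /(row_norm_le _ r0) zr.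
exists [ffun a => z 0 a < x 0 a]; apply/row_norm_le => [|a]; first by rewrite divr_ge0.
rewrite !mxE ffunE; have := zr a; rewrite !mxE !ler_norml => /andP[z1 z2].
by case: ltP => zx; rewrite ?expr0 ?expr1 ?mul1r ?mulN1r; apply/andP; split; lra.
Qed.

Lemma half_cube_sub x r (s : {ffun 'I_d -> bool}) : 0 <= r ->
  cube (x + \row_a ((-1) ^+ s a * (r / 2))) (r / 2) `<=` cube x r.
Proof.
move=> r0 z /row_norm_le; rewrite divr_ge0 // => /(_ isT) zr; apply/row_norm_le => // a.
have := zr a; rewrite !mxE !ler_norml => /andP[z1 z2].
by case: (s a) z1 z2; rewrite ?expr0 ?expr1 ?mul1r ?mulN1r => z1 z2; apply/andP; split; lra.
Qed.

Section transfer.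
Variables (i : chart_index X) (K : set 'rV[R]_d).
Hypotheses (cK : compact K) (Ki : K `<=` im_ i).

Let F (t : d.-tuple R) : \bar R :=
  (EFin \o (vol_density (metric_ i) \o @rowt R d)) \_ (@rowt R d @^-1` im_ i) t.

Lemma chart_volume_measurable : measurable_fun setT F.
Proof.
have oi : open (im_ i) by exact: (chart_im_open cX).
apply/(measurable_restrictT _ (measurable_rowt_open oi))/measurable_EFinP.
by apply: measurable_rowt => // x; exact: chart_volume_continuous.
Qed.

Lemma chart_volume_ge0 t : (0 <= F t)%E.
Proof. by rewrite /F patchE; case: ifP => // _; rewrite lee_fin sqrtr_ge0. Qed.

(** The part of [K], in chart [i], that the manifold identifies with [A] in chart [j]. Restricting
    to a compact [K] makes it closed, hence measurable. *)
Definition pullback j (A : set 'rV[R]_d) : set 'rV[R]_d :=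
  [set y | K y /\ (param_ j @` A) (param_ i y)].

Definition pullback_volume j A : \bar R :=
  \int[leb R d]_(t in @rowt R d @^-1` pullback j A) F t.

Lemma closed_pullback j A : compact A -> A `<=` im_ j -> closed (pullback j A).
Proof.
move=> cA Aj; have clA := param_compact_closed cA Aj.
have clK : closed K by apply: compact_closed => //; exact: norm_hausdorff.
rewrite -[pullback _ _]setCK; apply: open_closedC; rewrite openE => y /= Hy.
have [Ky|nKy] := pselect (K y); last first.
  have : nbhs y (~` K) by apply: open_nbhs_nbhs; split=> //; exact: closed_openC.
  by apply: filterS => z nKz [].
have nA : nbhs (param_ i y) (~` (param_ j @` A)).
  apply: open_nbhs_nbhs; split; first exact: closed_openC.
  by move=> H; apply: Hy.
by have := param_near (Ki Ky) nA; apply: filterS => z nz [_].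
Qed.

Lemma measurable_pullback j A : compact A -> A `<=` im_ j ->
  measurable (@rowt R d @^-1` pullback j A).
Proof. by move=> cA Aj; apply: measurable_rowt_closed; exact: closed_pullback. Qed.

(** In a small cube of radius r, the pullback lies in an ellipsoid of radius (4 L + 4) r, of
    Lebesgue measure at most (2 (4 L + 4) r)^d / sqrt(det G); the leading 2 bounds the variation of
    the density there. *)
Definition cube_bound (L : R) : R := 2 * (2 * (4 * L + 4)) ^+ d.

Variables (j : chart_index X) (x0 : 'rV[R]_d) (r0 L : R).
Hypotheses (r0_ge0 : 0 <= r0) (L0 : 0 <= L) (Q0 : cube x0 r0 `<=` im_ j).
Hypothesis quadL : forall x, cube x0 r0 x ->
  forall h, quad_form (metric_ j x) h <= L * `|h| ^+ 2.

Let sub_cube c r : cube c r `<=` cube x0 r0 -> cube c r `<=` im_ j.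
Proof. by move=> H z /H /Q0. Qed.

(** The cubes need only contain [x], not be centered at it, as bisection requires. The density at
    the image of [x] cancels against the determinant in the volume of the ellipsoid, so the bound
    involves only [L]. *)
Lemma pullback_volume_near x : cube x0 r0 x ->
  exists2 del : R, 0 < del & forall c r, 0 <= r <= del -> cube c r `<=` cube x0 r0 ->
    cube c r x -> (pullback_volume j (cube c r) <= (cube_bound L * r ^+ d)%:E)%E.
Proof.
move=> x0x; have jx := Q0 x0x.
have L4 : 0 <= 4 * L + 4 by rewrite addr_ge0 // mulr_ge0.
have L2 : 0 <= 2 * L + 2 by rewrite addr_ge0 // mulr_ge0.
have Cr r : 0 <= r -> (0 <= (cube_bound L * r ^+ d)%:E)%E.
  move=> r0'; rewrite lee_fin mulr_ge0 ?exprn_ge0 // /cube_bound mulr_ge0 // exprn_ge0 //.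
  by rewrite mulr_ge0.
have nearP (P : 'rV[R]_d -> Prop) : (\near x, P x) ->
    exists2 del : R, 0 < del & forall z, `|z - x| <= del -> P z.
  move=> /nbhs_ballP [e /= e0 eP]; exists (e / 2); first by rewrite divr_gt0.
  move=> z zx; apply: eP; rewrite mx_norm_ball /ball_ /= distrC.
  by apply: (le_lt_trans zx); rewrite ltr_pdivrMr // mulr_natr mulr2n ltrDl.
have dist c r z : cube c r x -> cube c r z -> `|z - x| <= 2 * r.
  move=> cx cz; have -> : z - x = (z - c) - (x - c) by rewrite opprB addrA subrK.
  apply: (le_trans (ler_normB _ _)); rewrite mulr_natl mulr2n; exact: lerD.
(* If [x] does not come from [K], then neither do the points near it, the image of [K] being closed,
   and the pullback of a small cube is empty. *)
have [[y0 Ky0 y0x]|nK] := pselect ((param_ i @` K) (param_ j x)); last first.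
  have nb : nbhs (param_ j x) (~` (param_ i @` K)).
    apply: open_nbhs_nbhs; split=> //; apply: closed_openC; exact: param_compact_closed.
  have [del del0 H] := nearP _ (param_near jx nb).
  exists (del / 2); first by rewrite divr_gt0.
  move=> c r /andP[r_ge0 rd] _ cx; rewrite /pullback_volume.
  rewrite (_ : _ @^-1` _ = set0) ?integral_set0 ?Cr //.
  apply/seteqP; split=> // t [Kt [z cz zt]].
  have := H z (le_trans (dist _ _ _ cx cz) _); rewrite -ler_pdivlMl // mulrC.
  by move=> /(_ rd); apply; exists (rowt t).
pose p := param_ j x.
have iy0 := Ki Ky0.
have pi : dom_ i p by rewrite /p -y0x; exact: param_dom.
have pj : dom_ j p by exact: param_dom.
have xE : coord_ j p = x by exact: paramK.
have y0E : coord_ i p = y0 by rewrite /p -y0x; exact: paramK.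
have [|del1 del10 H1] := @transition_ellipsoid i j p L pi pj.
  by rewrite xE; exact: quadL.
rewrite xE y0E in H1.
have vol0 := chart_volume_gt0 iy0.
(* By continuity the density at most doubles near [y0]; this is the first factor of [cube_bound]. *)
have nv : nbhs y0 [set y | vol_density (metric_ i) y <= 2 * vol_density (metric_ i) y0].
  have := chart_volume_continuous iy0.
  move=> /(_ [set s | s <= 2 * vol_density (metric_ i) y0]) /=; apply.
  have : nbhs (vol_density (metric_ i) y0) [set s | s < 2 * vol_density (metric_ i) y0].
    by apply: open_nbhs_nbhs; split; [exact: open_lt|rewrite /= mulr_natl mulr2n ltrDl].
  by apply: filterS => s /ltW.
have nv' : nbhs p (coord_ i @^-1` [set y | vol_density (metric_ i) y <= 2 * vol_density (metric_ i) y0]).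
  by apply: (Defs.coord_continuous cX pi); rewrite y0E.
have [del2 del20 H2] := nearP _ (param_near jx nv').
pose del := Num.min del1 del2.
have del0 : 0 < del by rewrite lt_min del10.
exists (del / 2); first by rewrite divr_gt0.
move=> c r /andP[r_ge0 rd] csub cx.
have zd z : cube c r z -> `|z - x| <= del1 /\ `|z - x| <= del2.
  move=> cz; have := dist _ _ _ cx cz.
  have : 2 * r <= del by rewrite -ler_pdivlMl // mulrC.
  by rewrite le_min => /andP[? ?] ?; split; apply: le_trans; eauto.
set G := metric_ i y0 in H1 *.
have pG : posdef G by exact: chart_posdef.
(* Points of the cube are within 2 r of [x], so the form is at most (2 L + 2) (2 r)^2. Since 2 L + 2
   >= 1, this is at most rho^2, without any square root. *)
pose rho := (4 * L + 4) * r.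
have rho0 : 0 <= rho by rewrite mulr_ge0.
have sub y : pullback j (cube c r) y ->
    ellipsoid G y0 rho y /\ vol_density (metric_ i) y <= 2 * vol_density (metric_ i) y0.
  move=> [Ky [z cz zy]]; have [z1 z2] := zd z cz.
  have yE : coord_ i (param_ j z) = y by rewrite zy paramK //; exact: Ki.
  split; last by have := H2 z z2; rewrite /= yE.
  rewrite /ellipsoid /=; have := H1 z z1; rewrite yE => H.
  apply: (le_trans H); have := dist _ _ _ cx cz => zx.
  apply: (@le_trans _ _ ((2 * L + 2) * (2 * r) ^+ 2)).
    by rewrite ler_wpM2l // lerXn2r ?nnegrE // mulr_ge0.
  have -> : rho ^+ 2 = (2 * L + 2) * (2 * r) ^+ 2 * (2 * L + 2) by rewrite /rho; ring.
  rewrite ler_peMr //; first by rewrite mulr_ge0 // sqr_ge0.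
  by apply: (@le_trans _ _ 2); rewrite ?ler1n // lerDr mulr_ge0.
have mP : measurable (@rowt R d @^-1` pullback j (cube c r)).
  by apply: measurable_pullback; [exact: compact_cube|exact: sub_cube].
apply: (@le_trans _ _ (\int[leb R d]_(t in @rowt R d @^-1` ellipsoid G y0 rho)
   (2 * vol_density (metric_ i) y0)%:E)%E).
  rewrite /pullback_volume integral_mkcond [leRHS]integral_mkcond.
  have mF := chart_volume_measurable.
  have mE := measurable_ellipsoid G y0 rho.
  apply: ge0_le_integral => //.
  - by move=> t _; rewrite patchE; case: ifP => // _; exact: chart_volume_ge0.
  - by apply/(measurable_restrictT _ mP); exact: measurable_funTS.
  - by apply/(measurable_restrictT _ mE); exact: measurable_cst.
  move=> t _; rewrite !patchE; case: (boolP (t \in _)) => [|_]; last first.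
    by case: ifP => // _; rewrite lee_fin mulr_ge0 // ltW.
  rewrite inE => /sub [Et vt]; rewrite (mem_set (Et : (rowt (d:=d) @^-1` ellipsoid G y0 rho) t)).
  rewrite /F patchE; case: ifP => _; rewrite lee_fin //.
  by rewrite mulr_ge0 // ltW.
rewrite integral_cst; last exact: measurable_ellipsoid.
apply: (@le_trans _ _ ((2 * vol_density (metric_ i) y0)%:E *
    ((2 * rho) ^+ d / Num.sqrt (\det G))%:E)%E).
  by apply: lee_wpmul2l; [rewrite lee_fin mulr_ge0 // ltW|exact: leb_ellipsoid].
rewrite -EFinM lee_fin /cube_bound /rho le_eqVlt; apply/orP; left; apply/eqP.
have vE : Num.sqrt (\det G) = vol_density (metric_ i) y0 by [].
rewrite vE; have -> : 2 * ((4 * L + 4) * r) = 2 * (4 * L + 4) * r by ring.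
rewrite exprMn; move: ((_ * _) ^+ d) (r ^+ d) => A B.
by field; exact: lt0r_neq0.
Qed.

(** The bound is additive under bisection: 2^d times its value at r / 2 is its value at r. If every
    half satisfied it, so would the whole cube. *)
Lemma pullback_volume_half c r : 0 <= r -> cube c r `<=` cube x0 r0 ->
  ((cube_bound L * r ^+ d)%:E < pullback_volume j (cube c r))%E ->
  exists c', cube c' (r / 2) `<=` cube c r /\
    ((cube_bound L * (r / 2) ^+ d)%:E < pullback_volume j (cube c' (r / 2)))%E.
Proof.
move=> r_ge0 csub bad; apply: contrapT => /forallNP good.
pose ctr (s : {ffun 'I_d -> bool}) := c + \row_a ((-1) ^+ s a * (r / 2)).
have sub s : cube (ctr s) (r / 2) `<=` cube c r by exact: half_cube_sub.
have le s : (pullback_volume j (cube (ctr s) (r / 2)) <= (cube_bound L * (r / 2) ^+ d)%:E)%E.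
  by rewrite leNgt; apply/negP => H; exact: good (conj (sub s) H).
have subj s : cube (ctr s) (r / 2) `<=` im_ j by apply: sub_cube => z /sub /csub.
move: bad; apply/negP; rewrite -leNgt.
apply: (@le_trans _ _ (\sum_(s <- enum {ffun 'I_d -> bool}) pullback_volume j (cube (ctr s) (r / 2)))%E).
  apply: ge0_integral_cover.
  - exact: chart_volume_measurable.
  - exact: chart_volume_ge0.
  - by apply: measurable_pullback; [exact: compact_cube|exact: sub_cube].
  - by move=> s; apply: measurable_pullback; [exact: compact_cube|exact: subj].
  move=> t [Kt [z cz zt]]; have [s sz] := cube_halves r_ge0 cz.
  by exists s; [rewrite mem_enum|split=> //; exists z].
apply: (@le_trans _ _ (\sum_(s <- enum {ffun 'I_d -> bool}) (cube_bound L * (r / 2) ^+ d)%:E)%E).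
  exact: lee_sum.
rewrite sumEFin big_enum /= sumr_const lee_fin cardT -cardE card_ffun card_bool card_ord.
by rewrite -[_ *+ (2 ^ d)]mulr_natr natrX -mulrA -exprMn divfK.
Qed.

(** A cube violating the bound would contain a nested sequence of violating cubes. A cluster point
    of their centers lies in all of them, and this contradicts the local estimate at that point;
    hence the local constant holds globally. *)
Lemma pullback_volume_le :
  (pullback_volume j (cube x0 r0) <= (cube_bound L * r0 ^+ d)%:E)%E.
Proof.
rewrite leNgt; apply/negP => bad.
pose B (k : nat) c := cube c (r0 / 2 ^+ k) `<=` cube x0 r0 /\
  ((cube_bound L * (r0 / 2 ^+ k) ^+ d)%:E < pullback_volume j (cube c (r0 / 2 ^+ k)))%E.
have rk k : 0 <= r0 / 2 ^+ k by rewrite divr_ge0 // exprn_ge0.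
have rS k : r0 / 2 ^+ k.+1 = r0 / 2 ^+ k / 2 by rewrite exprSr invfM mulrA.
(* Stated as an implication so that [choice] gives a total map; a pair of depth and center whose
   cube is not a violating one is left as it is. *)
have step (p : nat * 'rV[R]_d) : exists p' : nat * 'rV[R]_d, B p.1 p.2 ->
    [/\ p'.1 = p.1.+1, B p'.1 p'.2 & cube p'.2 (r0 / 2 ^+ p'.1) `<=` cube p.2 (r0 / 2 ^+ p.1)].
  have [[sp bp]|nb] := pselect (B p.1 p.2); last by exists p.
  have [c' [s' b']] := pullback_volume_half (rk _) sp bp.
  exists (p.1.+1, c') => _; split=> //=; last by rewrite rS.
  by rewrite /B rS; split=> // z /s' /sp.
have [nxt nxtP] := choice step.
pose st k := iter k nxt (0%N, x0).
have stP k : (st k).1 = k /\ B k (st k).2.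
  elim: k => [|k [k1 k2]]; first by rewrite /st /B /= expr0 divr1; do ?split.
  have [|e1 e2 _] := nxtP (st k); first by rewrite k1.
  by move: e1 e2; rewrite -/(st k.+1) k1 => e1; rewrite e1.
pose c k := (st k).2.
have nest k : cube (c k.+1) (r0 / 2 ^+ k.+1) `<=` cube (c k) (r0 / 2 ^+ k).
  have [k1 k2] := stP k; have [|e1 e2] := nxtP (st k); first by rewrite k1.
  by have [k1' _] := stP k.+1; rewrite -/(st k.+1) k1 k1'.
have nestm k m : cube (c (k + m)%N) (r0 / 2 ^+ (k + m)) `<=` cube (c k) (r0 / 2 ^+ k).
  by elim: m => [|m IH]; rewrite ?addn0 // addnS => z /nest /IH.
have [|x [_ xcl]] := @compact_cube x0 r0 (c @ \oo) _.
  exists 0%N => // k _; have [_ [sk _]] := stP k; apply: sk.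
  by rewrite /cube /= subrr normr0.
have xk k : cube (c k) (r0 / 2 ^+ k) x.
  have clk : closed (cube (c k) (r0 / 2 ^+ k)).
    by apply: compact_closed; [exact: norm_hausdorff|exact: compact_cube].
  apply: clk => A nA; have := xcl (cube (c k) (r0 / 2 ^+ k)) A; apply => //.
  exists k => // m /= km; have := @nestm k (m - k)%N; rewrite subnKC //; apply.
  by rewrite /cube /= subrr normr0.
have x0x : cube x0 r0 x by have [_ [sk _]] := stP 0%N; exact: sk (xk 0%N).
have [del del0 H] := pullback_volume_near x0x.
have [k kdel] : exists k, r0 / 2 ^+ k <= del.
  exists (Num.bound (r0 / del)); rewrite ler_pdivrMr ?exprn_gt0 // -ler_pdivrMl // mulrC.
  apply/ltW/(lt_le_trans (archi_boundP _)); first by rewrite divr_ge0 // ltW.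
  by rewrite -natrX ler_nat ltnW // ltn_expl.
have [_ [sk]] := stP k; apply/negP; rewrite -leNgt; apply: H => //.
  by rewrite rk.
exact: xk.
Qed.

End transfer.

Definition chart_volume_fun i (t : d.-tuple R) : \bar R :=
  (EFin \o (vol_density (metric_ i) \o @rowt R d)) \_ (@rowt R d @^-1` im_ i) t.

Let trace i K (S : set X) : set (d.-tuple R) :=
  [set t | K (rowt t) /\ S (param_ i (rowt t))].

(** The bound is uniform in the chart and in the compact set [K]; this is what survives the
    exhaustion of an unbounded chart by compact sets. Measurability is carried along for the sake of
    unions. *)
Let bounded_volume (S : set X) := exists C : R, forall i K, compact K -> K `<=` im_ i ->
  measurable (trace i K S) /\
  (\int[leb R d]_(t in trace i K S) chart_volume_fun i t <= C%:E)%E.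

(** On a small cube, continuity bounds the entries of the metric of chart [j], which supplies the
    constant [L] of the transfer estimate. *)
Lemma good_cube p : exists j r, [/\ cube (coord_ j p) r `<=` im_ j,
  bounded_volume (param_ j @` cube (coord_ j p) r) &
  nbhs p (param_ j @` cube (coord_ j p) r)].
Proof.
have [j pj] := atlas_cover cX p; exists j; set x := coord_ j p.
have jx : im_ j x by exists p.
have oj : open (im_ j) by exact: (chart_im_open cX).
have nE : \forall z \near x, entry_sum (metric_ j z) < entry_sum (metric_ j x) + 1.
  have cE : {for x, continuous (fun z => entry_sum (metric_ j z))}.
    rewrite /entry_sum.
    have {}c a b : {for x, continuous (fun z => `|metric_ j z a b|)}.
      apply: continuous_comp; last exact: norm_continuous.
      exact: (smooth_on_continuous (metric_smooth cX a b) jx).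
    have cs (I : Type) (s : seq I) (f : I -> 'rV[R]_d -> R) :
        (forall k, {for x, continuous (f k)}) ->
        {for x, continuous (fun z => \sum_(k <- s) f k z)}.
      move=> cf; elim: s => [|k s IH].
        have -> : (fun z => \sum_(k <- [::]) f k z) = cst 0.
          by apply/funext => z; rewrite big_nil.
        exact: cst_continuous.
      have -> : (fun z => \sum_(l <- k :: s) f l z) = f k \+ (fun z => \sum_(l <- s) f l z).
        by apply/funext => z; rewrite big_cons.
      exact: continuousD.
    by apply: (cs) => a; apply: (cs) => b.
  have := cE [set s | s < entry_sum (metric_ j x) + 1]; apply.
  by apply: open_nbhs_nbhs; split; [exact: open_lt|rewrite /= ltrDl].
have nO : \forall z \near x, im_ j z by apply: open_nbhs_nbhs.
have : \forall z \near x, entry_sum (metric_ j z) < entry_sum (metric_ j x) + 1 /\ im_ j z.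
  exact: filterI nE nO.
move=> /nbhs_ballP[e /= e0 eP].
exists (e / 2); have e20 : 0 <= e / 2 by rewrite divr_ge0 // ltW.
have sub z : cube x (e / 2) z -> entry_sum (metric_ j z) < entry_sum (metric_ j x) + 1 /\ im_ j z.
  move=> zx; apply: eP; rewrite mx_norm_ball /ball_ /= distrC.
  by apply: (le_lt_trans zx); rewrite ltr_pdivrMr // mulr_natr mulr2n ltrDl.
have sub2 : cube x (e / 2) `<=` im_ j by move=> z /sub [].
split=> //.
  exists (cube_bound (entry_sum (metric_ j x) + 1) * (e / 2) ^+ d) => i K cK Ki; split.
    have := measurable_pullback cK Ki (@compact_cube x (e / 2)) sub2.
    exact.
  have H := @pullback_volume_le i K cK Ki j x (e / 2) (entry_sum (metric_ j x) + 1) e20.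
  apply: H => //; first by rewrite addr_ge0 // entry_sum_ge0.
  move=> z /sub [zE _] h; apply: (le_trans (quad_form_le _ _)).
  by rewrite ler_wpM2r ?sqr_ge0 // ltW.
have nx : nbhs p (coord_ j @^-1` ball x (e / 2)).
  apply: (Defs.coord_continuous cX pj); apply: nbhsx_ballx; exact: divr_gt0.
have nd : nbhs p (dom_ j) by apply: open_nbhs_nbhs; split=> //; exact: (dom_open cX).
apply: filterS (filterI nx nd) => q [/= qx qj]; exists (coord_ j q); last exact: (coordK cX).
by move: qx; rewrite mx_norm_ball /ball_ /cube /= distrC => /ltW.
Qed.

Let bounded_volume0 : bounded_volume set0.
Proof.
exists 0 => i K _ _; have -> : trace i K set0 = set0 by apply/seteqP; split=> // t [].
by rewrite integral_set0; split.
Qed.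

Let bounded_volumeU S S' : bounded_volume S -> bounded_volume S' -> bounded_volume (S `|` S').
Proof.
move=> [C HC] [C' HC']; exists (C + C') => i K cK Ki.
have [mS lS] := HC i K cK Ki; have [mS' lS'] := HC' i K cK Ki.
have tE : trace i K (S `|` S') = trace i K S `|` trace i K S'.
  apply/seteqP; split=> t; first by move=> [Kt [?|?]]; [left|right].
  by move=> [[? ?]|[? ?]]; split=> //; [left|right].
rewrite tE; split; first exact: measurableU.
have mf := chart_volume_measurable i.
apply: (@le_trans _ _ (\sum_(b <- [:: true; false])
   \int[leb R d]_(t in if b then trace i K S else trace i K S') chart_volume_fun i t)%E).
  apply: ge0_integral_cover => //.
  - by move=> t; exact: chart_volume_ge0.
  - exact: measurableU.
  - by case.
  by move=> t [?|?]; [exists true|exists false].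
by rewrite !big_cons big_nil adde0 EFinD; exact: leeD.
Qed.

(** Compactness by filters: otherwise the complements of the sets of bounded volume generate a
    proper filter, and a good cube around one of its cluster points would have to meet its own
    complement. *)
Lemma bounded_volume_setT : bounded_volume setT.
Proof.
apply: contrapT => nT.
pose F : set_system X := [set S | exists2 S', bounded_volume S' & ~` S' `<=` S].
have pF : ProperFilter F.
  split=> [[S bS] S0|].
    by apply: nT; have <- : S = setT by apply/seteqP; split=> // p _; apply: contrapT => /S0.
  split.
  - by exists set0.
  - move=> A B [S bS SA] [S' bS' S'B]; exists (S `|` S'); first exact: bounded_volumeU.
    by rewrite setCU => p [/SA ? /S'B].
  - by move=> A B AB [S bS SA]; exists S => // p /SA /AB.
have [|p [_ pcl]] := space_compact cX pF; first by exists set0.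
have [j [r [_ bN nN]]] := good_cube p.
have [|q [nq Nq]] := pcl (~` (param_ j @` cube (coord_ j p) r)) _ _ nN.
  by exists (param_ j @` cube (coord_ j p) r).
exact: nq.
Qed.

(** An exhaustion of the chart by compact sets: points of norm at most m, at distance at least 1 /
    (m + 1) from the complement. *)
Let shrink i (m : nat) : set 'rV[R]_d :=
  [set y | `|y| <= m%:R] `&` \bigcap_(z in ~` im_ i) [set y | (m.+1%:R)^-1 <= `|y - z|].

(** Monotone convergence along the exhaustion, every term being below the same constant. *)
Lemma chart_volume_fin i : (leint (im_ i) (vol_density (metric_ i)) < +oo)%E.
Proof.
have [C HC] := bounded_volume_setT.
have oi : open (im_ i) by exact: (chart_im_open cX).
have clS m : closed (shrink i m).
  apply: closedI; first exact: closed_row_ball.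
  apply: closed_bigI => z _.
  apply: (@closed_comp _ _ (fun y : 'rV[R]_d => `|y - z| : R) [set s | (m.+1%:R)^-1 <= s]).
    move=> y _; apply: (@continuous_comp _ _ _ (fun y : 'rV[R]_d => y - z) (fun z => `|z| : R)).
      by apply: differentiable_continuous; apply: differentiableB.
    exact: norm_continuous.
  exact: closed_ge.
have subS m : shrink i m `<=` im_ i.
  move=> y [_ H]; apply: contrapT => ny.
  by have := H y ny; rewrite /= subrr normr0 leNgt invr_gt0 ltr0n.
have cS m : compact (shrink i m).
  apply: bounded_closed_compact => //; exists m%:R; split; first exact: num_real.
  by move=> s sm y [ym _]; exact: le_trans ym (ltW sm).
have ndS : {homo shrink i : n m / (n <= m)%N >-> (n <= m)%O}.
  move=> m m' mm'; apply/subsetPset => y [ym yz]; split.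
    by apply: (le_trans ym); rewrite ler_nat.
  move=> z nz; apply: le_trans (yz z nz).
  by rewrite lef_pV2 ?posrE ?ltr0n // ler_nat ltnS.
have covS : \bigcup_m (@rowt R d @^-1` shrink i m) = @rowt R d @^-1` im_ i.
  apply/seteqP; split=> t; first by move=> [m _ /subS].
  move=> /= it; have : nbhs (rowt t) (im_ i) by apply: open_nbhs_nbhs.
  move=> /nbhs_ballP [e /= e0 eP].
  exists (maxn (Num.bound `|rowt t|) (Num.bound e^-1)) => //; split=> /=.
    apply: ltW; apply: (lt_le_trans (archi_boundP (normr_ge0 _))).
    by rewrite ler_nat leq_maxl.
  move=> z nz /=; apply: (@le_trans _ _ e); last first.
    rewrite leNgt; apply/negP => H; apply: nz; apply: eP.
    by rewrite mx_norm_ball.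
  rewrite -[leRHS]invrK lef_pV2 ?posrE ?ltr0n ?invr_gt0 //.
  have ei : 0 <= e^-1 by rewrite invr_ge0 ltW.
  apply/ltW/(lt_le_trans (archi_boundP ei)).
  by rewrite ler_nat leqW // leq_maxr.
have mS m : measurable (@rowt R d @^-1` shrink i m) by exact: measurable_rowt_closed.
have mf := chart_volume_measurable i.
have -> : leint (im_ i) (vol_density (metric_ i)) =
    (\int[leb R d]_(t in \bigcup_m (@rowt R d @^-1` shrink i m)) chart_volume_fun i t)%E.
  rewrite covS /leint; apply: eq_integral => t it.
  by rewrite /chart_volume_fun patchE it.
have cvg : (\int[leb R d]_(t in @rowt R d @^-1` shrink i m) chart_volume_fun i t)%E
    @[m --> \oo] -->
   (\int[leb R d]_(t in \bigcup_m (@rowt R d @^-1` shrink i m)) chart_volume_fun i t)%E.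
  apply: ge0_nondecreasing_set_cvg_integral => //.
  - by move=> m m' /ndS /subsetPset H; apply/subsetPset => t; exact: H.
  - by move=> m; exact: measurable_funTS.
  - by move=> m t _; exact: chart_volume_ge0.
rewrite -(cvg_lim _ cvg) //; apply: le_lt_trans (ltry C).
apply: lime_le; first by apply/cvg_ex; eexists; exact: cvg.
apply: nearW => m; have [_] := HC i _ (cS m) (@subS m).
suff -> : trace i (shrink i m) setT = @rowt R d @^-1` shrink i m by [].
by apply/seteqP; split=> [t []|t ?].
Qed.

End chart_theory.

(** * Functions of the angle on a product with the circle *)

Section head_tail.
Context {R : realType} {e : nat}.
Implicit Types (x : 'rV[R]_(1 + e)) (V : R -> R) (W : 'rV[R]_e -> R) (b : 'I_e).

Definition head x : R := lsubmx x 0 0.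

Lemma headE x : head x = x 0 (lshift e 0).
Proof. by rewrite /head mxE. Qed.

Lemma head_consr (s : R) (y : 'rV[R]_e) : head (consr s y) = s.
Proof. by rewrite /head /consr row_mxKl mxE. Qed.

Lemma tail_consr (s : R) (y : 'rV[R]_e) : rsubmx (consr s y) = y.
Proof. exact: row_mxKr. Qed.

Lemma consr_head_tail x : consr (head x) (rsubmx x) = x.
Proof.
rewrite -[RHS]hsubmxK; congr row_mx; apply/rowP => a.
by rewrite !mxE ord1 headE.
Qed.

Lemma ord_head_tail (a : 'I_(1 + e)) : a = lshift e 0 \/ exists b, a = rshift 1 b.
Proof.
by case: (split_ordP a) => [k ->|b ->]; [left; rewrite ord1|right; exists b].
Qed.

Lemma head_shift x b (h : R) :
  head (h *: delta_mx 0 (rshift 1 b) + x) = head x.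
Proof.
by rewrite -[x in LHS]consr_head_tail -consr_shift head_consr.
Qed.

Lemma tail_line x (h : R) : rsubmx (h *: delta_mx 0 (lshift e 0) + x) = rsubmx x.
Proof.
by rewrite -[x in LHS]consr_head_tail -consr_line tail_consr.
Qed.

Lemma tail_shift x b (h : R) :
  rsubmx (h *: delta_mx 0 (rshift 1 b) + x) = h *: delta_mx 0 b + rsubmx x.
Proof.
by rewrite -[x in LHS]consr_head_tail -consr_shift tail_consr.
Qed.

Lemma derive_dir0 (U : normedModType R) (f : U -> R) y : 'D_0 f y = 0.
Proof.
rewrite /derive (_ : (fun h => _) = cst 0) ?lim_cst //.
by apply/funext => h /=; rewrite scaler0 add0r subrr scaler0.
Qed.

Lemma partial_head_mul W V V1 x : antideriv V V1 ->
  partial (lshift e 0) (fun y => W (rsubmx y) * V (head y)) x = W (rsubmx x) * V1 (head x).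
Proof.
move=> VV1; set F := fun y => _.
have := @derive_along_map R _ _ _ (fun s => consr s (rsubmx x)) 1 _ F (head x)
  (fun h => consr_line (head x) h (rsubmx x)).
rewrite consr_head_tail -/(partial _ F x) => <-.
have -> : F \o (fun s => consr s (rsubmx x)) = fun s => W (rsubmx x) * V s.
  by apply/funext => s; rewrite /F /= tail_consr head_consr.
by rewrite (@derive_val _ _ _ _ _ _ _ (antiderivZ (W (rsubmx x)) VV1 (head x))).
Qed.

Lemma partial_head V V1 : antideriv V V1 ->
  partial (lshift e 0) (V \o head) = V1 \o head.
Proof.
move=> VV1; apply/funext => x; have := @partial_head_mul (fun=> 1) _ _ x VV1.
rewrite mul1r /= => <-; congr (partial _ _ x).
by apply/funext => y; rewrite mul1r.
Qed.

Lemma partial_tail_head V b : partial (rshift 1 b) (V \o head) = fun=> 0.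
Proof.
apply/funext => x; rewrite /partial (@derive_along_map _ _ _ _ head _ 0).
  exact: derive_dir0.
by move=> h; rewrite head_shift scaler0 add0r.
Qed.

Lemma partial_head_tail W : partial (lshift e 0) (fun y : 'rV[R]_(1 + e) => W (rsubmx y)) = fun=> 0.
Proof.
apply/funext => x; rewrite /partial (@derive_along_map _ _ _ _ (fun y : 'rV[R]_(1 + e) => rsubmx y) _ 0).
  exact: derive_dir0.
by move=> h; rewrite tail_line scaler0 add0r.
Qed.

Lemma partial_tail W b :
  partial (rshift 1 b) (fun y : 'rV[R]_(1 + e) => W (rsubmx y)) = fun y => partial b W (rsubmx y).
Proof.
apply/funext => x; rewrite /partial.
apply: (@derive_along_map _ _ _ _ (fun y : 'rV[R]_(1 + e) => rsubmx y)) => h.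
exact: tail_shift.
Qed.

Lemma differentiable_head x : differentiable head x.
Proof.
have -> : head = fun y => y 0 (lshift e 0) by apply/funext => y; rewrite headE.
exact: differentiable_coord.
Qed.

Lemma differentiable_tail x : differentiable (fun y : 'rV[R]_(1 + e) => rsubmx y) x.
Proof.
apply: differentiable_row => a.
have -> : (fun y : 'rV[R]_(1 + e) => rsubmx y 0 a) = fun y => y 0 (rshift 1 a).
  by apply/funext => y; rewrite mxE.
exact: differentiable_coord.
Qed.

Lemma smooth_on_tail (O : set 'rV[R]_e) W : smooth_on O W ->
  smooth_on [set x : 'rV[R]_(1 + e) | O (rsubmx x)] (fun x => W (rsubmx x)).
Proof.
move=> sW s x Ox.
suff [W' sW' ->] : exists2 W', smooth_on O W' &
    foldr partial (fun x : 'rV[R]_(1 + e) => W (rsubmx x)) s = fun x => W' (rsubmx x).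
  apply: (@differentiable_comp _ _ _ _ (fun y : 'rV[R]_(1 + e) => rsubmx y) W').
    exact: differentiable_tail.
  exact: smooth_on_differentiable sW' Ox.
elim: s => [|a s [W' sW' /= ->]]; first by exists W.
have [->|[b ->]] := ord_head_tail a.
  by exists (fun=> 0); [exact: smooth_on_cst|exact: partial_head_tail].
by exists (partial b W'); [exact: smooth_on_partial|exact: partial_tail].
Qed.

Lemma differentiable_comp_head V V1 x : antideriv V V1 -> differentiable (V \o head) x.
Proof.
move=> VV1; apply: differentiable_comp; first exact: differentiable_head.
by apply/derivable1_diffP; exact: (@ex_derive _ _ _ _ _ _ _ (VV1 (head x))).
Qed.

(** Bootstrap: if V and its first three derivatives are differentiable to order k, so is the
    right-hand side, a power of the positive V being as regular as V. All four then gain one order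
    together. *)
Lemma smooth_on_ode_solution (A B q : R) V V1 V2 V3 : (forall s, 0 < V s) ->
  [/\ antideriv V V1, antideriv V1 V2, antideriv V2 V3 &
      antideriv V3 (fun s => A * V2 s - B * V s + V s `^ q)] ->
  smooth_on setT (V \o head).
Proof.
move=> V0 [a0 a1 a2 a3]; apply/smooth_onP => k.
suff [] : [/\ differentiable_upto k setT (V \o head), differentiable_upto k setT (V1 \o head),
    differentiable_upto k setT (V2 \o head) & differentiable_upto k setT (V3 \o head)] by [].
have step m U U' : antideriv U U' -> differentiable_upto m setT (U' \o head) ->
    differentiable_upto m.+1 setT (U \o head).
  move=> UU' dU'; split=> [x _|a]; first exact: differentiable_comp_head UU'.
  have [->|[b ->]] := ord_head_tail a; first by rewrite (partial_head UU').
  by rewrite partial_tail_head; exact: differentiable_upto_cst.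
elim: k => [|k [d0 d1 d2 d3]].
  by split; split=> // x _; apply: differentiable_comp_head; eauto.
split; apply: step; eauto.
have oT : open [set: 'rV[R]_(1 + e)] by exact: openT.
apply: (@differentiable_uptoD _ _ k setT (fun x => A * V2 (head x) - B * V (head x))) => //.
  apply: (@differentiable_uptoD _ _ k setT (fun x => A * V2 (head x))) => //.
    by apply: differentiable_uptoM => //; exact: differentiable_upto_cst.
  have -> : (fun x : 'rV[R]_(1 + e) => - (B * V (head x))) = fun x => - B * V (head x).
    by apply/funext => x; rewrite mulNr.
  by apply: differentiable_uptoM => //; exact: differentiable_upto_cst.
apply: (@differentiable_upto_powR _ _ k setT (V \o head)) => // x _; exact: V0.
Qed.

End head_tail.

(** * The product metric dt^2 + G and functions of t alone *)

Section product_metric.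
Context {R : realType} {e : nat}.
Variables (O1 : set 'rV[R]_1) (O2 : set 'rV[R]_e) (G : 'rV[R]_e -> 'M[R]_e).
Hypotheses (oO1 : open O1) (oO2 : open O2).
Hypothesis G_smooth : forall a b, smooth_on O2 (fun x => G x a b).
Hypothesis G_posdef : forall x, O2 x -> posdef (G x).
Implicit Types (x : 'rV[R]_(1 + e)) (V : R -> R) (a b : 'I_(1 + e)).

Definition product_set : set 'rV[R]_(1 + e) := [set x | O1 (lsubmx x) /\ O2 (rsubmx x)].
Definition product_metric x : 'M[R]_(1 + e) := block_mx 1%:M 0 0 (G (rsubmx x)).

Notation O := product_set.
Notation g := product_metric.
Notation hd := (lshift e (0 : 'I_1)).

Lemma open_product_set : open O.
Proof.
apply: openI.
  apply: (open_comp _ oO1) => x _; apply: differentiable_continuous.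
  apply: differentiable_row => a.
  have -> : (fun y : 'rV[R]_(1 + e) => lsubmx y 0 a) = fun y => y 0 (lshift e a).
    by apply/funext => y; rewrite mxE.
  exact: differentiable_coord.
apply: (open_comp _ oO2) => x _; apply: differentiable_continuous.
exact: differentiable_tail.
Qed.

Lemma smooth_product_metric a b : smooth_on O (fun x => g x a b).
Proof.
apply: (@smooth_on_sub _ _ [set x | O2 (rsubmx x)]); first by move=> x [].
have cst (c : R) (f : 'rV[R]_(1 + e) -> R) : f = (fun=> c) -> smooth_on [set x | O2 (rsubmx x)] f.
  by move=> ->; exact: smooth_on_cst.
have [->|[a' ->]] := ord_head_tail a; have [->|[b' ->]] := ord_head_tail b.
- by apply: (cst 1); apply/funext => x; rewrite /g block_mxEul mxE eqxx.
- by apply: (cst 0); apply/funext => x; rewrite /g block_mxEur mxE.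
- by apply: (cst 0); apply/funext => x; rewrite /g block_mxEdl mxE.
have -> : (fun x => g x (rshift 1 a') (rshift 1 b')) = fun x => G (rsubmx x) a' b'.
  by apply/funext => x; rewrite /g block_mxEdr.
exact: (smooth_on_tail (G_smooth a' b')).
Qed.

Lemma posdef_product_metric x : O x -> posdef (g x).
Proof.
move=> [_ /G_posdef [GT G0]]; split.
  by rewrite /g tr_block_mx tr_scalar_mx !trmx0 GT.
move=> v; rewrite -[v]hsubmxK => v0.
rewrite /quad_form /g mul_row_block !mulmx0 addr0 add0r mulmx1 tr_row_mx mul_row_col.
have sq : (lsubmx v *m (lsubmx v)^T) 0 0 = (lsubmx v 0 0) ^+ 2.
  by rewrite mxE big_ord1 [in X in _ * X]mxE.
rewrite mxE sq.
have [r0|r0] := eqVneq (rsubmx v) 0.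
  rewrite r0 !mul0mx [X in _ + X]mxE addr0 exprn_even_gt0 //=.
  apply: contra v0 => /eqP l0; rewrite r0.
  have -> : lsubmx v = 0 by apply/rowP => k; rewrite ord1 l0 mxE.
  by rewrite row_mx0.
by apply: ltr_wpDl; [exact: sqr_ge0|exact: G0].
Qed.

(** This holds at every [x], also outside the chart: where the matrix is singular, [invmx] returns
    it unchanged, and it has this block form as well. *)
Lemma inverse_product_metric x :
  exists H, invmx (g x) = block_mx 1%:M 0 0 H.
Proof.
have [u|nu] := boolP (g x \in unitmx).
  by exists (invmx (G (rsubmx x))); rewrite /g invmx_block_diag // invmx1.
by exists (G (rsubmx x)); rewrite /invmx (negbTE nu).
Qed.

Lemma inverse_product_metric_head x b : invmx (g x) hd b = (b == hd)%:R.
Proof.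
have [H ->] := inverse_product_metric x; have [->|[b' ->]] := ord_head_tail b.
  by rewrite block_mxEul mxE eqxx.
by rewrite block_mxEur mxE.
Qed.

Lemma inverse_product_metric_tail x (a : 'I_e) : invmx (g x) (rshift 1 a) hd = 0.
Proof. by have [H ->] := inverse_product_metric x; rewrite block_mxEdl mxE. Qed.

Lemma vol_density_product x : vol_density g x = vol_density G (rsubmx x).
Proof. by rewrite /vol_density /g det_ublock det1 mul1r. Qed.

Lemma eq_laplacian f f' x : (forall y, O y -> f y = f' y) -> O x ->
  laplacian g f x = laplacian g f' x.
Proof.
move=> ff' Ox; have oO := open_product_set.
have H a : partial a (flux g f a) x = partial a (flux g f' a) x.
  apply: (eq_partial _ oO _ Ox) => y Oy; rewrite /flux.
  by under eq_bigr => b _ do rewrite (eq_partial b oO ff' Oy).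
have S : \sum_a partial a (flux g f a) x = \sum_a partial a (flux g f' a) x.
  by apply: eq_bigr => a _; exact: H.
by rewrite (laplacianE g f x) S.
Qed.

Lemma sum_head (F : 'I_(1 + e) -> R) : (forall a : 'I_e, F (rshift 1 a) = 0) ->
  \sum_a F a = F hd.
Proof.
by move=> F0; rewrite big_split_ord /= big_ord1 [X in _ + X]big1 ?addr0.
Qed.

(** Only the first component of the flux is nonzero. The density depends on the other coordinates
    only, so it leaves the derivative and cancels. *)
Lemma laplacian_head V V1 V2 x : antideriv V V1 -> antideriv V1 V2 -> O x ->
  laplacian g (V \o head) x = - V2 (head x).
Proof.
move=> a0 a1 Ox.
have fluxE a : (fun y => vol_density g y * \sum_b invmx (g y) a b * partial b (V \o head) y) =
    fun y => (a == hd)%:R * (vol_density G (rsubmx y) * V1 (head y)).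
  apply/funext => y; rewrite vol_density_product mulrCA; congr (_ * _).
  rewrite sum_head => [|b]; last by rewrite partial_tail_head mulr0.
  rewrite (partial_head a0) /=; have [->|[b ->]] := ord_head_tail a.
    by rewrite inverse_product_metric_head eqxx.
  by rewrite inverse_product_metric_tail.
rewrite /laplacian (eq_bigr (fun a => partial a (fun y =>
  (a == hd)%:R * (vol_density G (rsubmx y) * V1 (head y))) x)) => [|a _]; last by rewrite fluxE.
rewrite sum_head => [|a]; last first.
  have -> : (fun y => (rshift 1 a == hd)%:R * (vol_density G (rsubmx y) * V1 (head y))) = fun=> 0.
    by apply/funext => y; rewrite mul0r.
  by rewrite partial_cst.
have -> : (fun y => (hd == hd)%:R * (vol_density G (rsubmx y) * V1 (head y))) =
    fun y => vol_density G (rsubmx y) * V1 (head y).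
  by apply/funext => y; rewrite eqxx mul1r.
rewrite (partial_head_mul _ _ a1) vol_density_product mulNr mulKf //.
by apply: lt0r_neq0; apply: (vol_density_gt0 G_posdef); exact: Ox.2.
Qed.

Lemma shifted_laplacian_head (alpha : R) V V1 V2 x : antideriv V V1 -> antideriv V1 V2 ->
  O x -> shifted_laplacian g alpha (V \o head) x = - V2 (head x) + alpha / 2 * V (head x).
Proof. by move=> a0 a1 Ox; rewrite /shifted_laplacian (laplacian_head a0 a1 Ox). Qed.

Lemma paneitz_head (alpha : R) V V1 V2 V3 V4 x :
  antideriv V V1 -> antideriv V1 V2 -> antideriv V2 V3 -> antideriv V3 V4 -> O x ->
  paneitz g alpha (V \o head) x =
    V4 (head x) - alpha * V2 (head x) + alpha ^+ 2 / 4 * V (head x).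
Proof.
move=> a0 a1 a2 a3 Ox.
pose W s := - V2 s + alpha / 2 * V s.
have b0 : antideriv W (fun s => - V3 s + alpha / 2 * V1 s).
  by apply: antiderivD; [exact: antiderivN|exact: antiderivZ].
have b1 : antideriv (fun s => - V3 s + alpha / 2 * V1 s) (fun s => - V4 s + alpha / 2 * V2 s).
  by apply: antiderivD; [exact: antiderivN|exact: antiderivZ].
rewrite /paneitz {1}/shifted_laplacian (@eq_laplacian _ (W \o head)) // => [|y Oy]; last first.
  by rewrite (shifted_laplacian_head _ a0 a1 Oy).
rewrite (laplacian_head b0 b1 Ox) (shifted_laplacian_head _ a0 a1 Ox).
by move: (V4 _) (V2 _) (V _) => *; field.
Qed.

(** The metric does not depend on the angle, and its entries with an index of the circle are
    constant. Functions of the angle meet no other symbol in their Hessian. *)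
Lemma christoffel_head a b x : christoffel g hd a b x = 0.
Proof.
rewrite /christoffel sum_head => [|c]; last by rewrite inverse_product_metric_head !mul0r.
have gh c : (fun y => g y hd c) = fun=> (c == hd)%:R.
  apply/funext => y; have [->|[c' ->]] := ord_head_tail c; rewrite /g.
    by rewrite block_mxEul mxE eqxx.
  by rewrite block_mxEur mxE.
have gh' c : (fun y => g y c hd) = fun=> (c == hd)%:R.
  apply/funext => y; have [->|[c' ->]] := ord_head_tail c; rewrite /g.
    by rewrite block_mxEul mxE eqxx.
  by rewrite block_mxEdl mxE.
have gab : partial hd (fun y => g y a b) x = 0.
  have [E|[a' E]] := ord_head_tail a; first by rewrite E gh partial_cst.
  have [E'|[b' E']] := ord_head_tail b; first by rewrite E' gh' partial_cst.
  have -> : (fun y => g y a b) = fun y : 'rV[R]_(1 + e) => G (rsubmx y) a' b'.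
    by apply/funext => y; rewrite E E' /g block_mxEdr.
  by rewrite (partial_head_tail (fun y => G y a' b')).
by rewrite gh gh' !partial_cst gab add0r subr0 !mulr0.
Qed.

Variables (V V1 V2 : R -> R).
Let w1 a x : R := (a == hd)%:R * V1 (head x).
Let w2 a b x : R := (a == hd)%:R * (b == hd)%:R * V2 (head x).

Lemma grad_sqnorm_head x : grad_sqnorm g w1 x = V1 (head x) ^+ 2.
Proof.
rewrite /grad_sqnorm sum_head => [|a]; last by rewrite big1 // => b _; rewrite /w1 mul0r mulr0 mul0r.
rewrite sum_head => [|a]; last by rewrite /w1 mul0r mulr0.
by rewrite inverse_product_metric_head /w1 eqxx !mul1r expr2.
Qed.

Lemma hessian_head a b x : hessian g w1 w2 a b x = w2 a b x.
Proof.
rewrite /hessian big1 ?subr0 // => c _; have [->|[c' ->]] := ord_head_tail c.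
  by rewrite christoffel_head mul0r.
by rewrite /w1 mul0r mulr0.
Qed.

Lemma hess_sqnorm_head x : hess_sqnorm g w1 w2 x = V2 (head x) ^+ 2.
Proof.
rewrite /hess_sqnorm.
under eq_bigr do under eq_bigr do under eq_bigr do under eq_bigr do rewrite !hessian_head.
rewrite sum_head => [|a]; last first.
  by do 3! (rewrite big1 // => ? _); rewrite /w2 !mul0r mulr0 mul0r.
rewrite sum_head => [|a]; last first.
  by do 2! (rewrite big1 // => ? _); rewrite /w2 mulr0 !mul0r mulr0 mul0r.
rewrite sum_head => [|a]; last first.
  by rewrite big1 // => ? _; rewrite /w2 !mul0r mulr0.
rewrite sum_head => [|a]; last by rewrite /w2 mulr0 !mul0r mulr0.
by rewrite !inverse_product_metric_head /w2 eqxx !mul1r expr2.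
Qed.

End product_metric.

Section product_integral.
Context {R : realType} {e : nat}.
Notation mu := (@lebesgue_measure R).

Lemma leint_product (A : set R) (O2 : set 'rV[R]_e) (h : R -> R) (W : 'rV[R]_e -> R) :
  measurable A -> measurable (@rowt R e @^-1` O2) ->
  measurable_fun setT h -> (forall s, 0 <= h s) ->
  measurable_fun (@rowt R e @^-1` O2) (W \o @rowt R e) -> (forall y, O2 y -> 0 <= W y) ->
  leint [set x : 'rV[R]_(1 + e) | A (head x) /\ O2 (rsubmx x)]
    (fun x => h (head x) * W (rsubmx x)) =
  (\int[mu]_(s in A) (h s)%:E * leint O2 W)%E.
Proof.
move=> mA mO mh h0 mW W0.
pose H : R -> \bar R := (EFin \o h) \_ A.
pose K : e.-tuple R -> \bar R := (EFin \o (W \o @rowt R e)) \_ (@rowt R e @^-1` O2).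
have mH : measurable_fun setT H.
  by apply/(measurable_restrictT _ mA)/measurable_EFinP; exact: measurable_funTS.
have mK : measurable_fun setT K by apply/(measurable_restrictT _ mO)/measurable_EFinP.
have H0 s : (0 <= H s)%E by rewrite /H patchE; case: ifP => // _; rewrite lee_fin.
have K0 t : (0 <= K t)%E.
  by rewrite /K patchE; case: ifPn => //; rewrite inE => /W0 ?; rewrite lee_fin.
pose Z (t : (1 + e).-tuple R) : \bar R := (H (thead t) * K [tuple of behead t])%E.
have mZ : measurable_fun setT Z.
  apply: emeasurable_funM.
    apply: (measurableT_comp mH); exact: measurable_tnth.
  apply: (measurableT_comp mK); exact: measurable_behead.
have ZE s t : Z (consT (s, t)) = (H s * K t)%E.
  by rewrite /Z; congr (H _ * K _)%E; exact/val_inj.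
transitivity (\int[leb R e.+1]_t Z t)%E.
  rewrite /leint integral_mkcond; apply: eq_integral => t _.
  have -> : t = consT (thead t, [tuple of behead t]) by apply/val_inj; rewrite /= [in LHS](tuple_eta t).
  rewrite ZE; set s := thead t; set r := [tuple of behead t].
  rewrite patchE /H /K !patchE /= (_ : point = 0%E) //.
  have -> : (consT (s, r) \in @rowt R (1 + e) @^-1` [set x | A (head x) /\ O2 (rsubmx x)]) =
     (s \in A) && (r \in @rowt R e @^-1` O2).
    apply/idP/andP.
      by rewrite inE /= rowt_consT head_consr tail_consr => -[? ?]; split; exact/mem_set.
    by move=> [/set_mem ? /set_mem ?]; rewrite inE /= rowt_consT head_consr tail_consr.
  case: (s \in A) => /=; last by rewrite mul0e.
  case: (r \in _); last by rewrite mule0.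
  by rewrite -EFinM rowt_consT head_consr tail_consr.
rewrite leb_tonelli1 //; last by move=> t; exact: mule_ge0.
have KE : (\int[leb R e]_t K t)%E = leint O2 W by rewrite /leint [RHS]integral_mkcond.
transitivity (\int[mu]_s (H s * leint O2 W))%E.
  apply: eq_integral => s _; under eq_integral do rewrite ZE.
  by rewrite ge0_integralZl // KE.
rewrite ge0_integralZr //; first by rewrite -integral_mkcond.
by rewrite -KE integral_ge0.
Qed.

End product_integral.

(** * The angular charts of the circle *)

Section circle_charts.
Context {R : realType}.
Implicit Types (s t : R).

Lemma angle_bounds (p : R * R) : - pi < angle p < pi.
Proof.
have := atan_gtNpi2 (p.2 / (1 + p.1)); have := atan_ltpi2 (p.2 / (1 + p.1)).
by rewrite /angle => ? ?; apply/andP; split; lra.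
Qed.

Lemma cos_half_gt0 t : - pi < t < pi -> 0 < cos (t / 2).
Proof. by move=> /andP[? ?]; apply: cos_gt0_pihalf; apply/andP; split; lra. Qed.

Lemma one_cos t : 1 + cos t = 2 * cos (t / 2) ^+ 2.
Proof.
have {1}-> : t = (t / 2) *+ 2 by rewrite -mulr_natr divfK.
by rewrite cos_mulr2n addrC subrK mulr_natl.
Qed.

Lemma angle_circle_pt t : - pi < t < pi -> angle (cos t, sin t) = t.
Proof.
move=> tpi; have c0 := cos_half_gt0 tpi; rewrite /angle /=.
have -> : sin t / (1 + cos t) = tan (t / 2).
  rewrite one_cos {1}(_ : t = (t / 2) *+ 2); last by rewrite -mulr_natr divfK.
  rewrite sin_mulr2n /tan -mulr_natl; field; exact: lt0r_neq0.
rewrite tanK; first by field.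
by move: tpi => /andP[? ?]; rewrite in_itv /=; apply/andP; split; lra.
Qed.

Lemma circle_pt_neq t : - pi < t < pi -> (cos t, sin t) <> (- 1, 0).
Proof.
move=> tpi [c _]; have := cos_half_gt0 tpi; have := one_cos t.
by rewrite c subrr => /esym/eqP; rewrite mulf_eq0 expf_eq0 /= pnatr_eq0 /= => /eqP ->; rewrite ltxx.
Qed.

Lemma circle_im_false :
  chart_im (circle_chart R false) = [set x | - pi < x 0 0 < pi].
Proof.
apply/seteqP; split=> x.
  by move=> [p _ <-] /=; rewrite mxE; exact: angle_bounds.
move=> /= xpi; exists (circle_pt (x 0 0)) => /=; first exact: circle_pt_neq.
by apply/rowP => k; rewrite !ord1 mxE angle_circle_pt.
Qed.

Lemma circle_im_true :
  chart_im (circle_chart R true) = [set x | 0 < x 0 0 < pi *+ 2].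
Proof.
have pi2 : (pi : R) *+ 2 = 2 * pi by rewrite mulr_natl.
apply/seteqP; split=> x.
  move=> [p _ <-] /=; rewrite mxE.
  by have /andP[? ?] := angle_bounds (- set_val p); apply/andP; split; lra.
move=> /= /andP[x1 x2]; have xpi : - pi < x 0 0 - pi < pi by apply/andP; split; lra.
have E : - ((cos (x 0 0), sin (x 0 0)) : R * R) = (cos (x 0 0 - pi), sin (x 0 0 - pi)).
  by rewrite cosB sinB cospi sinpi !mulrN1 !mulr0 addr0 subr0.
exists (circle_pt (x 0 0)) => /=.
  move=> H; apply: (circle_pt_neq xpi); rewrite -E /=.
  have -> : (cos (x 0 0), sin (x 0 0)) = (1, 0) := H.
  by congr pair; rewrite oppr0.
apply/rowP => k; rewrite !ord1 mxE.
have -> : - set_val (circle_pt (x 0 0)) = (cos (x 0 0 - pi), sin (x 0 0 - pi)) := E.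
by rewrite angle_circle_pt //; lra.
Qed.

Lemma periodic_int (T : R) (f : R -> R) (k : int) s : has_period T f ->
  f (s + T * k%:~R) = f s.
Proof.
move=> pf; have H m s' : f (s' + T * m%:R) = f s'.
  elim: m s' => [|m IH] s'; first by rewrite mulr0 addr0.
  by rewrite -natr1 mulrDr mulr1 addrA pf.
case: k => m; first exact: H.
by rewrite NegzE mulrNz mulrN -{2}[s](subrK (T * m.+1%:R)) H.
Qed.

(** The remainder r of s - t modulo 2 pi has cosine 1. If it were in (0, 2 pi), sin (r / 2) would be
    positive, against the half-angle formula. *)
Lemma circle_pt_periodic (f : R -> R) s t : has_period (pi *+ 2) f ->
  circle_pt s = circle_pt t -> f s = f t.
Proof.
move=> pf /(congr1 set_val) [cE sE].
have pi0 : 0 < (pi : R) *+ 2 by rewrite pmulrn_lgt0 ?pi_gt0.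
have c1 : cos (s - t) = 1 by rewrite cosB cE sE -!expr2 cos2Dsin2.
pose k := Num.floor ((s - t) / (pi *+ 2)).
pose r := s - t - pi *+ 2 * k%:~R.
have r0 : 0 <= r by rewrite subr_ge0 mulrC -ler_pdivlMr // Num.Theory.floor_le.
have r1 : r < pi *+ 2.
  rewrite ltrBlDl; have -> : (pi : R) *+ 2 * k%:~R + pi *+ 2 = (k + 1)%:~R * (pi *+ 2).
    by rewrite intrD; ring.
  by rewrite -ltr_pdivrMr // Num.Theory.floorD1_gt.
have cr : cos r = 1.
  have := @periodic_int (pi *+ 2) cos k r (fun x => cosD2pi x).
  by rewrite /r subrK c1 => <-.
have [r2|rneq] := eqVneq r 0.
  have sE' : s = t + pi *+ 2 * k%:~R by have : r = 0 := r2; rewrite /r; lra.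
  by rewrite sE' periodic_int.
have rp : 0 < r by rewrite lt_neqAle eq_sym rneq.
have : 0 < sin (r / 2).
  apply: sin_gt0_pi; apply/andP; split; first by rewrite divr_gt0.
  by rewrite ltr_pdivrMr // mulr_natr.
have : 2 * cos (r / 2) ^+ 2 = 2 by rewrite -one_cos cr.
have := cos2Dsin2 (r / 2); nra.
Qed.

End circle_charts.

Lemma chart_im_prod {R : realType} {T1 T2 : Type} {e : nat} (c1 : chart R T1 1)
    (c2 : chart R T2 e) :
  chart_im (prod_chart c1 c2) = product_set (chart_im c1) (chart_im c2).
Proof.
apply/seteqP; split=> x.
  by move=> [p [p1 p2] <-]; split; rewrite /= ?row_mxKl ?row_mxKr; [exists p.1|exists p.2].
move=> [[p p1 xp] [y y2 xy]]; exists (p, y) => //=.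
by rewrite xp xy hsubmxK.
Qed.

(** * Solutions on the product obtained from periodic functions of the angle *)

Section circle_product.
Context {R : realType} {e : nat} (M : rmanifold R e).
Hypothesis cM : compact_riemannian M.
Notation N := (rprod (S1 R) M).
Notation mu := (@lebesgue_measure R).
Implicit Types (b : bool) (m : chart_index M) (V : R -> R).

Notation im_ m := (chart_im (atlas M m)).
Notation metric_ m := (metric (atlas M m)).

Definition circle_angles b : set R :=
  if b then `]0, pi *+ 2[%classic else `]- pi, pi[%classic.

Lemma circle_imE b : chart_im (circle_chart R b) = [set x | circle_angles b (x 0 0)].
Proof.
by case: b; rewrite ?circle_im_true ?circle_im_false; apply/seteqP; split=> x;
  rewrite /circle_angles /= in_itv.
Qed.

Lemma measurable_circle_angles b : measurable (circle_angles b).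
Proof. by case: b; exact: measurable_itv. Qed.

Lemma circle_angles_sub b s : circle_angles b s -> `[- pi, pi *+ 2]%classic s.
Proof.
have := pi_gt0 R; have : (pi : R) *+ 2 = 2 * pi by rewrite mulr_natl.
case: b; rewrite /circle_angles /= !in_itv /= => E p0 /andP[s1 s2];
  by apply/andP; split; lra.
Qed.

Lemma open_circle_im b : open (chart_im (circle_chart R b)).
Proof.
rewrite circle_imE; apply: (@open_comp _ _ (fun x : 'rV[R]_1 => x 0 0) (circle_angles b)).
  by move=> x _; exact: coord_continuous.
by case: b; exact: interval_open.
Qed.

Lemma circle_chart_im b m :
  chart_im (atlas N (b, m)) = product_set (chart_im (circle_chart R b)) (im_ m).
Proof. exact: chart_im_prod. Qed.

Lemma circle_chart_metric b m : metric (atlas N (b, m)) = product_metric (metric_ m).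
Proof. by case: b. Qed.

(** Some angle of the first component is chosen, and periodicity makes the choice irrelevant. Both
    circle charts are parametrized by [circle_pt], so in a chart the function is just V of the first
    coordinate. *)
Definition circle_lift V (p : N) : R := V (xget 0 [set t | circle_pt t = p.1]).

Lemma circle_lift_pt V t (y : M) : has_period (pi *+ 2) V ->
  circle_lift V (circle_pt t, y) = V t.
Proof.
move=> pV; apply: circle_pt_periodic => //.
exact: (@xgetPex _ 0 [set s | circle_pt s = circle_pt t] (ex_intro _ t erefl)).
Qed.

Lemma local_rep_circle_lift V b m : has_period (pi *+ 2) V ->
  local_rep (X := N) (b, m) (circle_lift V) = V \o head.
Proof. by move=> pV; apply/funext => x; case: b; exact: circle_lift_pt. Qed.

Let oO2 m : open (im_ m).
Proof. exact: (chart_im_open cM). Qed.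

Let vol_measurable m :
  measurable_fun (@rowt R e @^-1` im_ m) (vol_density (metric_ m) \o @rowt R e).
Proof. by apply: measurable_rowt => // x; exact: (chart_volume_continuous cM). Qed.

Lemma circle_chart_set b m : chart_im (atlas N (b, m)) =
  [set x | circle_angles b (head x) /\ im_ m (rsubmx x)].
Proof. by rewrite circle_chart_im circle_imE. Qed.

Lemma chart_int_head b m (h : R -> R) : continuous h -> (forall s, 0 <= h s) ->
  chart_int (X := N) (b, m) (fun x => h (head x)) =
  (\int[mu]_(s in circle_angles b) (h s)%:E * leint (im_ m) (vol_density (metric_ m)))%E.
Proof.
move=> ch h0; rewrite /chart_int circle_chart_set circle_chart_metric.
under eq_leint do rewrite vol_density_product.
apply: leint_product => //.
- exact: measurable_circle_angles.
- exact: measurable_rowt_open.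
- exact: continuous_measurable_fun.
- by move=> y _; exact: sqrtr_ge0.
Qed.

Lemma circle_angles_integral_fin b (h : R -> R) : continuous h -> (forall s, 0 <= h s) ->
  (\int[mu]_(s in circle_angles b) (h s)%:E < +oo)%E.
Proof.
move=> ch h0.
pose J : set R := `[- pi, pi *+ 2]%classic.
have ih : mu.-integrable J (EFin \o h).
  apply: continuous_compact_integrable; first exact: segment_compact.
  exact: continuous_subspaceT.
have mJ : measurable J by exact: measurable_itv.
have sub : (\int[mu]_(s in circle_angles b) (h s)%:E <=
    \int[mu]_(s in J) (h s)%:E)%E.
  apply: ge0_subset_integral => //.
  - exact: measurable_circle_angles.
  - by apply/measurable_EFinP/measurable_funTS; exact: continuous_measurable_fun.
  - by move=> s _; rewrite lee_fin.
  by move=> s; exact: circle_angles_sub.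
apply: (le_lt_trans sub).
have /integrableP[_] := ih; apply: le_lt_trans; apply: ge0_le_integral => //.
- by move=> s _; rewrite lee_fin.
- by apply/measurable_EFinP/measurable_funTS; exact: continuous_measurable_fun.
- by apply: measurableT_comp => //; apply/measurable_EFinP/measurable_funTS; exact: continuous_measurable_fun.
by move=> s _; rewrite /= ger0_norm.
Qed.

Lemma chart_int_head_fin b m (h : R -> R) : continuous h -> (forall s, 0 <= h s) ->
  (chart_int (X := N) (b, m) (fun x => (h (head x))) < +oo)%E.
Proof.
move=> ch h0; rewrite chart_int_head //.
have I0 : (0 <= \int[mu]_(s in circle_angles b) (h s)%:E)%E.
  by apply: integral_ge0 => s _; rewrite lee_fin.
apply: lte_mul_pinfty => //; last exact: chart_volume_fin.
by rewrite ge0_fin_numE //; exact: circle_angles_integral_fin.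
Qed.

Variables (V V1 V2 V3 : R -> R) (alpha q : R).
Hypothesis V0 : forall s, 0 < V s.
Hypothesis pV : has_period (pi *+ 2) V.
Hypothesis ode : [/\ antideriv V V1, antideriv V1 V2, antideriv V2 V3 &
  antideriv V3 (fun s => alpha * V2 s - alpha ^+ 2 / 4 * V s + V s `^ q)].

Notation u := (circle_lift V).

Let smooth_rep O : smooth_on O (V \o head : 'rV[R]_(1 + e) -> R).
Proof. by apply: smooth_on_sub (smooth_on_ode_solution V0 ode). Qed.

Lemma circle_lift_smooth : smooth_fun u.
Proof. by move=> [b m]; rewrite local_rep_circle_lift. Qed.

Lemma circle_lift_classical : classical_solution alpha q u.
Proof.
move=> [b m] x; rewrite circle_chart_im circle_chart_metric local_rep_circle_lift // => Ox.
have [a0 a1 a2 a3] := ode.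
have oO1 : open (chart_im (circle_chart R b)) by exact: open_circle_im.
have pG y : im_ m y -> posdef (metric_ m y) by exact: (chart_posdef cM).
rewrite (paneitz_head oO1 (@oO2 m) pG alpha a0 a1 a2 a3 Ox).
rewrite [(V \o head) x]/=; move: (V (head x) `^ q) (V2 _) (V _) => *; ring.
Qed.

(** The Green identity moves the operator from the test function to [u], which is smooth, and the
    classical equation applies pointwise. *)
Lemma circle_lift_weak : weak_solution alpha q u.
Proof.
move=> [b m] phi; rewrite /chart_int circle_chart_im circle_chart_metric => tphi.
have H : chart_im (atlas N (b, m)) = product_set (chart_im (circle_chart R b)) (im_ m).
  exact: circle_chart_im.
rewrite local_rep_circle_lift // paneitz_green //.
- apply: eq_leint => x Ox; congr (_ * _ * _).
  have := @circle_lift_classical (b, m) x.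
  by rewrite H circle_chart_metric local_rep_circle_lift // => ->.
- by apply: open_product_set => //; exact: open_circle_im.
- move=> a c; apply: smooth_product_metric; exact: (metric_smooth cM).
by move=> y; apply: posdef_product_metric => z; exact: (chart_posdef cM).
Qed.

Lemma circle_lift_ae_positive : ae_positive u.
Proof.
move=> [b m]; apply: aeW => t _; rewrite local_rep_circle_lift //; exact: V0.
Qed.

(** The weak derivatives are the classical ones, and the norms of gradient and Hessian reduce to
    |V'| and |V''|. These are bounded on the angular intervals, and the charts of [M] have finite
    volume. *)
Lemma circle_lift_sobolev22 : sobolev22 u.
Proof.
have [a0 a1 a2 a3] := ode.
move=> [b m] g O; rewrite local_rep_circle_lift //.
have gE : g = product_metric (metric_ m) := circle_chart_metric b m.
exists (fun a x => (a == lshift e 0)%:R * V1 (head x)),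
  (fun a c x => (a == lshift e 0)%:R * (c == lshift e 0)%:R * V2 (head x)).
have oO : open O.
  by rewrite /O circle_chart_im; apply: open_product_set => //; exact: open_circle_im.
have p1 a : partial a (V \o head) = fun x : 'rV[R]_(1 + e) => (a == lshift e 0)%:R * V1 (head x).
  apply/funext => x; have [->|[c ->]] := ord_head_tail a.
    by rewrite (partial_head a0) eqxx mul1r.
  by rewrite partial_tail_head mul0r.
have p2 a c : partial a (partial c (V \o head)) =
    fun x : 'rV[R]_(1 + e) => (a == lshift e 0)%:R * (c == lshift e 0)%:R * V2 (head x).
  apply/funext => x; have [->|[c' ->]] := ord_head_tail c; last first.
    by rewrite partial_tail_head partial_cst mulr0 mul0r.
  rewrite (partial_head a0); have [->|[c' ->]] := ord_head_tail a.
    by rewrite (partial_head a1) eqxx !mul1r.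
  by rewrite partial_tail_head !mul0r.
have cont h h' : antideriv h h' -> continuous (fun s => h s ^+ 2).
  move=> hh' s; have ch := antideriv_continuous hh'.
  exact: (@continuousM _ _ h h s (ch s) (ch s)).
split.
- by move=> a; rewrite -p1; exact: weak_partial_smooth.
- move=> a c; rewrite -p1 -p2; apply: weak_partial_smooth => //.
  by apply: smooth_on_partial.
- apply: (@chart_int_head_fin b m (fun s => V s ^+ 2)); last by move=> s; exact: sqr_ge0.
  exact: cont a0.
- rewrite gE (_ : grad_sqnorm _ _ = fun x => V1 (head x) ^+ 2).
    apply: (@chart_int_head_fin b m (fun s => V1 s ^+ 2)); last by move=> s; exact: sqr_ge0.
    exact: cont a1.
  by apply/funext => x; exact: grad_sqnorm_head.
rewrite gE (_ : hess_sqnorm _ _ _ = fun x => V2 (head x) ^+ 2).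
  apply: (@chart_int_head_fin b m (fun s => V2 s ^+ 2)); last by move=> s; exact: sqr_ge0.
  exact: cont a2.
by apply/funext => x; exact: hess_sqnorm_head.
Qed.

End circle_product.

(** * Integration over the circle with its two overlapping charts *)

Section circle_volume.
Context {R : realType}.
Notation mu := (@lebesgue_measure R).
Implicit Types (b : bool) (s : R) (h : R -> R).

Let pi2_gt0 : 0 < (pi : R) *+ 2.
Proof. by rewrite pmulrn_lgt0 ?pi_gt0. Qed.

Lemma circle_angles_integral b h : continuous h -> has_period (pi *+ 2) h ->
  (\int[mu]_(s in circle_angles b) (h s)%:E = (int_per (pi *+ 2) h)%:E)%E.
Proof.
move=> ch ph; have [H hH] := continuous_antideriv ch.
have p0 := pi_gt0 R.
rewrite (int_perE pi2_gt0 ch hH); case: b; rewrite /circle_angles.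
  by rewrite (integral_antideriv pi2_gt0 ch hH).
rewrite (integral_antideriv _ ch hH); last lra.
congr EFin; rewrite -(periodic_antideriv_shift (- pi) hH ph); congr (H _ - _).
by rewrite mulr2n addrA addNr add0r.
Qed.

Definition circle_multiplicity s : nat := chart_multiplicity (X := S1 R) (circle_pt s).

(** The share of one chart: 1/2, except at (1, 0) and (-1, 0), where the sine vanishes and a single
    chart remains. *)
Definition circle_weight s : R := 2^-1 * (1 + \1_(sin @^-1` [set 0]) s).

Lemma circle_multiplicityE s :
  circle_multiplicity s = ((circle_pt s \in dom (circle_chart R true)) +
                          (circle_pt s \in dom (circle_chart R false)))%N.
Proof.
rewrite /circle_multiplicity /chart_multiplicity -sum1_card big_mkcond big_bool /=.
by rewrite !inE; do 2 case: (_ \in _).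
Qed.

Lemma circle_weightE s : (circle_multiplicity s)%:R^-1 = circle_weight s.
Proof.
have dE b : (circle_pt s \in dom (circle_chart R b)) =
    ~~ ((cos s == if b then 1 else - 1) && (sin s == 0)).
  apply/idP/idP.
    move=> /set_mem H; apply/negP => /andP[/eqP c /eqP z]; case: b H c => H c.
      by have E : (cos s, sin s) = (1, 0) by [rewrite c z]; exact: (H E).
    by have E : (cos s, sin s) = (- 1, 0) by [rewrite c z]; exact: (H E).
  move=> /negP H; rewrite inE; case: b H => H E; apply: H.
    have : (cos s, sin s) = (1, 0) := E.
    by case=> -> ->; rewrite !eqxx.
  have : (cos s, sin s) = (- 1, 0) := E.
  by case=> -> ->; rewrite !eqxx.
rewrite circle_multiplicityE !dE /circle_weight indicE.
have -> : (s \in sin @^-1` [set 0]) = (sin s == 0) by apply/idP/eqP; rewrite inE.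
have c2 := cos2Dsin2 s.
have [s0|s0] := eqVneq (sin s) 0; last by rewrite !andbF /= addr0 mulr1.
have neq : ((- 1 : R) == 1) = false by apply/eqP => H; lra.
have : (cos s - 1) * (cos s + 1) = 0 by rewrite s0 in c2; nra.
move=> /eqP; rewrite mulf_eq0 subr_eq0 addr_eq0 => /orP[] /eqP ->.
  by rewrite eqxx eq_sym neq /= invr1; field.
by rewrite eqxx neq /= invr1; field.
Qed.

Lemma circle_weight_ge0 s : 0 <= circle_weight s.
Proof. by rewrite -circle_weightE invr_ge0. Qed.

Lemma measurable_circle_weight : measurable_fun setT circle_weight.
Proof.
apply: measurable_funM => //; apply: measurable_funD => //.
apply: measurable_indic; rewrite -[X in measurable X]setTI.
by apply: (continuous_measurable_fun (@continuous_sin R)).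
Qed.

Lemma sin_eq0_circle_angles b s : circle_angles b s -> sin s = 0 -> s = if b then pi else 0.
Proof.
have key (t : R) : - pi < t < pi -> sin t = 0 -> t = 0.
  move=> /andP[t1 t2] st; case: (ltgtP t 0) => // t0.
    have : 0 < sin (- t) by apply: sin_gt0_pi; apply/andP; split; lra.
    by rewrite sinN st oppr0 ltxx.
  have : 0 < sin t by apply: sin_gt0_pi; apply/andP; split; lra.
  by rewrite st ltxx.
case: b; rewrite /circle_angles /= in_itv /=; last exact: key.
move=> /andP[s1 s2] s0; have := key (s - pi).
rewrite sinB s0 cospi sinpi mul0r mulr0 subrr => H.
suff : s - pi = 0 by move=> /eqP; rewrite subr_eq0 => /eqP.
by apply: H => //; apply/andP; split; lra.
Qed.

(** Each open interval of angles contains one zero of the sine, a null set, so each chart accounts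
    for half of the integral over a period. *)
Lemma circle_weight_integral b h : continuous h -> has_period (pi *+ 2) h ->
  (forall s, 0 <= h s) ->
  (\int[mu]_(s in circle_angles b) (h s * circle_weight s)%:E =
   (2^-1 * int_per (pi *+ 2) h)%:E)%E.
Proof.
move=> ch ph h0; have mh : measurable_fun setT h by exact: continuous_measurable_fun.
have c2 : continuous (fun s => 2^-1 * h s).
  by move=> s; apply: cvgM; [exact: cvg_cst|exact: ch].
rewrite -int_perZ // -(@circle_angles_integral b) //; last first.
  by move=> s; rewrite ph.
apply: ge0_ae_eq_integral.
- exact: measurable_circle_angles.
- apply/measurable_EFinP/measurable_funTS; apply: measurable_funM => //.
  exact: measurable_circle_weight.
- by apply/measurable_EFinP/measurable_funTS; exact: continuous_measurable_fun.
- by move=> s _; rewrite lee_fin mulr_ge0 // circle_weight_ge0.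
- by move=> s _; rewrite lee_fin mulr_ge0.
exists [set (if b then pi else 0)]; split => //; first exact: lebesgue_measure_set1.
move=> s /= /not_implyP [bs H]; apply: (sin_eq0_circle_angles bs).
apply: contrapT => s0; apply: H; congr EFin.
by rewrite mulrC /circle_weight indicE memNset // addr0 mulr1.
Qed.

End circle_volume.

(** * The volume of M and the integral of a function of the angle *)

Section manifold_volume.
Context {R : realType} {e : nat} (M : rmanifold R e).
Hypothesis cM : compact_riemannian M.
Implicit Types (m j : chart_index M).

Notation im_ m := (chart_im (atlas M m)).
Notation dom_ m := (dom (atlas M m)).
Notation param_ m := (param (atlas M m)).
Notation metric_ m := (metric (atlas M m)).

Let weight m (y : 'rV[R]_e) : R := (chart_multiplicity (param_ m y))%:R^-1.

Let oi m : open (im_ m).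
Proof. exact: (chart_im_open cM). Qed.

Lemma chart_multiplicity_gt0 (p : M) : (0 < chart_multiplicity p)%N.
Proof.
have [i pi] := atlas_cover cM p; apply/card_gt0P; exists i; exact: mem_set.
Qed.

(** In a chart, the multiplicity is a finite sum of indicators of open sets. *)
Lemma measurable_weight m : measurable_fun (@rowt R e @^-1` im_ m) (weight m \o @rowt R e).
Proof.
have mim : measurable (@rowt R e @^-1` im_ m) by exact: measurable_rowt_open.
pose U j : set 'rV[R]_e := im_ m `&` (param_ m @^-1` dom_ j).
have oU j : open (U j).
  rewrite openE => y [my jy]; have nd : nbhs (param_ m y) (dom_ j).
    by apply: open_nbhs_nbhs; split=> //; exact: (dom_open cM).
  have ni : nbhs y (im_ m) by apply: open_nbhs_nbhs.
  exact: filterI ni (param_near cM my nd).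
have mU j : measurable (@rowt R e @^-1` U j) by exact: measurable_rowt_open.
apply: (@eq_measurable_fun _ _ _ _ _
  (fun t => (\sum_(j <- enum (chart_index M)) (\1_(@rowt R e @^-1` U j) t : R)) `^ (- 1))).
  move=> t; rewrite inE /= => mt.
  rewrite powR_inv1; last by apply: sumr_ge0 => j _; rewrite indicE.
  congr (_^-1); rewrite /chart_multiplicity -sum1_card natr_sum big_enum [RHS]big_mkcond /=.
  apply: eq_bigr => j _; rewrite indicE inE.
  have -> : (t \in @rowt R e @^-1` U j) = (param_ m (rowt t) \in dom_ j).
    by apply/idP/idP; rewrite !inE => // -[].
  by case: ifP.
apply: (measurableT_comp (@measurable_powR R (- 1))); apply: measurable_sum => j.
exact: measurable_indic.
Qed.

Lemma leint_weight_ge0 m (g : 'rV[R]_e -> R) : (forall y, 0 <= g y) ->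
  (0 <= leint (im_ m) (fun y => (weight m y * g y)%R))%E.
Proof.
by move=> g0; apply: integral_ge0 => t _; rewrite lee_fin mulr_ge0 // invr_ge0.
Qed.

Let vol_measurable m :
  measurable_fun (@rowt R e @^-1` im_ m) (vol_density (metric_ m) \o @rowt R e).
Proof. by apply: measurable_rowt => // x; exact: (chart_volume_continuous cM). Qed.

Lemma measurable_weight_vol m : measurable_fun (@rowt R e @^-1` im_ m)
  ((fun y => weight m y * vol_density (metric_ m) y) \o @rowt R e).
Proof. by apply: measurable_funM; [exact: measurable_weight|exact: vol_measurable]. Qed.

Definition volume : \bar R := vol_int (X := M) (fun=> 1).

Lemma volumeE :
  volume = (\sum_m leint (im_ m) (fun y => (weight m y * vol_density (metric_ m) y)%R))%E.
Proof.
apply: eq_bigr => m _; apply: eq_leint => y _.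
by rewrite /local_rep /= mul1r.
Qed.

Lemma volume_fin : (volume < +oo)%E.
Proof.
rewrite volumeE; apply: lte_sum_pinfty => m _.
apply: le_lt_trans (chart_volume_fin cM m); apply: ge0_le_integral => //.
- exact: measurable_rowt_open.
- by move=> t _; rewrite lee_fin mulr_ge0 ?invr_ge0 // sqrtr_ge0.
- by apply/measurable_EFinP; exact: measurable_weight_vol.
- by apply/measurable_EFinP; exact: vol_measurable.
move=> t _; rewrite lee_fin ler_piMl ?sqrtr_ge0 // invf_le1 ?ler1n ?ltr0n;
  exact: chart_multiplicity_gt0.
Qed.

(** A strict inequality between integrals over the circle must stay strict after multiplication by
    the volume. A small box in one chart, with density and weight bounded below, already contributes
    a positive amount. *)
Lemma volume_gt0 : (0 < volume)%E.
Proof.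
have [p _] := space_nonempty cM; have [m pm] := atlas_cover cM p.
rewrite volumeE (bigD1 m) //=.
suff H : (0 < leint (im_ m) (fun y => (weight m y * vol_density (metric_ m) y)%R))%E.
  apply: lte_paddr => //; apply: sume_ge0 => j _; apply: leint_weight_ge0 => y.
  exact: sqrtr_ge0.
pose y0 := Defs.coord (atlas M m) p; have my0 : im_ m y0 by exists p.
pose v := vol_density (metric_ m) y0; have v0 : 0 < v := chart_volume_gt0 cM my0.
have nv : \forall y \near y0, im_ m y /\ v / 2 <= vol_density (metric_ m) y.
  have ni : nbhs y0 (im_ m) by apply: open_nbhs_nbhs.
  have nv : nbhs y0 [set y | v / 2 < vol_density (metric_ m) y].
    have := chart_volume_continuous cM my0 => /(_ [set s | v / 2 < s]); apply.
    apply: open_nbhs_nbhs; split; first exact: open_gt.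
    by rewrite /= ltr_pdivrMr // mulr_natr mulr2n ltrDl.
  by apply: filterS (filterI ni nv) => y [? /ltW].
move: nv => /nbhs_ballP [r /= r0 rP].
have r20 : 0 < r / 2 by rewrite divr_gt0.
pose B := rowt_box (y0 0) (r / 2).
have BP t : B t -> im_ m (rowt t) /\ v / 2 <= vol_density (metric_ m) (rowt t).
  move=> Bt; apply: rP; rewrite mx_norm_ball /ball_ /=.
  apply: (@le_lt_trans _ _ (r / 2)); last by rewrite ltr_pdivrMr // mulr_natr mulr2n ltrDl.
  by apply/row_norm_le => [|a]; [exact: ltW|rewrite !mxE distrC; exact: Bt].
(* A point lies in at most all the charts, which bounds the weight below; the density is at least v
   / 2 on the box. *)
pose c : R := #|chart_index M|%:R^-1 * (v / 2).
have i0 : (0 < #|chart_index M|)%N by apply/card_gt0P; exists m.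
have c0 : 0 < c by rewrite mulr_gt0 ?invr_gt0 ?ltr0n // divr_gt0.
have mB : measurable B by exact: measurable_rowt_box.
apply: (@lt_le_trans _ _ (\int[leb R e]_(t in B) c%:E)%E).
  have lB : leb R e B = ((2 * (r / 2)) ^+ e)%:E by apply: leb_rowt_box; exact: ltW.
  have -> : (\int[leb R e]_(t in B) c%:E = (c * (2 * (r / 2)) ^+ e)%:E)%E.
    by rewrite integral_cst // [RHS]EFinM; exact: (congr1 (fun z => c%:E * z)%E lB).
  by rewrite lte_fin mulr_gt0 // exprn_gt0 // mulr_gt0.
have mf := @measurable_weight_vol m.
have Bsub : B `<=` @rowt R e @^-1` im_ m by move=> t /BP [].
apply: (@le_trans _ _ (\int[leb R e]_(t in B)
    (weight m (rowt t) * vol_density (metric_ m) (rowt t))%:E)%E).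
  apply: ge0_le_integral => //.
  - by move=> t _; rewrite lee_fin ltW.
  - apply/measurable_EFinP; apply: measurable_funS mf => //.
    exact: measurable_rowt_open.
  move=> t /BP [_ vt]; rewrite lee_fin /c ler_pM //.
    by rewrite ltW // divr_gt0.
  rewrite lef_pV2 ?posrE ?ltr0n ?chart_multiplicity_gt0 // ler_nat.
  exact: max_card.
apply: ge0_subset_integral => //.
- exact: measurable_rowt_open.
- exact/measurable_EFinP.
by move=> t _; rewrite lee_fin mulr_ge0 ?invr_ge0 // sqrtr_ge0.
Qed.

Notation N := (rprod (S1 R) M).

Lemma chart_multiplicity_prod s (y : M) : chart_multiplicity (X := N) (circle_pt s, y) =
  (circle_multiplicity s * chart_multiplicity y)%N.
Proof.
rewrite /circle_multiplicity /chart_multiplicity -cardX; apply: eq_card => -[b m].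
by rewrite !inE in_setX.
Qed.

(** Multiplicity and density both factor over the product, so Tonelli applies in each chart; the two
    circle charts contribute half each. *)
Lemma vol_int_circle_lift (h : R -> R) : continuous h -> has_period (pi *+ 2) h ->
  (forall s, 0 <= h s) ->
  vol_int (circle_lift (M := M) h) = ((int_per (pi *+ 2) h)%:E * volume)%E.
Proof.
move=> ch ph h0.
have I0 : 0 <= int_per (pi *+ 2) h by exact: int_per_ge0.
have rep b m : chart_int (X := N) (b, m) (local_rep (X := N) (b, m)
    (fun p => circle_lift h p / (chart_multiplicity p)%:R)) =
   ((2^-1 * int_per (pi *+ 2) h)%:E *
    leint (im_ m) (fun y => (weight m y * vol_density (metric_ m) y)%R))%E.
  rewrite -(circle_weight_integral b ch ph h0) -leint_product.
  - rewrite /chart_int circle_chart_set circle_chart_metric; apply: eq_leint => x _.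
    have -> : local_rep (X := N) (b, m) (fun p => circle_lift h p / (chart_multiplicity p)%:R) x
        = h (head x) / (circle_multiplicity (head x) * chart_multiplicity (param_ m (rsubmx x)))%:R.
      rewrite -chart_multiplicity_prod -(circle_lift_pt _ (param_ m (rsubmx x)) ph).
      by case: b.
    by rewrite vol_density_product natrM invfM -circle_weightE /weight !mulrA.
  - exact: measurable_circle_angles.
  - exact: measurable_rowt_open.
  - apply: measurable_funM; first exact: continuous_measurable_fun.
    exact: measurable_circle_weight.
  - by move=> s; rewrite mulr_ge0 // circle_weight_ge0.
  - exact: measurable_weight_vol.
  - by move=> y _; rewrite mulr_ge0 ?invr_ge0 // sqrtr_ge0.
transitivity (\sum_(b : bool) \sum_m chart_int (X := N) (b, m) (local_rep (X := N) (b, m)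
    (fun p => (circle_lift h p / (chart_multiplicity p)%:R)%R)))%E.
  rewrite pair_bigA /=; apply: eq_bigr => -[b m] _ //.
under eq_bigr do under eq_bigr do rewrite rep.
rewrite big_bool /= -ge0_sume_distrr -?volumeE; last first.
  by move=> m _; apply: leint_weight_ge0 => y; exact: sqrtr_ge0.
rewrite -ge0_muleDl ?lee_fin ?mulr_ge0 ?invr_ge0 // -EFinD; congr (EFin _ * _)%E.
by field.
Qed.

End manifold_volume.

(** * Exponents, constant solutions and conclusion *)

Section exponents.
Context {R : realType} (n : nat).
Hypothesis n5 : (5 <= n)%N.

Let n4 : 0 < n%:R - 4 :> R.
Proof. by rewrite subr_gt0 ltr_nat. Qed.

Lemma two_sharp_gt2 : 2 < two_sharp n :> R.
Proof. by rewrite /two_sharp ltr_pdivlMr // natrM; lra. Qed.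

(** Identifies the exponent 1 / (q - 1) of the one-dimensional problem with the one in
    [constant_solution]. *)
Lemma two_sharp_sub2V : (two_sharp n - 1 - 1)^-1 = (n%:R - 4) / 8 :> R.
Proof.
have -> : two_sharp n - 1 - 1 = 8 / (n%:R - 4) :> R.
  by rewrite /two_sharp natrM; field; exact: lt0r_neq0.
by rewrite invf_div.
Qed.

End exponents.

Lemma antideriv_cst_eq0 (R : realType) (c : R) (f : R -> R) :
  antideriv (fun=> c) f -> f = fun=> 0.
Proof.
move=> cf; apply/funext => s.
have [_ <-] := cf s; have [_ <-] := antideriv_cst c s.
by [].
Qed.

(** For a constant the equation reads c^(q - 1) = a^2 / 4. It serves to exclude that the solution
    found is constant. *)
Lemma constant_ode_solution (R : realType) (a q c : R) (V1 V2 V3 : R -> R) : 1 < q -> 0 < c ->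
  [/\ antideriv (fun=> c) V1, antideriv V1 V2, antideriv V2 V3 &
      antideriv V3 (fun s => a * V2 s - a ^+ 2 / 4 * c + c `^ q)] ->
  c = (a ^+ 2 / 4) `^ (q - 1)^-1.
Proof.
move=> q1 c0 [/antideriv_cst_eq0 -> /antideriv_cst_eq0 -> /antideriv_cst_eq0 ->].
move=> /antideriv_cst_eq0 /(congr1 (fun f => f 0)) /=; rewrite mulr0 sub0r => H.
have -> : a ^+ 2 / 4 = c `^ (q - 1).
  apply: (mulIf (lt0r_neq0 c0)); rewrite -[X in _ = _ * X]powRr1 ?ltW //.
  by rewrite -powRD ?subrK ?gt_eqF ?implybT //; lra.
by rewrite -powRrM divff ?powRr1 ?ltW // subr_eq0 gt_eqF.
Qed.

Theorem mainTheorem4 (R : realType) (n : nat) (M : rmanifold R n.-1) :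
  (5 <= n)%N -> compact_riemannian M ->
  exists alpha : nat -> R,
    [/\ forall k, 0 < alpha k,
        alpha k @[k --> \oo] --> +oo &
        forall k,
          (exists u : rprod (S1 R) M -> R,
             [/\ smooth_fun u,
                 forall p, 0 < u p,
                 classical_solution (alpha k) (two_sharp n - 1) u &
                 ~ exists c, forall p, u p = c]) /\
          (least_energy n (rprod (S1 R) M) (alpha k) <
           energy n (X := rprod (S1 R) M)
             (fun=> constant_solution n (alpha k)))%E].
Proof.
move=> n5 cM; set q : R := two_sharp n - 1.
have q1 : 1 < q by rewrite ltrBrDr; exact: two_sharp_gt2.
have qE : q + 1 = two_sharp n by rewrite subrK.
have pi2_gt0 : 0 < (pi : R) *+ 2 by rewrite pmulrn_lgt0 ?pi_gt0.
have [a0 a0_gt0 sol] := periodic_solution q1.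
(* Every parameter from [a0] on is admissible; any sequence there tending to infinity would do. *)
exists (fun k => a0 + k%:R); split.
- by move=> k; rewrite ltr_wpDr.
- apply: (@ger_cvgy _ _ _ _ (fun k => k%:R)); last exact: cvgr_idn.
  by apply: nearW => k; rewrite lerDr ltW.
move=> k; set a := a0 + k%:R.
have [|V [V1 [V2 [V3 [V0 pV ode low]]]]] := sol a; first by rewrite lerDl.
have cV : continuous V by case: ode => /antideriv_continuous.
have constE : (a ^+ 2 / 4) `^ (q - 1)^-1 = constant_solution n a.
  by rewrite /constant_solution two_sharp_sub2V.
rewrite constE in low.
have pE : has_period (pi *+ 2) (fun s => V s `^ (q + 1)) by move=> s; rewrite pV.
have cE : continuous (fun s => V s `^ (q + 1)).
  move=> s; apply: (@continuous_comp _ _ _ V (fun z => z `^ (q + 1))); first exact: cV.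
  by apply: differentiable_continuous; apply/derivable1_diffP;
    have [] := is_derive1_powR (q + 1) (V0 s).
have u_energy : energy n (circle_lift (M := M) V) =
    ((int_per (pi *+ 2) (fun s => V s `^ (q + 1)))%:E * volume M)%E.
  have <- := vol_int_circle_lift cM cE pE (fun s => powR_ge0 (V s) (q + 1)).
  apply: (congr1 (@vol_int _ _ _)); apply/funext => p.
  by rewrite /circle_lift qE ger0_norm //; exact: ltW.
have [c cP] : exists c, c = constant_solution n a :> R by exists (constant_solution n a).
rewrite -cP in low constE *.
have c_energy : energy n (X := rprod (S1 R) M) (fun=> c) =
    ((pi *+ 2 * c `^ (q + 1))%:E * volume M)%E.
  have <- : int_per (pi *+ 2) (fun=> c `^ (q + 1)) = pi *+ 2 * c `^ (q + 1).
    by rewrite int_per_cst // mulrC.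
  have cc : continuous (fun _ : R => c `^ (q + 1)) by exact: cst_continuous.
  have pc : has_period (pi *+ 2) (fun=> c `^ (q + 1)) by [].
  have <- := vol_int_circle_lift cM cc pc (fun=> powR_ge0 c (q + 1)).
  apply: (congr1 (@vol_int _ _ _)); apply/funext => p.
  by rewrite /circle_lift qE ger0_norm // cP; exact: powR_ge0.
split.
  exists (circle_lift V); split.
  - exact: (circle_lift_smooth V0 pV ode).
  - by move=> p; exact: V0.
  - exact: (circle_lift_classical cM pV ode).
  (* If [u] were constant, then so would be V, with the value of the constant solution, and [low]
     would compare a number with itself. A point of [M] is needed to recover V from [u]. *)
  move=> [c' uc]; have [y _] := space_nonempty cM.
  have VE : V = fun=> c'.
    by apply/funext => s; rewrite -(uc (circle_pt s, y)) circle_lift_pt.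
  have c'0 : 0 < c' by have := V0 0; rewrite VE.
  have c'E : c' = (a ^+ 2 / 4) `^ (q - 1)^-1.
    by apply: (@constant_ode_solution _ a q c' V1 V2 V3) => //; move: ode; rewrite VE.
  by move: low; rewrite VE -constE -c'E int_per_cst // mulrC ltxx.
rewrite c_energy; apply: (@le_lt_trans _ _ (energy n (circle_lift (M := M) V))).
  apply: ereal_inf_lbound; exists (circle_lift V) => //; split.
  - exact: (circle_lift_sobolev22 cM V0 pV ode).
  - exact: circle_lift_ae_positive.
  - exact: (circle_lift_weak cM V0 pV ode).
(* Both energies carry the factor [volume M], which cancels from the strict inequality because it is
   positive and finite. *)
rewrite u_energy lte_pmul2r ?lte_fin //; last exact: volume_gt0.
by rewrite ge0_fin_numE ?volume_fin // ltW // volume_gt0.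
Qed.
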